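(* Let $d\ge 3$ be an integer and let $p\in\mathbf{N}$. The line bundle $\mathcal{O}_{\mathbf{P}^1\times\cdots\times\mathbf{P}^1}(1,\dots,1)$ ($d$ factors) satisfies Property $N_p$ if and only if $p\le 3$.
   Context: Everything is over $\mathbf{C}$. The line bundle $\mathcal{O}(1,\dots,1)$ on a product of $d$ projective spaces is the tensor product of the pullbacks of $\mathcal{O}(1)$ from the factors. Property $N_p$ (Green–Lazarsfeld), $p\in\mathbf{N}=\{0,1,2,\dots\}$: let $Y$ be a smooth complex projective variety and $L$ a very ample line bundle on $Y$, defining an embedding $Y\hookrightarrow \mathbf{P}(H^0(Y,L)^* )$. Let $S=\mathrm{Sym}^* H^0(Y,L)$ be the homogeneous coordinate ring of this projective space, and let $G=\bigoplus_{n} H^0(Y,L^{n})$, a graded $S$-module. Let $$0\to E_n\to E_{n-1}\to\cdots\to E_0\to G\to 0$$ be a minimal graded free resolution of $G$ over $S$. Then $L$ satisfies Property $N_p$ if and only if $E_0=S$ and, for every $1\le i\le p$, $E_i$ is a (possibly zero) direct sum of copies of $S(-i-1)$. *)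

(* Defs.v *)
From HB Require Import structures.
From mathcomp Require Import all_boot all_order all_algebra.
From mathcomp Require Import reals.
From mathcomp Require Import complex.
From mathcomp Require Import mpoly.

Set Implicit Arguments.
Unset Strict Implicit.
Unset Printing Implicit Defensive.

Import GRing.Theory.
Local Open Scope ring_scope.

(* Property N_p.  The powers of L enter through H, where H n is H^0(Y, L^n)
   realised as a space of functions on a set X (for instance, the complement of
   the zero section in L^-1, or a cover of it such as [multicone] below); the
   product of sections is then the pointwise product of functions. *)
Section PropertyN.
Variables (F : closedFieldType) (X : Type) (H : nat -> (X -> F) -> Prop).

(* A basis s of H^0(Y, L) identifies Sym^* H^0(Y, L) with {mpoly F[N]}; the
   polynomial q acts on G as multiplication by q(s). *)
Definition is_basis (N : nat) (s : 'I_N -> X -> F) : Prop :=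
  [/\ forall k, H 1 (s k),
      forall c : 'I_N -> F,
        (forall x, \sum_k c k * s k x = 0) -> forall k, c k = 0
    & forall f, H 1 f ->
        exists c : 'I_N -> F, forall x, f x = \sum_k c k * s k x].

(* E_i is the direct sum over j of S(- twist i j), with elements written as row
   vectors, and diff i is the matrix of E_(i+1) -> E_i, acting on the right.
   The map E_0 -> G sends the j-th basis vector to aug j.  Since G vanishes in
   negative degrees, so do the generators of a minimal resolution; hence the
   twists are taken in nat. *)
Record augmented_complex (N : nat) := AugmentedComplex {
  rank : nat -> nat;
  twist : forall i, 'I_(rank i) -> nat;
  diff : forall i, 'M[{mpoly F[N]}]_(rank i.+1, rank i);
  aug : 'I_(rank 0) -> X -> F
}.

Section Resolution.
Variables (N : nat) (s : 'I_N -> X -> F) (E : augmented_complex N).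

Definition in_degree (i n : nat) (u : 'rV[{mpoly F[N]}]_(rank E i)) : Prop :=
  forall j m, m \in msupp (u 0 j) -> (mdeg m + twist j)%N = n.

Definition augment (u : 'rV[{mpoly F[N]}]_(rank E 0)) (x : X) : F :=
  \sum_j (u 0 j).@[fun k => s k x] * aug j x.

Definition graded : Prop :=
  (forall j : 'I_(rank E 0), H (twist j) (aug j)) /\
  (forall i (j : 'I_(rank E i.+1)), in_degree (twist j) (row j (diff E i))).

(* Exactness at G and E_0 is imposed degree by degree, G being a direct sum. *)
Definition exact_complex : Prop :=
  [/\ forall n f, H n f ->
        exists2 u, in_degree n u & forall x, augment u x = f x,
      forall n (u : 'rV_(rank E 0)), in_degree n u ->
        ((forall x, augment u x = 0) <-> exists v, u = v *m diff E 0)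
    & forall i (u : 'rV_(rank E i.+1)),
        u *m diff E i = 0 <-> exists v, u = v *m diff E i.+1].

Definition finite_length : Prop :=
  exists n, forall i, (n < i)%N -> rank E i = 0%N.

(* diff maps E_(i+1) into (z_1, ..., z_N) E_i. *)
Definition minimal : Prop := forall i j k, (diff E i j k)@_(0%MM) = 0.

Definition minimal_graded_free_resolution : Prop :=
  [/\ graded, exact_complex, finite_length & minimal].

End Resolution.

Definition property_N (p : nat) : Prop :=
  exists (N : nat) (s : 'I_N -> X -> F) (E : augmented_complex N),
    [/\ is_basis s,
        minimal_graded_free_resolution s E,
        rank E 0 = 1%N /\ (forall j : 'I_(rank E 0), twist j = 0%N)
      & forall i, (1 <= i <= p)%N ->
          forall j : 'I_(rank E i), twist j = i.+1].

End PropertyN.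

(* Row i of a point of the multicone is a vector of homogeneous coordinates on
   the i-th factor of (P^r)^d. *)
Definition multicone (F : closedFieldType) (d r : nat) : Type :=
  {x : 'M[F]_(d, r.+1) | [forall i, row i x != 0]}.

Section LineBundles.
Variables (F : closedFieldType) (d r : nat).

Definition eval_at (g : {mpoly F[d * r.+1]}) (x : multicone F d r) : F :=
  g.@[fun k => mxvec (val x) 0 k].

(* Locally a quotient of polynomials.  The Zariski neighbourhood of x can be
   taken to be {h != 0}: shrink it to a basic open set {u != 0} and multiply
   numerator and denominator by u. *)
Definition regular (f : multicone F d r -> F) : Prop :=
  forall x, exists g h : {mpoly F[d * r.+1]},
    eval_at h x != 0 /\
    forall y, eval_at h y != 0 -> f y = eval_at g y / eval_at h y.

Definition multihomogeneous (a : 'I_d -> nat) (f : multicone F d r -> F) : Prop :=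
  forall (x y : multicone F d r) (t : 'rV[F]_d),
    (forall i, t 0 i != 0) -> val y = diag_mx t *m val x ->
    f y = (\prod_i t 0 i ^+ a i) * f x.

(* H^0((P^r)^d, O(a_1, ..., a_d)): the fibre of O(-1) over a point of P^r is the
   line it represents, so a section of O(a_1, ..., a_d) is a regular function on
   the multicone which is homogeneous of degree a_i in the i-th row. *)
Definition H0_O (a : 'I_d -> nat) (f : multicone F d r -> F) : Prop :=
  regular f /\ multihomogeneous a f.

(* Property N_p for L = O(a_1, ..., a_d) on (P^r)^d; L^n = O(n a_1, ..., n a_d). *)
Definition O_property_N (a : 'I_d -> nat) (p : nat) : Prop :=
  property_N (fun n => H0_O (fun i => (n * a i)%N)) p.

End LineBundles.
Arguments O_property_N F {d} r a p.

(* Main.v *)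
From HB Require Import structures.
Require Import Defs.
From mathcomp Require Import all_boot all_order all_algebra.
From mathcomp Require Import reals complex.
From mathcomp Require Import zify ring lra boolp.
From mathcomp Require Import mpoly.
Set Implicit Arguments.
Unset Strict Implicit.
Unset Printing Implicit Defensive.
Import Order.TTheory GRing.Theory Num.Theory.
Local Open Scope ring_scope.

(** Let G be the graded ring of the sections of the powers of the line bundle
    on the product of d lines, and V its part of degree one, with a basis of
    2^d monomials.  By the exact sequences of a free resolution of G over
    Sym V, the number of generators of degree p + j of the p-th term of a
    minimal resolution is the dimension of the Koszul homology of G at the
    p-th exterior power of V with coefficients in degree j.  Call it K_{p,j}.
    The theorem then says that K_{p,j} vanishes for p <= 3 and j >= 2, and
    that K_{4,2} does not.  Here K_{p,j} = 0 is [acyclic _ _ _ p j]: the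
    coefficient degree j goes up by one along the Koszul differential while p
    goes down by one.

    The vanishing is proved by induction on d ([seg_vanishingS]), together
    with the vanishing of all K_{p,j} with j > d, which bounds the degrees of
    the generators and so makes the resolutions finite.  The ring of d + 1
    lines is the Segre product of that of d lines with k[x, y], and the Segre
    product with k[x, y] is an exact functor on graded modules.  Applied to
    the minimal resolution of G it gives a resolution of the new ring by
    modules that come from shifts S(-t) of a polynomial ring; such a module
    has no Koszul homology in coefficient degree j >= t + 2, nor for j = t + 1
    when p <= t ([seg_regular], [seg_var_acyclic]).  Following K_{p,j} of the
    new ring along this resolution leads to the Koszul homology of the q-th
    term at the exterior power p - q with coefficients in degree j + q, where
    q <= p.  By induction this term has t = q + 1 for 1 <= q <= 3, so that for
    j >= 2 what is needed is p - q <= q + 1.  For q >= 1 this is implied by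
    p <= 3, and it is here that the bound 3 appears.

    With this vanishing, a minimal resolution can be built step by step from
    minimal generators of the successive syzygy modules.  They are finitely
    generated because the vanishing of Koszul homology at p = 0 in large
    degrees bounds the degrees of the generators ([bounded_generation]), the
    ranks become zero after 2^d steps since the Koszul complex has that
    length ([res_rank_eq0]), and the degrees of the generators are those
    allowed by the nonvanishing Koszul homology ([res_twist]).  Combined with
    the description of the sections as multihomogeneous polynomials
    ([section_is_form], [form_is_section]) this proves Property N_p for
    p <= 3 ([seg_property_N3]).

    Conversely, in a resolution whose p-th term is generated in degree p + 1
    the same exact sequences force K_{p,2} = 0 ([linear_twist_seg_acyclic]).
    But K_{4,2} is not zero.  For three lines an explicit cycle is detected by
    an explicit linear form that vanishes on boundaries
    ([pairing_boundary], [pairing_cube_class]).  For more lines, restriction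
    to the subvariety where the last coordinate is fixed makes the Koszul
    complex of d lines a direct summand of that of d + 1 lines
    ([acyclic_seg_ext]). *)

(** * Koszul complexes *)

Section Complex.
Variables (B : comNzRingType) (l : nat -> B).

(** The element [(a, b)] stands for [a + b e] with [e] the last basis vector of
    the exterior algebra, so that the complex on [n.+1] elements is the cone of
    multiplication by [l n] on the complex on [n] elements. *)
Fixpoint koszul (U : lmodType B) (n : nat) : lmodType B :=
  if n is n'.+1 then (koszul U n' * koszul U n')%type else U.

Variable U : lmodType B.

Fixpoint kd (n : nat) : koszul U n -> koszul U n :=
  if n is n'.+1 then
    fun z => (kd z.1 + l n' *: z.2, - kd z.2)
  else fun=> 0.

(** Exterior degree [p], with all coefficients in the graded piece [D j].  The
    grading is a family of predicates, because the elements of different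
    degrees live in the same module. *)
Fixpoint kdeg (D : int -> U -> Prop) (n : nat) (p j : int) :
    koszul U n -> Prop :=
  if n is n'.+1 then fun z => kdeg D p j z.1 /\ kdeg D (p - 1) j z.2
  else fun z => if p == 0 then D j z else z = 0.

Record graded_module (D : int -> U -> Prop) (n : nat) : Prop := GradedModule {
  gr0 : forall j, D j 0;
  grB : forall j u v, D j u -> D j v -> D j (u - v);
  grZ : forall i j u, (i < n)%N -> D j u -> D (j + 1) (l i *: u)
}.

(** Coefficients of the bounding chain may lie in a module larger than that of
    the cycle: this is how a zero map in homology is expressed. *)
Definition cycles_bound (D' D : int -> U -> Prop) (n : nat) (p j : int) :=
  forall z : koszul U n, kdeg D' p j z -> kd z = 0 ->
    exists2 w, kdeg D (p + 1) (j - 1) w & kd w = z.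

Definition acyclic (D : int -> U -> Prop) := cycles_bound D D.

Lemma kdB n : {morph @kd n : u v / u - v}.
Proof.
elim: n => [|n IHn] u v /=; first by rewrite subr0.
congr (_, _); rewrite /= !IHn ?scalerBr ?opprD //.
by rewrite addrACA.
Qed.

Lemma kd0 n : @kd n 0 = 0.
Proof. by rewrite -[X in kd X](subrr 0) kdB subrr. Qed.

Lemma kdN n u : @kd n (- u) = - kd u.
Proof. by rewrite -sub0r kdB kd0 sub0r. Qed.

Lemma kdD n : {morph @kd n : u v / u + v}.
Proof. by move=> u v; rewrite -{1}[v]opprK kdB kdN opprK. Qed.

Lemma kdZ n a u : @kd n (a *: u) = a *: kd u.
Proof.
elim: n u => [|n IHn] u /=; first by rewrite scaler0.
congr (_, _); rewrite !IHn ?scalerN // scalerDr !scalerA; congr (_ + _ *: _).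
exact: mulrC.
Qed.

Lemma kdK n u : @kd n (kd u) = 0.
Proof.
elim: n u => [|n IHn] u //=.
by rewrite kdD !kdN kdZ !IHn !oppr0 add0r scalerN subrr.
Qed.

Section Degrees.
Variables (D : int -> U -> Prop) (n : nat).
Hypothesis grD : graded_module D n.
Implicit Types (p j : int).

Lemma kdeg0 m p j : @kdeg D m p j 0.
Proof.
elim: m p => [|m IHm] p /=; last by split; apply: IHm.
by case: ifP => // _; apply: gr0 grD _.
Qed.

Lemma kdegB m p j u v :
  @kdeg D m p j u -> kdeg D p j v -> kdeg D p j (u - v).
Proof.
elim: m p u v => [|m IHm] p u v /=.
  by case: ifP => _; [apply: grB grD _ _ _ | move=> -> ->; rewrite subr0].
by case=> u1 u2 [v1 v2]; split; apply: IHm.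
Qed.

Lemma kdegN m p j u : @kdeg D m p j u -> kdeg D p j (- u).
Proof. by move=> Du; rewrite -sub0r; apply: kdegB => //; apply: kdeg0. Qed.

Lemma kdegD m p j u v :
  @kdeg D m p j u -> kdeg D p j v -> kdeg D p j (u + v).
Proof. by move=> Du /kdegN; rewrite -{2}[v]opprK; apply: kdegB. Qed.

Lemma kdegZ i m p j u : (i < n)%N ->
  @kdeg D m p j u -> kdeg D p (j + 1) (l i *: u).
Proof.
move=> lt_in; elim: m p u => [|m IHm] p u /=.
  by case: ifP => _; [apply: grZ grD _ _ _ _ | move->; rewrite scaler0].
by case=> u1 u2; split; apply: IHm.
Qed.

Lemma kdeg_kd m p j u : (m <= n)%N ->
  @kdeg D m p j u -> kdeg D (p - 1) (j + 1) (kd u).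
Proof.
elim: m p u => [|m IHm] p u le_mn.
  by move=> _; apply: kdeg0.
case=> u1 u2; split=> /=; last by apply/kdegN/IHm => //; apply: ltnW.
by apply: kdegD; [apply: IHm => //; apply: ltnW | apply: kdegZ].
Qed.

Lemma kdeg_out m p j u : (p < 0) || (p > m%:Z) -> @kdeg D m p j u -> u = 0.
Proof.
elim: m p u => [|m IHm] p u /=.
  by case: ifP => // /eqP-> ; rewrite ltxx.
move=> pm; case: u => a b [/= /IHm ua /IHm ub]; rewrite ua ?ub //; lia.
Qed.

(** Negative exterior degrees are allowed so that the connecting maps below
    need no case distinction. *)
Lemma acyclic_out p j : (p < 0) || (p > n%:Z) -> acyclic D n p j.
Proof.
move=> pn z /(kdeg_out pn)-> _; exists 0; first exact: kdeg0.
exact: kd0.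
Qed.

End Degrees.

Lemma kdeg_sub (D D' : int -> U -> Prop) m p j j' u :
  (forall u, D j u -> D' j' u) -> @kdeg D m p j u -> kdeg D' p j' u.
Proof.
move=> sDD; elim: m p u => [|m IHm] p u /=; first by case: ifP => // _ /sDD.
by case=> u1 u2; split; apply: IHm.
Qed.

End Complex.

Arguments kd {B} l {U n} z.
Arguments kdeg {B U} D {n} p j z.
Arguments graded_module {B} l {U} D n.
Arguments cycles_bound {B} l {U} D' D n p j.
Arguments acyclic {B} l {U} D n p j.

Lemma eq_kd (B : comNzRingType) (l l' : nat -> B) (U : lmodType B) n
    (u : koszul U n) :
  (forall k, (k < n)%N -> l k = l' k) -> kd l u = kd l' u.
Proof.
elim: n u => [|n IHn] u ll' //=; rewrite ll' //.
by rewrite !IHn // => k lt_kn; apply/ll'/ltnW.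
Qed.

Lemma eq_acyclic (B : comNzRingType) (l l' : nat -> B) (U : lmodType B)
    (D : int -> U -> Prop) n p j :
  (forall k, (k < n)%N -> l k = l' k) -> acyclic l D n p j -> acyclic l' D n p j.
Proof.
move=> ll' acD z Dz dz; have [|w Dw dw] := acD z Dz; first by rewrite (eq_kd z ll').
by exists w; rewrite -?(eq_kd w ll').
Qed.

Section Functoriality.
Variables (B B' : comNzRingType) (U : lmodType B) (U' : lmodType B').

Fixpoint kmap (f : U -> U') n : koszul U n -> koszul U' n :=
  if n is n'.+1 then fun z => (kmap f z.1, kmap f z.2) else f.

Variable f : U -> U'.
Hypothesis fB : {morph f : u v / u - v}.

Let f0 : f 0 = 0. Proof. by have := fB 0 0; rewrite !subrr. Qed.

Lemma kmapB n : {morph @kmap f n : u v / u - v}.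
Proof. by elim: n => [|n IHn] u v //=; rewrite !IHn. Qed.

Lemma kmap0 n : @kmap f n 0 = 0.
Proof. by rewrite -[X in kmap _ X](subrr 0) kmapB subrr. Qed.

Lemma kmapN n u : @kmap f n (- u) = - kmap f u.
Proof. by rewrite -sub0r kmapB kmap0 sub0r. Qed.

Lemma kmapD n : {morph @kmap f n : u v / u + v}.
Proof. by move=> u v; rewrite -{1}[v]opprK kmapB kmapN opprK. Qed.

Lemma kmapZ n a a' u : (forall u, f (a *: u) = a' *: f u) ->
  @kmap f n (a *: u) = a' *: kmap f u.
Proof.
by move=> fZ; elim: n u => [|n IHn] u //=; rewrite !IHn.
Qed.

Lemma kdeg_kmap (D : int -> U -> Prop) (D' : int -> U' -> Prop) n p j j' (u : koszul U n) :
  (forall u, D j u -> D' j' (f u)) ->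
  kdeg D p j u -> kdeg D' p j' (kmap f u).
Proof.
move=> fD; elim: n p u => [|n IHn] p u /=.
  case: ifP => _; first exact: fD.
  by move->; rewrite f0.
by case=> u1 u2; split; apply: IHn.
Qed.

Lemma kmap_surj (D : int -> U -> Prop) (D' : int -> U' -> Prop) n p j j' (v : koszul U' n) :
  (forall v, D' j' v -> exists2 u, D j u & f u = v) ->
  kdeg D' p j' v -> exists2 u, kdeg D p j u & kmap f u = v.
Proof.
move=> surjf; elim: n p v => [|n IHn] p v /=.
  case: ifP => _; first exact: surjf.
  by move->; exists 0 => //; rewrite f0.
case: v => v1 v2 [/= /IHn[u1 Du1 <-] /IHn[u2 Du2 <-]].
by exists (u1, u2).
Qed.

Lemma kmap_eq0 (D D' : int -> U -> Prop) n p j j' (u : koszul U n) :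
  (forall u, D j u -> f u = 0 -> D' j' u) ->
  kdeg D p j u -> kmap f u = 0 -> kdeg D' p j' u.
Proof.
move=> DD'; elim: n p u => [|n IHn] p u /=; first by case: ifP => // _; apply: DD'.
by case: u => u1 u2 [D1 D2] [fu1 fu2]; split; apply: IHn.
Qed.

Lemma kmap_ker (D : int -> U -> Prop) n p j (u : koszul U n) :
  (forall u, D j u -> f u = 0) -> kdeg D p j u -> kmap f u = 0.
Proof.
move=> fD; elim: n p u => [|n IHn] p u /=.
  by case: ifP => _; [apply: fD | move->; rewrite f0].
by case=> /IHn-> /IHn->.
Qed.

End Functoriality.

Arguments kmap {B B' U U'} f {n} u.

Lemma kmap_comp (B B' B'' : comNzRingType) (U : lmodType B) (U' : lmodType B')
    (U'' : lmodType B'') (g : U' -> U'') (f : U -> U') n u :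
  kmap g (@kmap _ _ _ _ f n u) = kmap (g \o f) u.
Proof. by elim: n u => [|n IHn] u //=; rewrite !IHn. Qed.

Lemma kmap_id (B : comNzRingType) (U : lmodType B) (f : U -> U) n u :
  f =1 id -> @kmap _ _ _ _ f n u = u.
Proof. by move=> fid; elim: n u => [|n IHn] u //=; rewrite !IHn; case: u. Qed.

Lemma kmap_scale (B : comNzRingType) (U : lmodType B) a n (u : koszul U n) :
  kmap ( *:%R a) u = a *: u.
Proof. by elim: n u => [|n IHn] u //=; rewrite !IHn. Qed.

Section DegreeZero.
Variables (B : comNzRingType) (l : nat -> B).

Fixpoint kemb (U : lmodType B) n (u : U) : koszul U n :=
  if n is n'.+1 then (kemb n' u, 0) else u.

Lemma kdeg_kemb (U : lmodType B) (D : int -> U -> Prop) n j u :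
  graded_module l D 0 -> D j u -> kdeg D 0 j (kemb n u).
Proof.
move=> grD Du; elim: n => [|n IHn] //=; split=> //.
exact: (kdeg0 grD).
Qed.

Lemma kdeg0P (U : lmodType B) (D : int -> U -> Prop) n j (z : koszul U n) :
  kdeg D 0 j z -> exists2 u, D j u & z = kemb n u.
Proof.
elim: n z => [|n IHn] z /=; first by exists z.
case: z => a b [/= /IHn[u Du ->] /kdeg_out-> //]; by exists u.
Qed.

Lemma kd_kemb (U : lmodType B) n (u : U) : kd l (kemb n u) = 0.
Proof.
elim: n => [|n IHn] //=; rewrite IHn kd0 scaler0 addr0 oppr0.
by [].
Qed.

Lemma kemb_inj (U : lmodType B) n : injective (@kemb U n).
Proof. by elim: n => [|n IHn] u v //= [/IHn]. Qed.

Lemma kd_trivial (U : lmodType B) n (z : koszul U n) :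
  (forall k (u : U), l k *: u = 0) -> kd l z = 0.
Proof.
move=> l0; have kl0 k m (u : koszul U m) : l k *: u = 0.
  by elim: m u => [|m IHm] u //=; case: u => a b; congr (_, _); apply: IHm.
by elim: n z => [|n IHn] z //=; rewrite !IHn kl0 addr0 oppr0.
Qed.

End DegreeZero.

Lemma kmap_kemb (B B' : comNzRingType) (U : lmodType B) (U' : lmodType B')
    (f : U -> U') n u :
  f 0 = 0 -> kmap f (kemb n u) = kemb n (f u).
Proof.
move=> f0; elim: n => [|n IHn] //=; rewrite IHn; congr (_, _).
by elim: n {IHn} => //= n ->.
Qed.

(** * Long exact sequences *)

Lemma cycles_bound_sub (B : comNzRingType) (l : nat -> B) (U : lmodType B)
    (D' D E' E : int -> U -> Prop) n p j :
    (forall j u, E' j u -> D' j u) -> (forall j u, D j u -> E j u) ->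
  cycles_bound l D' D n p j -> cycles_bound l E' E n p j.
Proof.
move=> E'D' DE bnd z Ez dz; have [w Dw dw] := bnd z (kdeg_sub (@E'D' _) Ez) dz.
by exists w => //; apply: (kdeg_sub (@DE _) Dw).
Qed.

Section ShortExact.
Variables (B B' : comNzRingType) (l : nat -> B) (l' : nat -> B').
Variables (U : lmodType B) (U' : lmodType B').
Variables (D : int -> U -> Prop) (D' : int -> U' -> Prop) (n : nat).
Variable f : int -> U -> U'.
Hypothesis grD : graded_module l D n.
Hypothesis fB : forall j, {morph f j : u v / u - v}.
Hypothesis fZ : forall i j u, (i < n)%N -> D j u ->
  f (j + 1) (l i *: u) = l' i *: f j u.
Hypothesis fD : forall j u, D j u -> D' j (f j u).

Definition gker (j : int) (u : U) : Prop := D j u /\ f j u = 0.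

Let f0 j : f j 0 = 0. Proof. by have := fB j 0 0; rewrite !subrr. Qed.

Lemma kd_kmap m p j u : (m <= n)%N -> kdeg D p j u ->
  kd l' (kmap (f j) u) = kmap (f (j + 1)) (@kd _ l _ m u).
Proof.
have fZ0 i m' p' u' : (i < n)%N -> kdeg D p' j u' ->
    kmap (f (j + 1)) (l i *: u' : koszul U m') = l' i *: kmap (f j) u'.
  move=> lt_in; elim: m' p' u' => [|m' IHm] p' u' /=.
    case: ifP => _; first exact: fZ.
    by move->; rewrite scaler0 !f0 scaler0.
  by case=> D1 D2; rewrite (IHm _ _ D1) (IHm _ _ D2).
elim: m p u => [|m IHm] p u lt_mn /=.
  by rewrite f0.
case=> D1 D2; rewrite (IHm _ _ (ltnW lt_mn) D1) (IHm _ _ (ltnW lt_mn) D2).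
by rewrite (kmapD (fB _)) (kmapN (fB _)) (fZ0 _ _ _ _ _ D2).
Qed.

Lemma graded_gker : graded_module l gker n.
Proof.
split=> [j|j u v [Du fu] [Dv fv]|i j u lt_in [Du fu]].
- by split; [apply: gr0 grD _ | apply: f0].
- by split; [apply: grB grD _ _ _ Du Dv | rewrite fB fu fv subrr].
by split; [apply: grZ grD _ _ _ _ Du | rewrite fZ // fu scaler0].
Qed.

Hypothesis f_surj : forall j v, D' j v -> exists2 u, D j u & f j u = v.

(** The part of the long exact sequence of [0 -> ker f -> D -> D' -> 0] that
    bounds the homology of the quotient by that of the two other terms. *)
Lemma acyclic_coker p j :
  acyclic l D n p j -> acyclic l gker n (p - 1) (j + 1) -> acyclic l' D' n p j.
Proof.
move=> acD acK z Dz dz.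
have [u Du fu] := kmap_surj (fB j) (@f_surj j) Dz.
have Ddu : kdeg D (p - 1) (j + 1) (kd l u) by apply: kdeg_kd grD _ _ _ _ _ Du.
have Kdu : kdeg gker (p - 1) (j + 1) (kd l u).
  apply: (kmap_eq0 (f := f (j + 1)) _ Ddu) => [v Dv fv|]; first by split.
  by rewrite -(kd_kmap (leqnn n) Du) fu.
have [w Kw dw] := acK _ Kdu (kdK _ _).
rewrite subrK addrK in Kw.
have Dw : kdeg D p j w by apply: kdeg_sub Kw => v [].
have [||y Dy dy] := acD (u - w).
  exact (kdegB grD Du Dw).
- by rewrite kdB dw subrr.
exists (kmap (f (j - 1)) y); first exact (kdeg_kmap (fB _) (@fD _) Dy).
have := kd_kmap (leqnn n) Dy; rewrite subrK => ->.
have kw0 : kmap (f j) w = 0 by apply: (kmap_ker (fB j) _ Kw) => v [].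
by rewrite dy (kmapB (fB _)) fu kw0 subr0.
Qed.

(** The part of the same sequence that bounds the homology of the kernel: it is
    enough that its homology maps to zero in that of [D]. *)
Lemma acyclic_gker p j :
    acyclic l' D' n (p + 1) (j - 1) ->
    cycles_bound l gker D n p j ->
  acyclic l gker n p j.
Proof.
move=> acD' acD z Kz dz; have [y Dy dy] := acD z Kz dz.
have kz0 : kmap (f j) z = 0 by apply: (kmap_ker (fB j) _ Kz) => v [].
have := kd_kmap (leqnn n) Dy; rewrite subrK dy kz0 => dfy.
have [||v Dv dv] := acD' (kmap (f (j - 1)) y) => //.
  exact (kdeg_kmap (fB _) (@fD _) Dy).
have [u Du fu] := kmap_surj (fB _) (@f_surj _) Dv.
have := kd_kmap (leqnn n) Du; rewrite subrK fu dv => dfu.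
have Ddu : kdeg D (p + 1) (j - 1) (kd l u).
  by have := kdeg_kd grD (leqnn n) Du; rewrite addrK subrK.
exists (y - kd l u); last by rewrite kdB dy kdK subr0.
apply: (kmap_eq0 (f := f (j - 1)) _ (kdegB grD Dy Ddu)) => [u1 Du1 fu1|].
  by split.
by rewrite (kmapB (fB _)) dfu subrr.
Qed.

End ShortExact.

Section Constructions.
Variables (B : comNzRingType) (l : nat -> B).

Lemma kdeg_shift (U : lmodType B) (D : int -> U -> Prop) n p t j
    (z : koszul U n) :
  kdeg (fun j => D (j - t)) p j z <-> kdeg D p (j - t) z.
Proof. by elim: n p z => [|n IHn] p z //=; rewrite !IHn. Qed.

Lemma cycles_bound_shift (U : lmodType B) (D' D : int -> U -> Prop) n p t j :
  cycles_bound l D' D n p (j - t) ->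
  cycles_bound l (fun j => D' (j - t)) (fun j => D (j - t)) n p j.
Proof.
move=> acD z /kdeg_shift Dz /(acD _ Dz)[w Dw dw]; exists w => //.
by apply/kdeg_shift; rewrite addrAC.
Qed.

(** Koszul homology is functorial, so a homomorphism with a left inverse is
    injective on it. *)
Lemma acyclic_retract (B' : comNzRingType) (l' : nat -> B')
    (U : lmodType B) (U' : lmodType B') (D : int -> U -> Prop)
    (D' : int -> U' -> Prop) n p j (f : U' -> U) (g : U -> U') :
    graded_module l D n -> graded_module l' D' n ->
    {morph f : u v / u - v} -> {morph g : u v / u - v} ->
    (forall i u, (i < n)%N -> f (l' i *: u) = l i *: f u) ->
    (forall i u, (i < n)%N -> g (l i *: u) = l' i *: g u) ->
    (forall j u, D' j u -> D j (f u)) -> (forall j u, D j u -> D' j (g u)) ->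
    cancel g f ->
  acyclic l' D' n p j -> acyclic l D n p j.
Proof.
move=> grD grD' fB gB fZ gZ fD gD gK acD z Dz dz.
have gZ' i k u : (i < n)%N -> D k u -> g (l i *: u) = l' i *: g u.
  by move=> lt_in _; apply: gZ.
have fZ' i k u : (i < n)%N -> D' k u -> f (l' i *: u) = l i *: f u.
  by move=> lt_in _; apply: fZ.
have [||w Dw dw] := acD (kmap g z).
- exact (kdeg_kmap gB (gD j) Dz).
- rewrite (kd_kmap (f := fun=> g) (fun=> gB) gZ' (leqnn n) Dz) dz.
  by rewrite (kmap0 gB).
exists (kmap f w); first exact (kdeg_kmap fB (fD _) Dw).
rewrite (kd_kmap (f := fun=> f) (fun=> fB) fZ' (leqnn n) Dw) dw kmap_comp.
exact: kmap_id.
Qed.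

Section Rows.
Variable r : nat.
Implicit Types U : lmodType B.

Let entry (c : 'I_r) (u : 'rV[B]_r) : B^o := u 0 c.

Fixpoint krow n : ('I_r -> koszul B^o n) -> koszul 'rV[B]_r n :=
  if n is n'.+1 then
    fun w => (krow (fun c => (w c).1), krow (fun c => (w c).2))
  else fun w => \row_c w c.

Lemma krowK n (w : 'I_r -> koszul B^o n) c : kmap (entry c) (krow w) = w c.
Proof.
elim: n w => [|n IHn] w /=; first by rewrite /entry mxE.
by rewrite !IHn; case: (w c).
Qed.

Lemma koszul_row_ext n (u v : koszul 'rV[B]_r n) :
  (forall c, kmap (entry c) u = kmap (entry c) v) -> u = v.
Proof.
elim: n u v => [|n IHn] u v uv; first by apply/rowP.
case: u v uv => u1 u2 [v1 v2] /= uv.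
by congr (_, _); apply: IHn => c; case: (uv c).
Qed.

Lemma kdeg_row (Dc : 'I_r -> int -> B -> Prop) n p j (u : koszul 'rV[B]_r n) :
  kdeg (fun j (u : 'rV_r) => forall c, Dc c j (u 0 c)) p j u <->
  forall c, kdeg (Dc c : int -> B^o -> Prop) p j (kmap (entry c) u).
Proof.
elim: n p u => [|n IHn] p u /=.
  case: ifP => _ //; split=> [-> c|u0]; first by rewrite /entry mxE.
  by apply/rowP => c; rewrite mxE; apply: u0.
rewrite !IHn; split=> [[D1 D2] c|Du]; first by split.
by split=> c; case: (Du c).
Qed.

Lemma cycles_bound_row (Dc' Dc : 'I_r -> int -> B -> Prop) n p j :
    (forall c, cycles_bound l (Dc' c : int -> B^o -> Prop) (Dc c) n p j) ->
  cycles_bound l (fun j (u : 'rV_r) => forall c, Dc' c j (u 0 c))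
    (fun j (u : 'rV_r) => forall c, Dc c j (u 0 c)) n p j.
Proof.
move=> acD z /kdeg_row Dz dz.
have kdE c m (u : koszul 'rV[B]_r m) :
    kd l (kmap (entry c) u) = kmap (entry c) (kd l u).
  elim: m u => [|m IHm] u /=; first by rewrite /entry mxE.
  have eB : {morph entry c : u v / u - v} by move=> v w; rewrite /entry !mxE.
  rewrite !IHm (kmapN eB) (kmapD eB) (kmapZ _ (a' := l m)) // => v.
  by rewrite /entry mxE.
have /fin_all_exists2[w Dw dw] c : exists2 w : koszul B^o n,
    kdeg (Dc c : int -> B^o -> Prop) (p + 1) (j - 1) w &
    kd l w = kmap (entry c) z.
  apply: acD (Dz c) _; rewrite kdE dz kmap0 // => u v.
  by rewrite /entry !mxE.
exists (krow w); first by apply/kdeg_row => c; rewrite krowK.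
by apply: koszul_row_ext => c; rewrite -kdE krowK dw.
Qed.

End Rows.

(** Division by [l n]: every element of [D] is uniquely a remainder in [D']
    plus [l n] times a quotient, given by [q]; thus [l n] is a nonzerodivisor
    on [D], with [D'] as cokernel. *)
Section Adjunction.
Variables (U : lmodType B) (D' D : int -> U -> Prop) (n : nat).
Variable q : U -> U.
Hypothesis grD' : graded_module l D' n.
Hypothesis qB : {morph q : u v / u - v}.

Lemma kmap_sub_scale c m (u : koszul U m) :
  kmap (fun u => u - c *: q u) u = u - c *: kmap q u.
Proof. by elim: m u => [|m IHm] u //=; rewrite !IHm; case: u. Qed.

Lemma kdeg_direct c m p j (a b : koszul U m) :
    (forall a b, D' j a -> a + c *: b = 0 -> a = 0 /\ b = 0) -> D' j 0 ->
  kdeg D' p j a -> a + c *: b = 0 -> a = 0 /\ b = 0.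
Proof.
move=> dir D0; elim: m p a b => [|m IHm] p a b /=.
  case: ifP => _; first exact: dir.
  by move=> ->; apply: dir.
case: a b => a1 a2 [b1 b2] [/= Da1 Da2] [/(IHm _ _ _ Da1)[-> ->]].
by case/(IHm _ _ _ Da2)=> -> ->.
Qed.

Hypothesis D'D : forall j u, D' j u -> D j u.
Hypothesis D_rem : forall j u, D j u -> D' j (u - l n *: q u).
Hypothesis D_quo : forall j u, D j u -> D (j - 1) (q u).
Hypothesis D_direct : forall j a b,
  D' j a -> a + l n *: b = 0 -> a = 0 /\ b = 0.

Lemma acyclic_adjoin p j : acyclic l D' n p j -> acyclic l D n.+1 p j.
Proof.
move=> acD [a b] [/= Da Db] [/= dab /eqP].
rewrite oppr_eq0 => /eqP db.
pose a1 := a - l n *: kmap q a.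
have Da1 : kdeg D' p j a1.
  rewrite /a1 -kmap_sub_scale; apply: kdeg_kmap Da => [u v|]; last exact: D_rem.
  by rewrite qB scalerBr !opprD addrACA.
have Dda1 := kdeg_kd grD' (leqnn n) Da1.
have [|da1 dqa] := kdeg_direct (b := kd l (kmap q a) + b)
    (@D_direct _) (gr0 grD' _) Dda1.
  by rewrite /a1 kdB kdZ scalerDr addrA subrK.
have [w Dw dw] := acD _ Da1 da1.
have Dqa : kdeg D p (j - 1) (kmap q a) by apply: (kdeg_kmap qB (@D_quo j) Da).
have Dw' : kdeg D (p + 1) (j - 1) w by apply: (kdeg_sub (@D'D _) Dw).
exists (w, kmap q a); first by split=> //=; rewrite addrK.
congr (_, _) => /=; first by rewrite dw subrK.
by apply/eqP; rewrite eq_sym -addr_eq0 addrC dqa.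
Qed.

End Adjunction.

(** When [l n] acts as zero the complex is the direct sum of two copies of the
    complex on [n] elements, one of them shifted. *)
Lemma acyclic_zero (U : lmodType B) (D : int -> U -> Prop) n p j :
    graded_module l D n -> (forall u : U, l n *: u = 0) ->
    acyclic l D n p j -> acyclic l D n (p - 1) j ->
  acyclic l D n.+1 p j.
Proof.
move=> grD ln0 acp acp1 [a b] [/= Da Db] [/= dab /eqP].
have kln0 m (u : koszul U m) : l n *: u = 0.
  elim: m u => [|m IHm] u //=; case: u => u1 u2.
  by congr (_, _); apply: IHm.
rewrite oppr_eq0 => /eqP db; rewrite kln0 addr0 in dab.
have [w1 Dw1 dw1] := acp _ Da dab; have [w2 Dw2 dw2] := acp1 _ Db db.
exists (w1, - w2).
  by split=> //=; rewrite addrK; rewrite subrK in Dw2; exact (kdegN grD Dw2).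
by congr (_, _); rewrite /= ?kln0 ?addr0 // kdN opprK.
Qed.

(** The two last elements are [l n] and [t * l n].  [D0] is a complement of the
    multiples of [l n] in [D].  An element [b] such that [t * b] is in [D] gives
    the relation [t * l n * b = l n * (t * b)] between the two elements; [D1] is
    a complement of the multiples of [l n] among these [b].  Hence the homology
    of [D] on all [n.+2] elements is controlled by that of [D0] in exterior
    degree [p] and of [D1] in exterior degree [p - 1]. *)
Section PairAdjunction.
Variables (U : lmodType B) (D D0 D1 : int -> U -> Prop) (n : nat) (t : B).
Variable q : U -> U.
Hypotheses (grD : graded_module l D n) (grD0 : graded_module l D0 n).
Hypothesis grD1 : graded_module l D1 n.
Hypothesis ly : l n.+1 = t * l n.
Hypothesis qB : {morph q : u v / u - v}.
Hypothesis D0D : forall j u, D0 j u -> D j u.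
Hypothesis D1D : forall j u, D1 j u -> D j u.
Hypothesis D1T : forall j u, D1 j u -> D j (t *: u).
Hypothesis D_rem : forall j u, D j u -> D0 j (u - l n *: q u).
Hypothesis D_quo : forall j u, D j u ->
  exists f g, [/\ D (j - 1) f, D (j - 1) g & q u = f + t *: g].
Hypothesis D_direct : forall j a b,
  D0 j a -> a + l n *: b = 0 -> a = 0 /\ b = 0.
Hypothesis D1_rem : forall j u,
  D j u -> D j (t *: u) -> D1 j (u - l n *: q u).
Hypothesis D1_quo : forall j u,
  D j u -> D j (t *: u) -> D (j - 1) (q u).
Hypothesis D1_direct : forall j a b,
  D1 j a -> a + l n *: b = 0 -> a = 0 /\ b = 0.

Let q0 : q 0 = 0. Proof. by have := qB 0 0; rewrite !subrr. Qed.

Let quo_lift m p j (u : koszul U m) : kdeg D p j u ->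
  exists f g, [/\ kdeg D p (j - 1) f, kdeg D p (j - 1) g
                & kmap q u = f + t *: g].
Proof.
elim: m p u => [|m IHm] p u /=.
  case: ifP => _; first exact: D_quo.
  move=> ->; exists 0, 0; split=> //.
  by rewrite scaler0 addr0.
case=> /IHm[f1 [g1 [Df1 Dg1 q1]]] /IHm[f2 [g2 [Df2 Dg2 q2]]].
by exists (f1, f2), (g1, g2); split=> //; rewrite q1 q2.
Qed.

Let rem_lift m p j (u : koszul U m) : kdeg D p j u -> kdeg D p j (t *: u) ->
  kdeg D1 p j (u - l n *: kmap q u) /\ kdeg D p (j - 1) (kmap q u).
Proof.
elim: m p u => [|m IHm] p u /=.
  case: ifP => _; first by move=> Du Dtu; split; [apply: D1_rem|apply: D1_quo].
  by move=> -> _; rewrite q0 scaler0 addrN.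
case: u => u1 u2 [/= Du1 Du2] [Dt1 Dt2].
by have [D1u1 Dq1] := IHm _ _ Du1 Dt1; have [D1u2 Dq2] := IHm _ _ Du2 Dt2.
Qed.

Lemma acyclic_pair p j :
    acyclic l D0 n p j -> acyclic l D1 n (p - 1) j ->
  acyclic l D n.+2 p j.
Proof.
move=> ac0 ac1 [[a b] [c e]] Dz dz.
have [[Da Db] [Dc De]] : (kdeg D p j a /\ kdeg D (p - 1) j b) /\
  (kdeg D (p - 1) j c /\ kdeg D (p - 1 - 1) j e) := Dz.
have da : kd l a + l n *: b + l n.+1 *: c = 0 by case: dz.
have dc : kd l c + l n *: e = 0 by case: dz => _ _ /eqP; rewrite oppr_eq0 => /eqP.
have ly' (u : koszul U n) : l n.+1 *: u = t *: (l n *: u) by rewrite ly scalerA.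
have [f [g [Df Dg qa]]] := quo_lift Da.
have Da1 : kdeg D0 p j (a - l n *: kmap q a).
  rewrite -kmap_sub_scale; apply: (kdeg_kmap _ (@D_rem j) Da) => u v.
  by rewrite qB scalerBr !opprD addrACA.
pose b1 := b + kd l f; pose c1 := c + kd l g.
have [|da1 bc1] := kdeg_direct (b := b1 + t *: c1)
    (@D_direct _) (gr0 grD0 _) (kdeg_kd grD0 (leqnn n) Da1).
  rewrite kdB kdZ qa kdD kdZ /b1 /c1 (scalerDr t) addrACA.
  rewrite [X in _ + X]scalerDr [X in _ + X]addrC addrA subrK.
  by rewrite scalerDr addrA !scalerA mulrC -ly.
have [w0 Dw0 dw0] := ac0 _ Da1 da1.
have Dkd u : kdeg D p (j - 1) u -> kdeg D (p - 1) j (@kd _ l U n u).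
  by move/(kdeg_kd grD (leqnn n)); rewrite subrK.
have Db1 : kdeg D (p - 1) j b1 := kdegD grD Db (Dkd _ Df).
have Dc1 : kdeg D (p - 1) j c1 := kdegD grD Dc (Dkd _ Dg).
have tc1 : t *: c1 = - b1 by apply/eqP; rewrite eq_sym eqr_oppLR -addr_eq0 bc1.
have [|D1c Dqc] := rem_lift Dc1; first by rewrite tc1; exact (kdegN grD Db1).
set c2 := kmap q c1 in D1c Dqc.
have [|dc2 e2] := kdeg_direct (b := e + kd l c2)
    (@D1_direct _) (gr0 grD1 _) (kdeg_kd grD1 (leqnn n) D1c).
  by rewrite kdB kdZ kdD kdK addr0 scalerDr [l n *: e + _]addrC addrA subrK.
have [w1 Dw1 dw1] := ac1 _ D1c dc2.
have tB : {morph *:%R t : u v / u - v :> U} by apply: scalerBr.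
have Dtw1 : kdeg D p (j - 1) (t *: w1).
  rewrite -kmap_scale; apply: (kdeg_kmap tB (@D1T _)).
  by rewrite subrK in Dw1.
have DDw1 : kdeg D p (j - 1) w1.
  by rewrite subrK in Dw1; apply: (kdeg_sub (@D1D _) Dw1).
(* [w0] bounds the remainder of [a]; [w1], [c2] correct the quotient
   [f + t *: g] of [a] by the relation between the two last elements. *)
exists ((w0, f + t *: w1), (g - w1, - c2)).
  rewrite /= addrK; split; split=> //.
  - exact: (kdeg_sub (@D0D _) Dw0).
  - exact (kdegD grD Df Dtw1).
  - exact (kdegB grD Dg DDw1).
  - exact (kdegN grD Dqc).
have -> : kd l (((w0, f + t *: w1), (g - w1, - c2)) : koszul U n.+2) =
  ((kd l w0 + l n *: (f + t *: w1) + l n.+1 *: (g - w1),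
    - kd l (f + t *: w1) + l n.+1 *: - c2),
   (- (kd l (g - w1) + l n *: - c2), - - kd l (- c2))) by [].
congr ((_, _), (_, _)).
- rewrite dw0 qa ly' scalerA mulrC -scalerA -!addrA -scalerDr scalerBr.
  by rewrite [t *: g - _]addrC -[f + _ + _]addrA [t *: w1 + _]addrA subrr add0r addNr addr0.
- rewrite kdD kdZ dw1 ly' !scalerN scalerBr tc1 /b1.
  by rewrite opprD opprD !opprK addrA addrK addrC addrK.
- rewrite kdB dw1 scalerN opprB opprB addrA [l n *: c2 + _]addrC subrK.
  by rewrite /c1 addrK.
- by apply/eqP; rewrite opprK kdN eq_sym -addr_eq0 e2.
Qed.

End PairAdjunction.

End Constructions.

(** * Polynomial rings *)

Section PolynomialRing.
Variables (F : fieldType) (N : nat).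
Notation S := {mpoly F[N]}.
Implicit Types (p q : S) (m : 'X_{1..N}) (i : 'I_N).

(** Indexing the variables by natural numbers allows the Koszul complex on an
    initial segment of them. *)
Definition mvar (k : nat) : S := if insub k is Some i then 'X_i else 0.

Lemma mvarE i : mvar i = 'X_i.
Proof. by rewrite /mvar valK. Qed.

Lemma mcoeffXM i p m :
  ('X_i * p)@_m = if (0 < m i)%N then p@_(m - U_(i)) else 0.
Proof.
rewrite mulrC; case: ifP => [m_gt0|/negbT].
  rewrite -[m in LHS](@submK _ U_(i)%MM) ?mcoeffMX 1?addmC ?mcoeffMX //.
  by apply/mnm_lepP => i'; rewrite mnm1E; case: eqP => // <-.
rewrite -eqn0Ngt => /eqP m0; apply/eqP; rewrite mcoeff_eq0.
rewrite (perm_mem (msuppMX _ _)); apply/mapP => -[m' _ def_m].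
by move: m0; rewrite def_m mnmDE mnm1E eqxx.
Qed.

(** Quotient of the division by the variable ['X_i]. *)
Definition mquo i p : S :=
  \sum_(m <- msupp p | (0 < m i)%N) p@_m *: 'X_[m - U_(i)].

Lemma mcoeff_mquo i p m : (mquo i p)@_m = p@_(m + U_(i)).
Proof.
have mUK m' : (0 < m' i)%N -> (m' - U_(i) + U_(i) = m')%MM.
  by move=> m0; apply/submK/mnm_lepP => i'; rewrite mnm1E; case: eqP => // <-.
rewrite /mquo raddf_sum /=; have mi0: (0 < (m + U_(i))%MM i)%N.
  by rewrite mnmDE mnm1E eqxx addn1.
under eq_bigr => m' m'0 do rewrite mcoeffZ mcoeffX.
have [mp|mp] := boolP ((m + U_(i))%MM \in msupp p); last first.
  rewrite (memN_msupp_eq0 mp) big1_seq // => m' /andP[m'0 m'p].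
  case: eqP => [def_m|]; last by rewrite mulr0.
  by case/negP: mp; rewrite -def_m mUK.
rewrite big_mkcond (bigD1_seq _ mp (msupp_uniq p)) //= mi0 addmK eqxx mulr1.
rewrite big1_seq ?addr0 // => m' /andP[ne_m' _]; case: ifP => // m'0.
case: eqP => [def_m|]; last by rewrite mulr0.
by case/eqP: ne_m'; rewrite -def_m mUK.
Qed.

Lemma mquoB i : {morph mquo i : p q / p - q}.
Proof.
by move=> p q; apply/mpolyP => m; rewrite mcoeffB !mcoeff_mquo mcoeffB.
Qed.

Lemma mquo0 i : mquo i 0 = 0.
Proof. by apply/mpolyP => m; rewrite mcoeff_mquo !mcoeff0. Qed.

(** Homogeneous polynomials in the first [k] variables only: the induction that
    computes their Koszul homology adjoins one variable at a time. *)
Definition hom (k : nat) (j : int) (p : S) : Prop :=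
  forall m, p@_m != 0 ->
    (mdeg m)%:Z = j /\ forall i, (k <= i)%N -> m i = 0%N.

Lemma hom0 k j : hom k j 0.
Proof. by move=> m; rewrite mcoeff0 eqxx. Qed.

Lemma homB k j p q : hom k j p -> hom k j q -> hom k j (p - q).
Proof.
move=> hp hq m; rewrite mcoeffB; have [p0|/hp//] := eqVneq p@_m 0.
by rewrite p0 sub0r oppr_eq0; apply: hq.
Qed.

Lemma homN k j p : hom k j p -> hom k j (- p).
Proof. by rewrite -sub0r; apply: homB; apply: hom0. Qed.

Lemma homD k j p q : hom k j p -> hom k j q -> hom k j (p + q).
Proof. by move=> hp /homN; rewrite -{2}[q]opprK; apply: homB. Qed.

Lemma hom_sum k j (I : Type) (s : seq I) (P : pred I) (f : I -> S) :
  (forall x, P x -> hom k j (f x)) -> hom k j (\sum_(x <- s | P x) f x).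
Proof.
by move=> hf; elim/big_rec: _ => [|x p Px]; [apply: hom0 | apply/homD/hf].
Qed.

Lemma homXM k j i p : (i < k)%N -> hom k j p -> hom k (j + 1) ('X_i * p).
Proof.
move=> lt_ik hp m; rewrite mcoeffXM; case: ifP => [m0|]; last by rewrite eqxx.
case/hp=> dm hm; rewrite -(@submK _ U_(i)%MM m); last first.
  by apply/mnm_lepP => i'; rewrite mnm1E; case: eqP => // <-.
split=> [|i' le_k]; first by rewrite mdegD mdeg1 PoszD dm.
by rewrite mnmDE hm // mnm1E; case: eqP => // eq_i; move: le_k; rewrite -eq_i leqNgt lt_ik.
Qed.

Lemma graded_hom n k : (n <= k <= N)%N ->
  graded_module mvar (hom k : int -> S^o -> Prop) n.
Proof.
case/andP=> le_nk le_kN; split=> [j|j u v|i j u lt_in].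
- exact: hom0.
- exact: homB.
have lt_iN : (i < N)%N by lia.
rewrite -[ i ]/(nat_of_ord (Ordinal lt_iN)) mvarE; apply: homXM => /=; lia.
Qed.

Lemma hom_rem (k : nat) j i p : k = i -> hom k.+1 j p -> hom k j (p - 'X_i * mquo i p).
Proof.
move=> -> hp m; rewrite mcoeffB mcoeffXM; case: ifP => [m0|/negbT].
  rewrite mcoeff_mquo submK ?subrr ?eqxx //.
  by apply/mnm_lepP => i'; rewrite mnm1E; case: eqP => // <-.
rewrite -eqn0Ngt subr0 => /eqP m0 /hp[dm hm]; split=> // i' le_i.
have [/val_inj<- //|ne_i] := eqVneq (val i) (val i').
by apply: hm; rewrite ltn_neqAle ne_i.
Qed.

Lemma hom_quo k j i p : hom k j p -> hom k (j - 1) (mquo i p).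
Proof.
move=> hp m; rewrite mcoeff_mquo => /hp[dm hm]; split=> [|i' le_i].
  by move: dm; rewrite mdegD mdeg1 PoszD => <-; rewrite addrK.
by have := hm _ le_i; rewrite mnmDE; lia.
Qed.

Lemma hom_direct k j i p q : (k <= i)%N ->
  hom k j p -> p + 'X_i * q = 0 -> p = 0 /\ q = 0.
Proof.
move=> le_ki hp pq0; have q0 : q = 0.
  apply/mpolyP => m; rewrite mcoeff0.
  have := congr1 (mcoeff (m + U_(i))%MM) pq0.
  rewrite mcoeffD mcoeffXM mnmDE mnm1E eqxx addn1 /= addmK mcoeff0.
  have [-> <-|/hp[_ /(_ i le_ki)]] := eqVneq p@_(m + U_(i)) 0.
    by rewrite add0r.
  by rewrite mnmDE mnm1E eqxx addn1.
by split=> //; move: pq0; rewrite q0 mulr0 addr0.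
Qed.

(** The variables form a regular sequence, and at each step the remainders modulo
    the last variable are the polynomials in the preceding ones. *)
Lemma hom_acyclic k (p j : int) : (k <= N)%N -> (p != 0) || (j != 0) ->
  acyclic mvar (hom k : int -> S^o -> Prop) k p j.
Proof.
move=> le_kN pj; elim: k le_kN => [|k IHk] lt_kN.
  move=> z /= Dz _; exists 0; first by case: ifP => // _; apply: hom0.
  move: Dz; case: eqP => [p0 hz|_ -> //]; apply/mpolyP => m.
  rewrite mcoeff0; have [-> //|/hz[dm hm]] := eqVneq z@_m 0.
  move: pj; rewrite p0 -dm /= => /negP[]; rewrite eqz_nat mdeg_eq0; apply/eqP.
  by apply/mnmP => i; rewrite hm // mnm0E.
pose i := Ordinal lt_kN.
have lkE (u : S^o) : mvar k *: u = 'X_i * u by rewrite -(mvarE i).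
apply: (acyclic_adjoin (D' := hom k : int -> S^o -> Prop) (q := mquo i)).
- by apply: graded_hom; rewrite leqnn ltnW.
- by move=> u v; apply: mquoB.
- move=> j0 u hu m /hu[dm hm]; split=> // i0 le_i0; apply: hm; exact: ltnW.
- by move=> j0 u hu; rewrite lkE; apply: (@hom_rem k j0 i).
- by move=> j0 u hu; apply: hom_quo.
- by move=> j0 u v hu; rewrite lkE; apply: hom_direct hu.
by apply: IHk; apply: ltnW.
Qed.

Lemma mnm_split m n : mdeg m = n.+1 ->
  exists i m', (m = U_(i) + m')%MM /\ mdeg m' = n.
Proof.
move=> dm; have [i m0] : exists i : 'I_N, (0 < m i)%N.
  apply/existsP; rewrite -[[exists _, _]]negbK; apply/negP.
  rewrite negb_exists => /forallP m0.
  suff m00 : m = 0%MM by move: dm; rewrite m00 mdeg0.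
  by apply/mnmP => i; have := m0 i; rewrite -eqn0Ngt mnm0E => /eqP.
have mE : (m = U_(i) + (m - U_(i)))%MM.
  rewrite addmC submK //; apply/mnm_lepP => i'; rewrite mnm1E.
  by case: eqP => // <-.
exists i, (m - U_(i))%MM; split=> //.
by apply/eqP; rewrite -eqSS -dm {2}mE mdegD mdeg1.
Qed.

Lemma hom1_sum k p : hom k 1 p -> p = \sum_(i < N) p@_U_(i) *: 'X_i.
Proof.
move=> hp; apply/mpolyP => m'; rewrite raddf_sum /=.
under eq_bigr => i _ do rewrite mcoeffZ mcoeffX.
have [um0|/hp[dm _]] := eqVneq p@_m' 0.
  rewrite um0 big1 // => i _; have [def_m|_] := eqVneq U_(i)%MM m'.
    by rewrite def_m um0 mul0r.
  by rewrite mulr0.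
have /mdeg1P[i0 /eqP def_m] : mdeg m' == 1%N by apply/eqP; lia.
rewrite (bigD1 i0) //= -def_m eqxx mulr1 big1 ?addr0 // => i ne_i.
case: eqP => [eq_i|_]; last by rewrite mulr0.
case/eqP: ne_i; apply/eqP; have /mnmP/(_ i0) := eq_i; rewrite def_m !mnm1E eqxx.
by case: eqP.
Qed.

End PolynomialRing.

(** * Twisted modules on the product of a projective space with a line *)

Section TwistedModules.
Variables (F : fieldType) (N : nat).
Notation S := {mpoly F[N]}.
Implicit Types (u v : {poly S}) (m : 'X_{1..N}) (i : 'I_N).

(** The variable of [{poly S}] is the affine coordinate [y / x] of the line, so
    that [seg_var k.*2] and [seg_var k.*2.+1] are the products of the [k]-th
    variable by [x] and by [y]. *)
Definition seg_var (k : nat) : {poly S} :=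
  if odd k then 'X * (mvar F N k./2)%:P else (mvar F N k./2)%:P.

(** The Segre product with [k[x, y]] of a free module generated in degree [t],
    indexed by the polynomial degree [j]: a binary form of degree [j + t] is a
    polynomial in the affine coordinate of degree at most [j + t]. *)
Definition seg (k : nat) (t j : int) u : Prop :=
  forall c m, (u`_c)@_m != 0 ->
    [/\ (mdeg m)%:Z = j, forall i, (k <= i)%N -> m i = 0%N & c%:Z <= j + t].

Lemma seg_hom k t j u c : seg k t j u -> hom k j u`_c.
Proof. by move=> hu m /hu[]. Qed.

Lemma seg0 k t j : seg k t j 0.
Proof. by move=> c m; rewrite coef0 mcoeff0 eqxx. Qed.

Lemma segB k t j u v : seg k t j u -> seg k t j v -> seg k t j (u - v).
Proof.
move=> hu hv c m; rewrite coefB mcoeffB.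
have [u0|/hu//] := eqVneq (u`_c)@_m 0.
by rewrite u0 sub0r oppr_eq0; apply: hv.
Qed.

Lemma seg_mvar k t j i u : (i < k)%N -> seg k t j u ->
  seg k (t - 1) (j + 1) (('X_i)%:P * u).
Proof.
move=> lt_ik hu c m; rewrite coefCM => cm0.
have [dm hm] := homXM lt_ik (seg_hom (c := c) hu) cm0.
split=> //; move: cm0; rewrite mcoeffXM; case: ifP => [_ /hu[_ _]|_].
  by rewrite addrACA subrr addr0.
by rewrite eqxx.
Qed.

Lemma seg_sub k t t' j u : t <= t' -> seg k t j u -> seg k t' j u.
Proof. by move=> le_t hu c m /hu[dm hm le_c]; split=> //; lia. Qed.

Lemma segXM k t j u : seg k t j u -> seg k (t + 1) j ('X * u).
Proof.
move=> hu c m; rewrite coefXM; case: c => [|c] /=; first by rewrite mcoeff0 eqxx.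
by case/hu=> dm hm le_c; split=> //; lia.
Qed.

Lemma graded_seg n k t : (n <= k.*2)%N -> (k <= N)%N ->
  graded_module seg_var (seg k t : int -> {poly S}^o -> Prop) n.
Proof.
move=> le_nk le_kN; split=> [j|j u v|l j u lt_in hu].
- exact: seg0.
- exact: segB.
have lt_lk : (l./2 < k)%N by lia.
have lt_lN : (l./2 < N)%N by lia.
pose i := Ordinal lt_lN.
rewrite /GRing.scale /= /seg_var (_ : mvar F N l./2 = 'X_i) ?(mvarE _ i) //.
case: odd; last first.
  by apply: seg_sub (seg_mvar _ hu) => //; lia.
rewrite -mulrA -[t](subrK 1); apply: segXM; exact: seg_mvar.
Qed.

Lemma coef_map_mquo i u c : (map_poly (mquo i) u)`_c = mquo i u`_c.
Proof. by rewrite coef_map_id0 ?mquo0. Qed.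

(** Adjoining the pair ['X_k], [y 'X_k] at once, the remainders modulo ['X_k]
    are the same module in fewer variables.  The elements that [y] maps into the
    module have one degree less in [y], whence [t - 1] in place of [t].  As [p]
    decreases by one as well, the condition [p <= t] is preserved. *)
Lemma seg_var_acyclic k (t p j : int) : (k <= N)%N -> 0 <= t -> p <= t -> 1 <= j ->
  acyclic seg_var (seg k t : int -> {poly S}^o -> Prop) k.*2 p j.
Proof.
move=> le_kN; elim: k le_kN t p => [|k IHk] lt_kN t p t0 le_pt j1.
  move=> z /= Dz _; exists 0; first by case: ifP => // _; apply: seg0.
  move: Dz; case: eqP => [p0 hz|_ -> //]; apply/polyP => c; apply/mpolyP => m.
  rewrite coef0 mcoeff0; have [-> //|/hz[dm hm _]] := eqVneq ((z : {poly S})`_c)@_m 0.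
  suff m0 : m = 0%MM by move: dm; rewrite m0 mdeg0; lia.
  by apply/mnmP => i; rewrite hm // mnm0E.
pose i := Ordinal lt_kN; pose q : {poly S}^o -> {poly S}^o := map_poly (mquo i).
have qE (u : {poly S}^o) c : (q u : {poly S})`_c = mquo i (u : {poly S})`_c.
  exact: coef_map_mquo.
have lk : seg_var k.*2 = ('X_i)%:P.
  by rewrite /seg_var odd_double doubleK (mvarE _ i).
have lk1 : seg_var k.*2.+1 = 'X * seg_var k.*2.
  by rewrite /seg_var /= odd_double /= uphalf_double doubleK.
have xE (u : {poly S}^o) c :
    (seg_var k.*2 *: u : {poly S})`_c = 'X_i * (u : {poly S})`_c.
  by rewrite lk /GRing.scale /= coefCM.
have remE (u : {poly S}^o) c : ((u - seg_var k.*2 *: q u : {poly S}^o) : {poly S})`_c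
    = (u : {poly S})`_c - 'X_i * mquo i (u : {poly S})`_c.
  by rewrite coefB xE qE.
have coef_rem (p0 : S) m : (p0 - 'X_i * mquo i p0)@_m != 0 -> p0@_m != 0.
  rewrite mcoeffB mcoeffXM; case: ifP; last by rewrite subr0.
  move=> m0; rewrite mcoeff_mquo submK ?subrr ?eqxx //.
  by apply/mnm_lepP => i'; rewrite mnm1E; case: eqP => // <-.
have direct t' j0 (a b : {poly S}^o) : seg k t' j0 a ->
    a + seg_var k.*2 *: b = 0 -> a = 0 /\ b = 0.
  move=> ha ab0.
  have ab0c c : (a : {poly S})`_c = 0 /\ (b : {poly S})`_c = 0.
    apply: (@hom_direct _ _ k j0 i) => //; first exact: seg_hom ha.
    by rewrite -xE -coefD ab0 coef0.
  by split; apply/polyP => c; rewrite coef0; case: (ab0c c).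
have le_kN := ltnW lt_kN.
rewrite doubleS; apply: (acyclic_pair (D0 := seg k t : int -> {poly S}^o -> Prop)
  (D1 := seg k (t - 1) : int -> {poly S}^o -> Prop) (q := q) (t := 'X)).
- by apply: graded_seg => //; lia.
- by apply: graded_seg => //; lia.
- by apply: graded_seg => //; lia.
- exact: lk1.
- by move=> u v; apply/polyP => c; rewrite coefB !qE coefB mquoB.
- by move=> j0 u hu c m /hu[dm hm le_c]; split=> // i0 lt_k; apply/hm/ltnW.
- move=> j0 u hu c m /hu[dm hm le_c]; split=> //; last by lia.
  by move=> i0 lt_k; apply/hm/ltnW.
- move=> j0 u /segXM; rewrite subrK => hu c m /hu[dm hm le_c]; split=> //.
  by move=> i0 lt_k; apply/hm/ltnW.
- move=> j0 u hu c m; rewrite remE => nz.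
  have /hu[_ _ le_c] := coef_rem _ _ nz.
  by have [] := hom_rem (i := i) (erefl k) (seg_hom (c := c) hu) nz.
- move=> j0 u hu.
  exists ((q u : {poly S})`_0)%:P, (\poly_(c < size (q u : {poly S})) (q u : {poly S})`_c.+1).
  split=> [c m|c m|].
  + rewrite coefC; case: c => [|c]; last by rewrite mcoeff0 eqxx.
    rewrite qE => nz; have [dm hm] := hom_quo (seg_hom hu) nz.
    by split=> //; lia.
  + rewrite coef_poly; case: ifP => _; last by rewrite mcoeff0 eqxx.
    rewrite qE => nz; have [dm hm] := hom_quo (seg_hom hu) nz.
    split=> //; move: nz; rewrite mcoeff_mquo => /hu[_ _]; lia.
  apply/polyP => c; rewrite coefD coefC [_ *: _]/('X * _) coefXM.
  case: c => [|c] /=; first by rewrite addr0.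
  rewrite add0r [RHS]coef_poly; case: ltnP => // le_s.
  by apply: nth_default; apply: leqW.
- exact: direct.
- move=> j0 u hu hXu c m; rewrite remE => nz; have nzu := coef_rem _ _ nz.
  have [dm hm] := hom_rem (i := i) (erefl k) (seg_hom (c := c) hu) nz; split=> //.
  by have := hXu c.+1 m; rewrite [_ *: _]/('X * _) coefXM /= => /(_ nzu)[_ _]; lia.
- move=> j0 u hu hXu c m; rewrite qE => nz.
  have [dm hm] := hom_quo (seg_hom hu) nz; split=> //.
  have := hXu c.+1 (m + U_(i))%MM; rewrite [_ *: _]/('X * _) coefXM /=.
  by rewrite -mcoeff_mquo => /(_ nz)[_ _]; lia.
- exact: direct.
- by apply: IHk.
(* For [t = 0] the twist [t - 1] is out of reach of the induction, but then
   [p <= 0] and the exterior degree [p - 1] is negative. *)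
have [t1|t1] := leP 1 t; first by apply: IHk => //; lia.
by apply: acyclic_out; [apply: graded_seg => //; lia | lia].
Qed.

(** The quotient of the modules with twists [t] and [t - 1] is the coefficient of
    the highest power of [y], on which [x] acts as zero and [y] as the identity. *)
Definition top_var (k : nat) : S := if odd k then mvar F N k./2 else 0.

Lemma graded_top n k : (n <= k.*2.+1)%N -> (k <= N)%N ->
  graded_module top_var (hom k : int -> S^o -> Prop) n.
Proof.
move=> le_nk le_kN; split=> [j|j u v|l j u lt_in hu].
- exact: hom0.
- exact: homB.
rewrite /top_var; case: (boolP (odd l)) => [odd_l|_]; last first.
  by rewrite scale0r; apply: hom0.
have lt_lk : (l./2 < k)%N by lia.
have lt_lN : (l./2 < N)%N by lia.
by rewrite (mvarE _ (Ordinal lt_lN)); apply: homXM.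
Qed.

Lemma top_acyclic k (p j : int) : (k <= N)%N -> 1 <= j ->
  acyclic top_var (hom k : int -> S^o -> Prop) k.*2 p j.
Proof.
move=> le_kN j1; elim: k le_kN p => [|k IHk] lt_kN p.
  move=> z /= Dz _; exists 0; first by case: ifP => // _; apply: hom0.
  move: Dz; case: eqP => [p0 hz|_ -> //]; apply/mpolyP => m.
  rewrite mcoeff0; have [-> //|/hz[dm hm]] := eqVneq z@_m 0.
  suff m0 : m = 0%MM by move: dm; rewrite m0 mdeg0; lia.
  by apply/mnmP => i; rewrite hm // mnm0E.
have le_kN := ltnW lt_kN; pose i := Ordinal lt_kN.
have lk : top_var k.*2 = 0 by rewrite /top_var odd_double.
have lk1 (u : S^o) : top_var k.*2.+1 *: u = 'X_i * u.
  by rewrite /top_var /= odd_double /= uphalf_double (mvarE _ i).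
rewrite doubleS; apply: (acyclic_adjoin (D' := hom k : int -> S^o -> Prop)
  (q := mquo i)).
- exact: graded_top.
- by move=> u v; apply: mquoB.
- by move=> j0 u hu m /hu[dm hm]; split=> // i0 le_i0; apply/hm/ltnW.
- by move=> j0 u hu; rewrite lk1; apply: (@hom_rem _ _ k j0 i).
- by move=> j0 u hu; apply: hom_quo.
- by move=> j0 u v hu; rewrite lk1; apply: hom_direct hu.
apply: acyclic_zero; try exact: IHk.
  by apply: graded_top.
by move=> u; rewrite lk scale0r.
Qed.

(** The long exact sequence of [seg N (t - 1) <= seg N t]: the quotient is acyclic
    in the coefficient degree [j - 1] of the connecting map as soon as
    [j >= 2]. *)
Lemma seg_var_acyclic_step (t p j : int) : 0 <= t -> 2 <= j ->
  acyclic seg_var (seg N t : int -> {poly S}^o -> Prop) N.*2 p j ->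
  acyclic seg_var (seg N (t - 1) : int -> {poly S}^o -> Prop) N.*2 p j.
Proof.
move=> t0 j2 acN; have nat_idx (c : nat) j0 : (c%:Z == j0) = (0 <= j0) && (c == `|j0|%N).
  by lia.
pose f (j : int) (u : {poly S}^o) : S^o :=
  if 0 <= j + t then (u : {poly S})`_(`|j + t|) else 0.
have gk : forall j u, seg N (t - 1) j u <-> gker (seg N t : int -> {poly S}^o -> Prop) f j u.
  move=> j0 u; split=> [hu|[hu fu] c m nz].
    split=> [|]; first by apply: seg_sub hu; lia.
    rewrite /f; case: ifP => // jt0; apply/mpolyP => m; rewrite mcoeff0.
    apply/eqP/negPn/negP => /hu[_ _]; lia.
  have [dm hm le_c] := hu _ _ nz; split=> //.
  suff : c%:Z != j0 + t by lia.
  apply/eqP => eq_c; move: fu nz; rewrite /f -eq_c /= => ->.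
  by rewrite mcoeff0 eqxx.
apply: (cycles_bound_sub (D' := gker (seg N t : int -> {poly S}^o -> Prop) f)
  (D := gker (seg N t : int -> {poly S}^o -> Prop) f)) => [j0 u /gk//|j0 u /gk//|].
apply: (acyclic_gker (l' := top_var) (D' := hom N : int -> S^o -> Prop)).
- by apply: graded_seg.
- move=> j0 u v; rewrite /f; case: ifP => _; first by rewrite -coefB.
  by rewrite subr0.
- move=> i j0 u lt_i hu.
  have vanish c : j0 + t < c%:Z -> (u : {poly S})`_c = 0.
    move=> lt_c; apply/mpolyP => m; rewrite mcoeff0.
    apply/eqP/negPn/negP => /hu[_ _]; lia.
  rewrite /f /GRing.scale /= /seg_var /top_var; case: odd; last first.
    rewrite mul0r; case: ifP => // jt0; rewrite coefCM vanish ?mulr0 //; lia.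
  have [jt|jt] := leP 0 (j0 + t); last first.
    have -> : u = 0 by apply/polyP => c; rewrite coef0 vanish //; lia.
    by rewrite !mulr0 coef0; case: ifP.
  rewrite -mulrA coefXM coefCM; case: ifP => jt1; last by lia.
  case: ifP => nz; first by lia.
  by rewrite (_ : `|(j0 + 1 + t)%R|%N.-1 = `|(j0 + t)%R|%N) //; lia.
- move=> j0 u hu; rewrite /f; case: ifP => _; last exact: hom0.
  exact: (seg_hom hu).
- move=> j0 v hv; have [->|nz_v] := eqVneq v 0.
    exists 0; first exact: seg0.
    by rewrite /f coef0 if_same.
  have [m nz_m] : exists m, v@_m != 0.
    have : msupp v != [::] by rewrite msupp_eq0.
    case def_s: (msupp v) => [//|m s] _; exists m.
    by rewrite -mcoeff_msupp def_s mem_head.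
  have [dm _] := hv _ nz_m.
  exists (v%:P * 'X^(`|j0 + t|) : {poly S}).
    move=> c m'; rewrite coefCM coefXn; have [->|ne] := eqVneq c `|(j0 + t)%R|%N; last first.
      by rewrite mulr0 mcoeff0 eqxx.
    by rewrite mulr1 => /hv[dm' hm']; split=> //; lia.
  by rewrite /f coefCM coefXn eqxx mulr1; case: ifP => //; lia.
- by apply: top_acyclic => //; lia.
apply: cycles_bound_sub acN => // j0 u; by case.
Qed.

(** Descending induction on the twist, starting at [t = p]. *)
Lemma seg_regular (t p j : int) : 0 <= t -> 2 <= j ->
  acyclic seg_var (seg N t : int -> {poly S}^o -> Prop) N.*2 p j.
Proof.
move=> t0 j2; have [le_pt|lt_tp] := leP p t; first by apply: seg_var_acyclic => //; lia.
have [k def_t] : exists k : nat, t = p - k%:Z by exists `|p - t|%N; lia.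
elim: k t def_t t0 {lt_tp} => [|k IHk] t def_t t0.
  by apply: seg_var_acyclic => //; lia.
rewrite (_ : t = t + 1 - 1); last by rewrite addrK.
by apply: seg_var_acyclic_step; [lia | | apply: IHk; lia].
Qed.

End TwistedModules.

(** * Minimal generators of graded submodules *)

(** A subspace known only as a predicate has a finite spanning family: take one of
    largest rank. *)
Lemma subspace_rows (F : fieldType) n (P : 'rV[F]_n -> Prop) :
  exists k (A : 'M[F]_(k, n)),
    (forall i, P (row i A)) /\ forall v, P v -> (v <= A)%MS.
Proof.
pose R m := `[< exists k (A : 'M[F]_(k, n)),
                  (forall i, P (row i A)) /\ \rank A = m >].
have R0 : exists m, R m.
  exists 0%N; apply/asboolP; exists 0%N, 0; split; last by rewrite mxrank0.
  by case.
have Rn m : R m -> (m <= n)%N.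
  by case/asboolP => k [A [_ <-]]; apply: rank_leq_col.
case: (ex_maxnP R0 Rn) => m /asboolP[k [A [PA rA]]] maxm.
exists k, A; split=> // v Pv; apply: contraT => nvA.
have : R (\rank (col_mx A v)).
  apply/asboolP; exists (k + 1)%N, (col_mx A v); split=> // i.
  rewrite -[ i ]splitK; case: split => i' /=; first by rewrite rowKu.
  by rewrite rowKd (ord1 i') row_id.
move/maxm; rewrite -rA leqNgt -addsmxE ltn_neqAle mxrankS ?addsmxSl // andbT.
case/negP; apply: contra nvA => /eqP eqr.
have := mxrank_leqif_sup (addsmxSl A v); rewrite -eqr => -[_].
by rewrite eqxx addsmx_sub => /esym/andP[].
Qed.

Section FreeModules.
Variables (F : fieldType) (N : nat).
Notation S := {mpoly F[N]}.

Lemma homM k a b (p q : S) : hom k a p -> hom k b q -> hom k (a + b) (p * q).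
Proof.
move=> hp hq m; rewrite -mcoeff_msupp => /msuppM_le/allpairsP[[m1 m2] /=].
rewrite !mcoeff_msupp => -[/hp[d1 h1] /hq[d2 h2] ->].
split=> [|i le_i]; first by rewrite mdegD PoszD d1 d2.
by rewrite mnmDE h1 ?h2.
Qed.

Lemma homC k a : hom k 0 (a%:MP : S).
Proof.
move=> m; rewrite mcoeffC; have [->|] := eqVneq m 0%MM.
  by split=> [|i _]; rewrite ?mdeg0 ?mnm0E.
by rewrite mulr0 eqxx.
Qed.

Lemma hom_const k j (p : S) : hom k j p -> p@_0 != 0 -> j = 0 /\ p = (p@_0)%:MP.
Proof.
move=> hp nz; have [j0 _] := hp _ nz; rewrite mdeg0 in j0; split=> //.
apply/mpolyP => m; rewrite mcoeffC.
have [->|nz_m] := eqVneq m 0%MM; first by rewrite mulr1.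
rewrite mulr0; apply/eqP/negPn/negP => /hp[dm _].
by case/negP: nz_m; rewrite -mdeg_eq0 -eqz_nat dm -j0.
Qed.

Lemma hom_lt0 k j (p : S) : j < 0 -> hom k j p -> p = 0.
Proof.
move=> j0 hp; apply/mpolyP => m; rewrite mcoeff0; apply/eqP/negPn/negP.
by case/hp; lia.
Qed.

Section Rank.
Variables (r : nat) (tw : 'I_r -> nat).
Implicit Types (u v : 'rV[S]_r).

(** Homogeneous elements of degree [j] in the direct sum of the [S(- tw c)]. *)
Definition fdeg (j : int) u : Prop := forall c, hom N (j - (tw c)%:Z) (u 0 c).

Definition in_maxideal u : Prop := forall c, (u 0 c)@_0%MM = 0.

Lemma fdeg0 j : fdeg j 0.
Proof. by move=> c; rewrite mxE; apply: hom0. Qed.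

Lemma fdegB j u v : fdeg j u -> fdeg j v -> fdeg j (u - v).
Proof. by move=> Du Dv c; rewrite !mxE; apply: homB. Qed.

Lemma fdegZ j a p u : hom N a p -> fdeg j u -> fdeg (a + j) (p *: u).
Proof. by move=> hp Du c; rewrite mxE -addrA; apply: homM. Qed.

Lemma fdeg_delta c : fdeg (tw c) (delta_mx 0 c).
Proof.
move=> c'; rewrite mxE eqxx /=; case: eqP => [->|_]; last exact: hom0.
by rewrite subrr -mpolyC1; apply: homC.
Qed.

(** The homogeneous elements of a given degree have finitely many coefficients, so
    linear algebra over the field applies. *)
Lemma fdeg_span j (P : 'rV[S]_r -> Prop) :
    (forall u, P u -> fdeg j u) ->
  exists k (M : 'M[S]_(k, r)), (forall i, P (row i M)) /\
    forall u, P u -> exists a : 'rV[F]_k, u = map_mx (@mpolyC N F) a *m M.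
Proof.
move=> Pdeg; pose T : finType := ('I_r * 'X_{1..N < (`|j|%N).+1})%type.
pose enc (u : 'rV[S]_r) : 'rV[F]_#|T| :=
  \row_(x < #|T|) (u 0 (enum_val x).1)@_(bmnm (enum_val x).2).
have encM k (a : 'rV[F]_k) (M : 'M[S]_(k, r)) :
    enc (map_mx (@mpolyC N F) a *m M) = a *m \matrix_i enc (row i M).
  apply/rowP => x; rewrite !mxE raddf_sum; apply: eq_bigr => i _.
  by rewrite !mxE /= mcoeffCM.
have enc_inj u v : fdeg j u -> fdeg j v -> enc u = enc v -> u = v.
  move=> Du Dv uv; apply/rowP => c; apply/mpolyP => m.
  have [le_m|lt_m] := ltnP (mdeg m) (`|j|%N).+1.
    have /rowP/(_ (enum_rank (c, BMultinom le_m) : 'I_#|T|)) := uv.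
    by rewrite !mxE enum_rankK.
  have vanish w : fdeg j w -> (w 0 c)@_m = 0.
    by move=> Dw; apply/eqP/negPn/negP => /Dw[]; lia.
  by rewrite !vanish.
have [k [A [PA spanA]]] := subspace_rows (fun v : 'rV[F]_#|T| => exists2 u, P u & enc u = v).
have /fin_all_exists2[g Pg gA] i : exists2 u, P u & enc u = row i A by apply: PA.
exists k, (\matrix_i g i); split=> [i|u Pu]; first by rewrite rowK.
have /submxP[a def_a] : (enc u <= A)%MS by apply: spanA; exists u.
exists a; apply: enc_inj; first exact: Pdeg.
  move=> c; rewrite mxE; apply: hom_sum => i _; rewrite !mxE -[_ - _]add0r.
  by apply: homM; [apply: homC | apply/Pdeg/Pg].
rewrite encM def_a; congr (_ *m _); apply/row_matrixP => i.
by rewrite rowK -gA; congr enc; rewrite rowK.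
Qed.

(** The Koszul complex is taken on arbitrary linear forms [l], since a basis of the
    sections of degree one need not be the monomial one. *)
Section Koszul.
Variables (l : nat -> S) (M : nat).
Hypothesis hom_l : forall k, (k < M)%N -> hom N 1 (l k).
Hypothesis l_acyclic : forall p j : int, (p != 0) || (j != 0) ->
  acyclic l (hom N : int -> S^o -> Prop) M p j.

Lemma graded_fdeg n : (n <= M)%N -> graded_module l fdeg n.
Proof.
move=> le_nM; split=> [j|j u v|k j u lt_kn]; [exact: fdeg0|exact: fdegB|].
by rewrite addrC; apply: fdegZ; apply: hom_l; apply: leq_trans le_nM.
Qed.

Lemma fdeg_acyclic p j : p != 0 -> acyclic l fdeg M p j.
Proof.
move=> p0; pose E (c : 'I_r) (j : int) := @hom F N N (j - (tw c)%:Z).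
apply: (@cycles_bound_row _ l r E E).
by move=> c; apply: cycles_bound_shift; apply: l_acyclic; rewrite p0.
Qed.

(** A free module has homology only at [p = 0] in the degrees of its generators; a
    cycle with coefficients in the maximal ideal has no component there. *)
Lemma fdeg_bound p j :
  cycles_bound l (fun j u => fdeg j u /\ in_maxideal u) fdeg M p j.
Proof.
apply: (@cycles_bound_sub _ _ _
  (fun j u => forall c, hom N (j - (tw c)%:Z) (u 0 c) /\ (u 0 c)@_0%MM = 0)
  fdeg) => // [j0 u [Du mu] c|]; first by split; [apply: Du | apply: mu].
apply: (cycles_bound_row
  (Dc' := fun c j p => hom N (j - (tw c)%:Z) p /\ p@_0%MM = 0)
  (Dc := fun c j => hom N (j - (tw c)%:Z))) => c.
apply: (@cycles_bound_shift _ _ S^o (fun j p => hom N j p /\ p@_0%MM = 0)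
  (hom N)).
have [nz|] := boolP ((p != 0) || (j - (tw c)%:Z != 0)).
  by apply: cycles_bound_sub (l_acyclic nz) => // j0 u [].
rewrite negb_or !negbK => /andP[/eqP-> /eqP->] z Dz dz; exists 0.
  apply: (@kdeg0 _ l _ _ 0); split=> [j0|j0 u v|//]; first exact: hom0.
  exact: homB.
rewrite kd0; apply/esym; move: Dz => /kdeg0P[u [hu u0] ->].
suff -> : u = 0 by elim: (M) => [|n] //= ->.
have [//|/eqP nz_u] := eqVneq u 0.
apply/mpolyP => m; rewrite mcoeff0.
have [->//|nz_m] := eqVneq m 0%MM; apply/eqP/negPn/negP => /hu[dm _].
by case/negP: nz_m; rewrite -mdeg_eq0 -eqz_nat dm.
Qed.

End Koszul.

(** Modulo the maximal ideal the Koszul differential becomes zero. *)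
Lemma boundary_in_maxideal (l : nat -> S) n p j (w : koszul 'rV[S]_r n) u :
    (forall k, (l k)@_0%MM = 0) ->
  kdeg fdeg p j w -> kd l w = kemb n u -> in_maxideal u.
Proof.
move=> l0 Dw dw.
pose f (_ : int) (v : 'rV[S]_r) : 'rV[F]_r := map_mx (fun p : S => p@_0%MM) v.
have fB k : {morph f k : u v / u - v}.
  by move=> v v'; apply/rowP => c; rewrite !mxE mcoeffB.
have f0 k : f k 0 = 0 by apply/rowP => c; rewrite !mxE mcoeff0.
have fZ i k v : (i < n)%N -> fdeg k v -> f (k + 1) (l i *: v) = 0 *: f k v.
  by move=> _ _; apply/rowP => c; rewrite !mxE rmorphM /= l0 !mul0r.
have := kd_kmap (l' := fun=> 0) fB fZ (leqnn n) Dw.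
rewrite kd_trivial => [|k v]; last by rewrite scale0r.
rewrite dw (kmap_kemb _ _ (f0 _)) => /esym.
rewrite -[RHS](_ : kemb n 0 = 0); last by elim: n {w dw Dw fZ} => //= n ->.
by move=> /kemb_inj/rowP fu0 c; have := fu0 c; rewrite !mxE.
Qed.

End Rank.
End FreeModules.

Section MinimalGenerators.
Variables (F : fieldType) (N : nat).
Notation S := {mpoly F[N]}.

Lemma hom_mvar k : (k < N)%N -> hom N 1 (mvar F N k).
Proof.
move=> lt_kN; rewrite (mvarE _ (Ordinal lt_kN)) => m.
rewrite mcoeffX.
have [<- _|_] := eqVneq U_(Ordinal lt_kN)%MM m; last by rewrite eqxx.
by rewrite mdeg1; split=> // i; rewrite leqNgt ltn_ord.
Qed.

Lemma mvar_const k : (mvar F N k)@_0%MM = 0.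
Proof.
rewrite /mvar; case: insubP => [i _ _|_]; last by rewrite mcoeff0.
by rewrite mcoeffX mnm1_eq0.
Qed.

Lemma mvar_acyclic (p j : int) : (p != 0) || (j != 0) ->
  acyclic (mvar F N) (hom N : int -> S^o -> Prop) N p j.
Proof. exact: hom_acyclic. Qed.

(** A finite family of homogeneous elements of a free module, the rows of [gmx],
    with their degrees. *)
Record generators (r : nat) := Generators {
  grank : nat;
  gtw : 'I_grank -> nat;
  gmx : 'M[S]_(grank, r)
}.

Lemma graded_fdeg_mvar r (tw : 'I_r -> nat) :
  graded_module (mvar F N) (fdeg tw) N.
Proof. by apply: (@graded_fdeg _ _ _ _ _ N) => // k; apply: hom_mvar. Qed.

Section Submodule.
Variables (r : nat) (tw : 'I_r -> nat) (Z : int -> 'rV[S]_r -> Prop).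

(** Stability under the scalars and the variables implies stability under all
    homogeneous polynomials, see [subM]. *)
Record graded_submodule : Prop := GradedSubmodule {
  sub0 : forall j, Z j 0;
  subB : forall j u v, Z j u -> Z j v -> Z j (u - v);
  subC : forall j (a : F) u, Z j u -> Z j (a%:MP *: u);
  subX : forall j k u, (k < N)%N -> Z j u -> Z (j + 1) (mvar F N k *: u);
  sub_fdeg : forall j u, Z j u -> fdeg tw j u
}.

Hypothesis Zsub : graded_submodule.

Lemma graded_sub n : (n <= N)%N -> graded_module (mvar F N) Z n.
Proof.
move=> le_nN; split=> [j|j u v|k j u lt_kn]; [exact: sub0|exact: subB|].
by apply: subX => //; apply: leq_trans le_nN.
Qed.

Lemma subN j u : Z j u -> Z j (- u).
Proof. by rewrite -sub0r; apply: subB => //; apply: sub0. Qed.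

Lemma subD j u v : Z j u -> Z j v -> Z j (u + v).
Proof. by move=> Zu /subN; rewrite -{2}[v]opprK; apply: subB. Qed.

Lemma subMX m j u : Z j u -> Z ((mdeg m)%:Z + j) ('X_[m] *: u).
Proof.
move: {2}(mdeg m) (erefl (mdeg m)) => n; elim: n m j u => [|n IHn] m j u.
  by move/eqP; rewrite mdeg_eq0 => /eqP-> Zu; rewrite mpolyX0 mdeg0 add0r scale1r.
move=> dm Zu; have [i [m' [-> dm']]] := mnm_split dm.
rewrite mpolyXD mulrC -scalerA mdegD mdeg1 PoszD -addrA -(mvarE F i).
rewrite addrCA; apply: IHn => //; rewrite addrC.
exact: subX.
Qed.

Lemma subM a p j u : hom N a p -> Z j u -> Z (a + j) (p *: u).
Proof.
move=> hp Zu; rewrite [p]mpolyE scaler_suml.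
rewrite big_seq; elim/big_rec: _ => [|m q]; first exact: sub0.
rewrite mcoeff_msupp => /hp[<- _] Zq; apply: subD => //.
by rewrite -mul_mpolyC -scalerA; apply/subC => //; apply: subMX.
Qed.

Definition gens_in (g : generators r) : Prop :=
  forall c, Z (gtw c) (row c (gmx g)).

Definition lifts (g : generators r) (j : int) : Prop :=
  forall u, Z j u -> exists2 v, fdeg (@gtw _ g) j v & v *m gmx g = u.

(** Nakayama's lemma in one degree: if the Koszul homology of [Z] vanishes at
    [p = 0] then an element of degree [j] is a combination of elements of degree
    [j - 1] with the variables as coefficients. *)
Lemma lift_boundary g j u :
    lifts g (j - 1) -> acyclic (mvar F N) Z N 0 j -> Z j u ->
  exists v, [/\ fdeg (@gtw _ g) j v, v *m gmx g = u & in_maxideal v].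
Proof.
move=> lg acZ Zu.
have gr0 := graded_sub (leq0n N).
have [||w Dw dw] := acZ (kemb N u).
- exact: kdeg_kemb gr0 Zu.
- exact: kd_kemb.
pose f (v : 'rV[S]_(grank g)) := v *m gmx g.
have fB : {morph f : u v / u - v} by move=> v v'; apply: mulmxBl.
have [w1 Dw1 fw1] := kmap_surj fB lg Dw.
have grg := graded_fdeg (@gtw _ g) hom_mvar (leqnn N).
have := kdeg_kd grg (leqnn N) Dw1; rewrite addrK subrK => /kdeg0P[v Dv dw1].
exists v; split=> //; last exact: boundary_in_maxideal mvar_const Dw1 dw1.
have fZ i k w0 : (i < N)%N -> fdeg (@gtw _ g) k w0 ->
    f (mvar F N i *: w0) = mvar F N i *: f w0.
  by move=> _ _; rewrite /f scalemxAl.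
have := kd_kmap (f := fun=> f) (fun=> fB) fZ (leqnn N) Dw1.
rewrite fw1 dw dw1 kmap_kemb; last exact: mul0mx.
by move/kemb_inj => ->.
Qed.

Lemma gens_in_span g j v :
  gens_in g -> fdeg (@gtw _ g) j v -> Z j (v *m gmx g).
Proof.
move=> Zg Dv; rewrite mulmx_sum_row; elim/big_rec: _ => [|c u _ Zu].
  exact: sub0.
apply: subD => //; rewrite -(subrK (gtw c)%:Z j).
exact: subM.
Qed.

Lemma gens_in_degree (t : nat) : exists2 g, gens_in g & lifts g t.
Proof.
have [k [M [ZM spanM]]] := fdeg_span (sub_fdeg Zsub (j := t)).
exists (Generators (fun=> t) M) => [c|u /spanM[a ->]]; first exact: ZM.
exists (map_mx (@mpolyC N F) a) => // c.
by rewrite mxE subrr; apply: homC.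
Qed.

Lemma lifts_lt0 g j : j < 0 -> lifts g j.
Proof.
move=> j0 u /(sub_fdeg Zsub) Du; exists 0; first exact: fdeg0.
rewrite mul0mx; apply/rowP => c; rewrite mxE; apply/esym.
by apply: hom_lt0 (Du c); lia.
Qed.

Lemma gens_upto (t : nat) :
  exists2 g, gens_in g & forall j : int, j <= t%:Z -> lifts g j.
Proof.
elim: t => [|t [g Zg lg]].
  have [g Zg lg] := gens_in_degree 0; exists g => // j le_j.
  by have [j0|j0] := leP 0 j; [have -> : j = 0 by lia | apply: lifts_lt0].
have [h Zh lh] := gens_in_degree t.+1.
pose tw' (c : 'I_(grank g + grank h)) :=
  match split c with inl i => gtw i | inr i => gtw i end.
exists (Generators tw' (col_mx (gmx g) (gmx h))) => [c|j le_j].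
  rewrite /tw' /=; case: splitP => i def_c.
    rewrite (_ : c = lshift _ i); last exact: val_inj.
    by rewrite rowKu; apply: Zg.
  rewrite (_ : c = rshift _ i); last exact: val_inj.
  by rewrite rowKd; apply: Zh.
have [le_jt|lt_tj] := leP j t%:Z.
  move=> u /(lg _ le_jt)[v Dv <-]; exists (row_mx v 0).
    move=> c; rewrite /tw' /= mxE; case: split => i; last by rewrite mxE; apply: hom0.
    exact: Dv.
  by rewrite mul_row_col mul0mx addr0.
have -> : j = t.+1 by lia.
move=> u /lh[v Dv <-]; exists (row_mx 0 v).
  move=> c; rewrite /tw' /= mxE; case: split => i; first by rewrite mxE; apply: hom0.
  exact: Dv.
by rewrite mul_row_col mul0mx add0r.
Qed.

Definition finitely_generated : Prop :=
  exists2 g, gens_in g & forall j : int, lifts g j.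

(** Generators of degree at most [t] generate in all degrees, by [lift_boundary].
    This replaces the Hilbert basis theorem. *)
Lemma bounded_generation (t : nat) :
    (forall j : int, t%:Z < j -> acyclic (mvar F N) Z N 0 j) ->
  finitely_generated.
Proof.
move=> acZ; have [g Zg lg] := gens_upto t; exists g => //.
suff lgn (n : nat) j : j <= t%:Z + n%:Z -> lifts g j.
  by move=> j; apply: (lgn `|j|%N); lia.
elim: n j => [|n IHn] j le_j; first by apply: lg; lia.
have [/lg//|lt_tj] := leP j t%:Z.
move=> u Zu; have [|v [Dv <- _]] := lift_boundary (g := g) _ (acZ _ lt_tj) Zu.
  by apply: IHn; lia.
by exists v.
Qed.

Record minimal_generators (g : generators r) : Prop := MinimalGenerators {
  mg_in : gens_in g;
  mg_lifts : forall j, lifts g j;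
  mg_min : forall j v, fdeg (@gtw _ g) j v -> v *m gmx g = 0 -> in_maxideal v
}.

(** A relation with a nonzero constant coefficient expresses one generator in terms
    of the others. *)
Lemma drop_generator g (j : int) v c :
    gens_in g -> (forall j, lifts g j) ->
    fdeg (@gtw _ g) j v -> v *m gmx g = 0 -> (v 0 c)@_0%MM != 0 ->
  exists2 h, gens_in h /\ (forall j, lifts h j) & grank g = (grank h).+1.
Proof.
case: g c v => k twg M c v /= Zg lg Dv vM0 nz_c.
case: k twg M c v Zg lg Dv vM0 nz_c => [|k] twg M c v Zg lg Dv vM0 nz_c.
  by case: c nz_c.
exists (Generators (fun i => twg (lift c i)) (row' c M)) => //=.
split=> [i|j' u /lg[w Dw <-]].
  rewrite /= (_ : row i _ = row (lift c i) M); first exact: Zg.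
  by apply/rowP => i'; rewrite !mxE.
rewrite /= in w Dw *; have [j0 def_vc] := hom_const (Dv c) nz_c.
set a := (v 0 c)@_0%MM in nz_c def_vc.
pose w' := w - (w 0 c * (a^-1)%:MP) *: v.
have w'c : w' 0 c = 0.
  rewrite !mxE def_vc -mulrA -mpolyCM mulVf // mulr1; exact: subrr.
have Dw' : fdeg twg j' w'.
  apply: fdegB => //.
  have := fdegZ (homM (Dw c) (@homC F N N a^-1)) Dv.
  by rewrite addr0 (_ : j = (twg c)%:Z) ?subrK //; lia.
exists (col' c w'); first by move=> i; rewrite mxE; apply: Dw'.
have -> : w *m M = w' *m M.
  by rewrite mulmxBl -scalemxAl vM0 scaler0 subr0.
apply/rowP => i; rewrite !mxE (bigD1_ord c) //= w'c mul0r add0r.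
by apply: eq_bigr => i' _; rewrite !mxE.
Qed.

Lemma minimal_generators_exist :
  finitely_generated -> exists g, minimal_generators g.
Proof.
case=> g0 Zg0 lg0.
pose P k := `[< exists2 g, gens_in g /\ (forall j, lifts g j) & grank g = k >].
have exP : exists k, P k by exists (grank g0); apply/asboolP; exists g0.
case: (ex_minnP exP) => k /asboolP[g [Zg lg] def_k] min_k.
exists g; split=> // j v Dv vM0 c; apply/eqP/negPn/negP => nz_c.
have [h [Zh lh] def_g] := drop_generator Zg lg Dv vM0 nz_c.
have /min_k : P (grank h) by apply/asboolP; exists h.
by rewrite -def_k def_g ltnn.
Qed.

(** Otherwise [lift_boundary] writes the generator [c] as a combination with
    coefficients in the maximal ideal, and the difference contradicts
    minimality. *)
Lemma minimal_generator_degree g c :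
  minimal_generators g -> ~ acyclic (mvar F N) Z N 0 (@gtw _ g c).
Proof.
case=> Zg lg min_g acZ.
have [v [Dv vM mv]] := lift_boundary (g := g) (lg _) acZ (Zg c).
have /(_ c)/eqP : in_maxideal (delta_mx 0 c - v).
  apply: (min_g (gtw c)); first by apply: fdegB => //; apply: fdeg_delta.
  by rewrite mulmxBl -rowE vM subrr.
rewrite !mxE !eqxx mcoeffB mv subr0.
by rewrite mcoeff1 eqxx oner_eq0.
Qed.

Lemma minimal_generator_neq0 g c :
  minimal_generators g -> row c (gmx g) <> 0.
Proof.
case=> Zg lg min_g Mc0.
have := min_g (gtw c) (delta_mx 0 c) (@fdeg_delta F N _ (@gtw _ g) c).
rewrite -rowE Mc0 => /(_ erefl c)/eqP; rewrite !mxE !eqxx mcoeff1 eqxx.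
by rewrite oner_eq0.
Qed.

End Submodule.

Lemma fdeg_submodule r (tw : 'I_r -> nat) : graded_submodule tw (fdeg tw).
Proof.
split=> [j|j u v|j a u Du|j k u lt_k Du|//]; [exact: fdeg0|exact: fdegB| |].
  by rewrite -[j]add0r; apply: fdegZ => //; apply: homC.
by rewrite addrC; apply: fdegZ => //; apply: hom_mvar.
Qed.

End MinimalGenerators.

(** * Minimal resolutions *)

Section Resolution.
Variables (F : fieldType) (N : nat).
Notation S := {mpoly F[N]}.
Variables (Q : comNzRingType) (ev : {rmorphism S -> Q}).
Variable DG : int -> Q -> Prop.

Let lG k := ev (mvar F N k).

Definition quo_acyclic (p j : int) : Prop :=
  acyclic lG (DG : int -> Q^o -> Prop) N p j.

(** What the construction of the minimal resolution of [Q] needs: a graded quotient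
    without linear relations, of bounded regularity. *)
Record graded_quotient : Prop := GradedQuotient {
  gq_graded : graded_module lG (DG : int -> Q^o -> Prop) N;
  gq_hom : forall j u, hom N j u -> DG j (ev u);
  gq_surj : forall j v, DG j v -> exists2 u, hom N j u & ev u = v;
  gq_nondeg : forall j u, j < 2 -> hom N j u -> ev u = 0 -> u = 0;
  gq_bounded : exists T : nat, forall p j, T%:Z < j -> quo_acyclic p j
}.

Hypothesis gqG : graded_quotient.

(** A free module together with the graded submodule that the next term of the
    resolution has to cover. *)
Record presentation := Presentation {
  prank : nat;
  ptw : 'I_prank -> nat;
  prel : int -> 'rV[S]_prank -> Prop
}.

(** The default value is never reached, see [mgensP]; it makes the resolution
    definable before the existence of minimal generators is proved. *)
Definition mgens (P : presentation) : generators F N (prank P) :=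
  if pselect (exists g, minimal_generators (@prel P) g) is left ex
  then projT1 (cid ex)
  else @Generators F N _ 0 (fun=> 0%N) 0.

Definition pnext (P : presentation) : presentation :=
  @Presentation (grank (mgens P)) (@gtw _ _ _ (mgens P))
    (fun j u => fdeg (@gtw _ _ _ (mgens P)) j u /\ u *m gmx (mgens P) = 0).

Definition syz (q : nat) : presentation :=
  iter q pnext (@Presentation 1 (fun=> 0%N)
    (fun j u => fdeg (fun=> 0%N) j u /\ ev (u 0 0) = 0)).

(** Invariant of the construction.  [gp_acyclic] is the dimension shift: the Koszul
    homology of the [q]-th syzygy module is that of [Q], [q.+1] steps further. *)
Record good_presentation (q : nat) (P : presentation) : Prop := GoodPres {
  gp_sub : graded_submodule (@ptw P) (@prel P);
  gp_max : forall j u, @prel P j u -> in_maxideal u;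
  gp_low : forall j u, j < q%:Z + 2 -> @prel P j u -> u = 0;
  gp_acyclic : forall p j,
    quo_acyclic (p + q%:Z + 1) (j - q%:Z - 1) ->
    acyclic (mvar F N) (@prel P) N p j
}.

Lemma good_fg q P : good_presentation q P -> finitely_generated (@prel P).
Proof.
move=> gP; have [T bT] := gq_bounded gqG.
apply: (bounded_generation (gp_sub gP) (t := (T + q + 1)%N)) => j lt_j.
by apply: (gp_acyclic gP); apply: bT; lia.
Qed.

Lemma mgensP q P : good_presentation q P ->
  minimal_generators (@prel P) (mgens P).
Proof.
move=> gP; rewrite /mgens; case: pselect => [ex|[]]; first by case: cid.
exact: minimal_generators_exist (good_fg gP).
Qed.

Lemma good_syz0 : good_presentation 0 (syz 0).
Proof.
have grG := gq_graded gqG.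
have maxZ j (u : 'rV[S]_1) :
    fdeg (fun=> 0%N) j u /\ ev (u 0 0) = 0 -> in_maxideal u.
  case=> Du evu c; rewrite (ord1 c); apply/eqP/negPn/negP => nz.
  have [_ def_u] := hom_const (Du 0) nz.
  set a := (u 0 0)@_0%MM in nz def_u.
  have uU : u 0 0 * (a^-1)%:MP = 1 by rewrite def_u -mpolyCM mulfV.
  by have := congr1 ev uU; rewrite rmorphM evu mul0r rmorph1 => /esym/eqP; rewrite oner_eq0.
split.
- split=> [j|j u v [Du u0] [Dv v0]|j a u [Du u0]|j k u lt_k [Du u0]|j u []//] /=.
  + by split; [apply: fdeg0 | rewrite mxE rmorph0].
  + by split; [apply: fdegB | rewrite !mxE rmorphB u0 v0 subrr].
  + split; last by rewrite mxE rmorphM u0 mulr0.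
    by rewrite -[j]add0r; apply: fdegZ => //; apply: homC.
  split; last by rewrite mxE rmorphM u0 mulr0.
  by rewrite addrC; apply: fdegZ => //; apply: hom_mvar.
- by move=> j u; apply: maxZ.
- move=> j u lt_j [Du u0]; apply/rowP => c; rewrite (ord1 c) mxE.
  apply: (gq_nondeg gqG _ _ u0 (j := j)); first by move: lt_j; rewrite add0r.
  by have := Du 0; rewrite subr0.
move=> p j; rewrite addr0 subr0 => acG.
pose f (_ : int) (u : 'rV[S]_1) : Q^o := ev (u 0 0).
apply: (acyclic_gker (D := fdeg (fun=> 0%N)) (f := f) (l' := lG) (D' := DG : int -> Q^o -> Prop)).
- exact: graded_fdeg_mvar.
- by move=> i u v; rewrite /f !mxE rmorphB.
- by move=> i k u lt_i Du; rewrite /f mxE rmorphM.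
- by move=> k u Du; apply: (gq_hom gqG); have := Du 0; rewrite subr0.
- move=> k v /(gq_surj gqG)[u Du <-]; exists (const_mx u); last by rewrite /f mxE.
  by move=> c; rewrite mxE subr0.
- exact: acG.
apply: (cycles_bound_sub (D' := fun j u => fdeg (fun=> 0%N) j u /\ in_maxideal u)
  (D := fdeg (fun=> 0%N))) => // [k u [Du u0]|]; first by split=> //; apply: (maxZ k).
by apply: fdeg_bound => p0 j0; apply: mvar_acyclic.
Qed.

Lemma good_pnext q P : good_presentation q P -> good_presentation q.+1 (pnext P).
Proof.
move=> gP; have mg := mgensP gP; have [Zg lg min_g] := mg.
set g := mgens P in Zg lg min_g mg.
have maxZ j (u : 'rV[S]_(grank g)) :
    fdeg (@gtw _ _ _ g) j u /\ u *m gmx g = 0 -> in_maxideal u.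
  by case; apply: min_g.
split.
- split=> [j|j u v [Du u0] [Dv v0]|j a u [Du u0]|j k u lt_k [Du u0]|j u []//] /=.
  + by split; [apply: fdeg0 | rewrite mul0mx].
  + by split; [apply: fdegB | rewrite mulmxBl u0 v0 subrr].
  + split; last by rewrite -scalemxAl u0 scaler0.
    by rewrite -[j]add0r; apply: fdegZ => //; apply: homC.
  split; last by rewrite -scalemxAl u0 scaler0.
  by rewrite addrC; apply: fdegZ => //; apply: hom_mvar.
- exact: maxZ.
- move=> j u lt_j Zu; have [Du u0] := Zu; have mu := maxZ _ _ Zu.
  apply/rowP => c; rewrite mxE; apply/mpolyP => m; rewrite mcoeff0.
  have [->|nz_m] := eqVneq m 0%MM; first exact: mu.
  apply/eqP/negPn/negP => /Du[dm _].
  have : (0 < mdeg m)%N by rewrite lt0n mdeg_eq0.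
  have : q%:Z + 2 <= (gtw c)%:Z.
    rewrite leNgt; apply/negP => lt_c.
    apply: (minimal_generator_neq0 (c := c) mg).
    exact (gp_low gP lt_c (Zg c)).
  by lia.
move=> p j acG.
apply: (acyclic_gker (D := fdeg (@gtw _ _ _ g)) (f := fun=> mulmxr (gmx g))
  (l' := mvar F N) (D' := @prel P)).
- exact: graded_fdeg_mvar.
- by move=> i u v /=; rewrite mulmxBl.
- by move=> i k u lt_i Du /=; rewrite scalemxAl.
- by move=> k u Du /=; exact (gens_in_span (gp_sub gP) Zg Du).
- by move=> k v /lg.
- apply: (gp_acyclic gP).
  have -> : p + 1 + q%:Z + 1 = p + q.+1%:Z + 1 by lia.
  by have -> : j - 1 - q%:Z - 1 = j - q.+1%:Z - 1 by lia.
apply: (cycles_bound_sub (D' := fun j u => fdeg (@gtw _ _ _ g) j u /\ in_maxideal u)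
  (D := fdeg (@gtw _ _ _ g))) => // [k u [Du u0]|]; first by split=> //; apply: (maxZ k).
by apply: fdeg_bound => p0 j0; apply: mvar_acyclic.
Qed.

Lemma good_syz q : good_presentation q (syz q).
Proof. by elim: q => [|q]; [apply: good_syz0 | apply: good_pnext]. Qed.

Definition res_mx (q : nat) : 'M[S]_(prank (syz q.+1), prank (syz q)) :=
  gmx (mgens (syz q)).

Lemma syz_gens q : minimal_generators (@prel (syz q)) (mgens (syz q)).
Proof. exact: mgensP (good_syz q). Qed.

(** A syzygy of degree below [q.+2] could only have constant coefficients, which
    minimality excludes. *)
Lemma res_twist_ge q (c : 'I_(prank (syz q.+1))) : (q.+2 <= ptw c)%N.
Proof.
rewrite leqNgt; apply/negP => lt_c.
apply: (minimal_generator_neq0 (c := c) (syz_gens q)).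
apply: (gp_low (good_syz q) (j := (ptw c)%:Z)); first by lia.
exact: mg_in (syz_gens q) c.
Qed.

(** The degrees of the generators are read off the Koszul homology of [Q] through
    the dimension shift. *)
Lemma res_twist q (c : 'I_(prank (syz q.+1))) :
  ~ quo_acyclic (q%:Z + 1) ((ptw c)%:Z - q%:Z - 1).
Proof.
move=> acG; apply: (minimal_generator_degree (c := c) (gp_sub (good_syz q)) (syz_gens q)).
by apply: (gp_acyclic (good_syz q)); rewrite add0r.
Qed.

(** The Koszul complex on [N] elements has no term beyond the [N]-th exterior
    power. *)
Lemma res_rank_eq0 q : (N <= q)%N -> prank (syz q.+1) = 0%N.
Proof.
move=> le_Nq; case def_r: (prank (syz q.+1)) => [//|r].
have c : 'I_(prank (syz q.+1)) by rewrite def_r; apply: ord0.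
case: (res_twist (c := c)); apply: (acyclic_out (gq_graded gqG)); lia.
Qed.

End Resolution.

(** * Segre product with a line *)

Section SegreRows.
Variables (F : fieldType) (N : nat).
Notation S := {mpoly F[N]}.

Definition crow r (e : nat) (u : 'rV[{poly S}]_r) : 'rV[S]_r :=
  map_mx (fun p : {poly S} => p`_e) u.

Lemma crow_ext r (u v : 'rV[{poly S}]_r) : (forall e, crow e u = crow e v) -> u = v.
Proof.
move=> uv; apply/rowP => c; apply/polyP => e.
by have /rowP/(_ c) := uv e; rewrite !mxE.
Qed.

Lemma crowB r e (u v : 'rV[{poly S}]_r) : crow e (u - v) = crow e u - crow e v.
Proof. by apply/rowP => c; rewrite !mxE coefB. Qed.

Lemma crow0 r e : crow e (0 : 'rV[{poly S}]_r) = 0.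
Proof. by apply/rowP => c; rewrite !mxE coef0. Qed.

Lemma crow_mul r r' e (u : 'rV[{poly S}]_r) (M : 'M[S]_(r, r')) :
  crow e (u *m map_mx polyC M) = crow e u *m M.
Proof.
apply/rowP => c; rewrite !mxE coef_sum; apply: eq_bigr => i _.
by rewrite !mxE coefMC.
Qed.

Lemma crow_seg_var r e k (u : 'rV[{poly S}]_r) :
  crow e (seg_var F N k *: u) =
  if odd k then if e is e'.+1 then mvar F N k./2 *: crow e' u else 0
  else mvar F N k./2 *: crow e u.
Proof.
apply/rowP => c; rewrite /seg_var; case: odd; last by rewrite !mxE coefCM.
by rewrite !mxE -mulrA coefXM; case: e => [|e] /=; rewrite !mxE // coefCM.
Qed.

Section Segre.
Variables (r : nat) (tw : 'I_r -> nat) (Z : int -> 'rV[S]_r -> Prop).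

(** The Segre product of [Z] with [k[x, y]]: in degree [j], the elements of [Z j]
    times binary forms of degree [j], the latter written in the affine
    coordinate. *)
Definition segre (j : int) (u : 'rV[{poly S}]_r) : Prop :=
  (forall e, Z j (crow e u)) /\ (forall e : nat, j < e%:Z -> crow e u = 0).

Lemma graded_segre :
  graded_submodule tw Z -> graded_module (seg_var F N) segre N.*2.
Proof.
move=> Zsub; split=> [j|j u v [Zu u0] [Zv v0]|k j u lt_k [Zu u0]].
- by split=> e *; rewrite crow0; [apply: (sub0 Zsub) |].
- split=> e *; rewrite crowB; first exact: (subB Zsub).
  by rewrite u0 // v0 // subrr.
have lt_kN : (k./2 < N)%N by lia.
split=> e; rewrite crow_seg_var.
  case: odd; last exact: (subX Zsub).
  by case: e => [|e]; [apply: (sub0 Zsub) | apply: (subX Zsub)].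
case: odd => lt_j; last by rewrite u0 ?scaler0 //; lia.
by case: e lt_j => // e lt_j; rewrite u0 ?scaler0 //; lia.
Qed.

(** The Segre product of a free module is the sum of modules [seg], with
    the indexing shifted by the twist. *)
Lemma segre_fdeg j u : (forall j u, Z j u <-> fdeg tw j u) ->
  segre j u <-> forall c, seg N (tw c) (j - (tw c)%:Z) (u 0 c).
Proof.
move=> ZE; split=> [[Zu u0] c e m nz|hu].
  have /ZE/(_ c m) := Zu e; rewrite mxE => /(_ nz)[dm hm]; split=> //.
  rewrite subrK leNgt; apply/negP => /u0/rowP/(_ c); rewrite !mxE => e0.
  by rewrite e0 mcoeff0 eqxx in nz.
split=> [e|e lt_j]; first by apply/ZE => c; rewrite mxE; apply: (seg_hom (hu c)).
apply/rowP => c; rewrite !mxE; apply/mpolyP => m; rewrite mcoeff0.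
by apply/eqP/negPn/negP => /hu[_ _]; lia.
Qed.

End Segre.

(** The Segre product is exact since it is computed coefficient by coefficient;
    lifts have to be zero above the degree [j], where the coefficients vanish. *)
Lemma segre_lift r (Z : int -> 'rV[S]_r -> Prop) tw (g : generators F N r) j z :
    graded_submodule tw Z -> (forall j, lifts Z g j) ->
  segre Z j z ->
  exists2 u, segre (fdeg (@gtw _ _ _ g)) j u & u *m map_mx polyC (gmx g) = z.
Proof.
move=> Zsub lg [Zz z0].
have /choice[v v_z] (e : nat) : exists x : 'rV[S]_(grank g),
    [/\ fdeg (@gtw _ _ _ g) j x, x *m gmx g = crow e z & j < e%:Z -> x = 0].
  have [le_e|lt_e] := leP e%:Z j; last first.
    by exists 0; split; [apply: fdeg0 | rewrite mul0mx z0 |].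
  by have [x Dx xz] := lg _ _ (Zz e); exists x; split.
pose n := `|j|%N.+1.
pose u : 'rV[{poly S}]_(grank g) := \row_c \poly_(e < n) v e 0 c.
have cu e : crow e u = v e.
  apply/rowP => c; rewrite !mxE coef_poly; case: ltnP => // le_n.
  by have [_ _ ->] := v_z e; rewrite ?mxE //; lia.
exists u; last by apply: crow_ext => e; rewrite crow_mul cu; have [] := v_z e.
by split=> e *; rewrite cu; have [? ? v0] := v_z e => //; apply: v0.
Qed.

End SegreRows.

Section SegreAcyclic.
Variables (F : fieldType) (N : nat).
Notation S := {mpoly F[N]}.
Variables (Q : comNzRingType) (ev : {rmorphism S -> Q}).
Variable DG : int -> Q -> Prop.
Hypothesis gqG : graded_quotient ev DG.

Definition segD (j : int) (v : {poly Q}) : Prop :=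
  (forall c, DG j v`_c) /\ (forall c : nat, j < c%:Z -> v`_c = 0).

Definition seg_op (k : nat) : {poly Q} :=
  if odd k then 'X * (ev (mvar F N k./2))%:P else (ev (mvar F N k./2))%:P.

(** The two cases are the hypotheses of [seg_regular] and of [seg_var_acyclic],
    after the shift by the twist. *)
Let good r (tw : 'I_r -> nat) (p w : int) : Prop := forall c,
  2 <= w - (tw c)%:Z \/ (p <= (tw c)%:Z /\ 1 <= w - (tw c)%:Z).

Lemma segre_free_acyclic r (tw : 'I_r -> nat) p w : good tw p w ->
  acyclic (seg_var F N) (segre (@fdeg F N r tw)) N.*2 p w.
Proof.
move=> gd.
pose E (c : 'I_r) (j : int) := @seg F N N (tw c) (j - (tw c)%:Z).
pose E' (j : int) (u : 'rV[{poly S}]_r) := forall c, E c j (u 0 c).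
apply: (@cycles_bound_sub _ _ _ E' E').
- by move=> j u /(segre_fdeg j u (fun _ _ => iff_refl _)).
- by move=> j u Eu; apply/(segre_fdeg j u (fun _ _ => iff_refl _)).
apply: cycles_bound_row => c.
apply: (@cycles_bound_shift _ _ {poly S}^o (seg N (tw c)) (seg N (tw c))).
by case: (gd c) => [w2|[le_p w1]]; [apply: seg_regular | apply: seg_var_acyclic].
Qed.

Lemma segre_syz_step q (p w : int) :
    good (@ptw _ _ (syz ev q.+1)) p w ->
    acyclic (seg_var F N) (segre (@prel _ _ (syz ev q.+1))) N.*2 (p - 1) (w + 1) ->
  acyclic (seg_var F N) (segre (@prel _ _ (syz ev q))) N.*2 p w.
Proof.
move=> gd ac1; have gS := good_syz gqG q.
have [Zg lg min_g] := syz_gens gqG q; set g := mgens _ in Zg lg min_g.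
have grD := graded_segre (fdeg_submodule F N (@gtw _ _ _ g)).
apply: (acyclic_coker grD (f := fun=> mulmxr (map_mx polyC (gmx g)))).
- by move=> j u v /=; rewrite mulmxBl.
- by move=> i j u _ _ /=; rewrite scalemxAl.
- move=> j u [Du u0]; split=> e /=; rewrite crow_mul.
    exact (gens_in_span (gp_sub gS) Zg (Du e)).
  by move=> lt_j; rewrite u0 // mul0mx.
- by move=> j v; apply: (segre_lift (gp_sub gS) lg).
- exact: segre_free_acyclic.
apply: cycles_bound_sub ac1 => j u /=.
  case=> -[Du u0] uM0; split=> // e; split; first exact: Du.
  by rewrite -crow_mul [_ *m _]uM0 crow0.
case=> Zu u0; split; first by split=> // e; case: (Zu e).
by apply: crow_ext => e; rewrite crow_mul crow0; case: (Zu e).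
Qed.

(** Each step along the resolution lowers the exterior degree by one and raises
    the coefficient degree by one, until the exterior degree is negative. *)
Lemma segre_syz_acyclic (p q : nat) (w : int) :
    (forall e : nat, (e <= p)%N ->
       good (@ptw _ _ (syz ev (q + e).+1)) (p%:Z - e%:Z) (w + e%:Z)) ->
  acyclic (seg_var F N) (segre (@prel _ _ (syz ev q))) N.*2 p w.
Proof.
elim: p q w => [|p IHp] q w gd; apply: segre_syz_step.
- by have := gd 0%N isT; rewrite addn0 addr0 subr0.
- by apply: acyclic_out; [apply: graded_segre (gp_sub (good_syz gqG _)) | lia].
- by have := gd 0%N isT; rewrite addn0 addr0 subr0.
have -> : p.+1%:Z - 1 = p%:Z by lia.
apply: IHp => e le_e; rewrite addSnnS.
have -> : p%:Z - e%:Z = p.+1%:Z - e.+1%:Z by lia.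
have -> : w + 1 + e%:Z = w + e.+1%:Z by lia.
exact: gd.
Qed.

Lemma segre_acyclic (p : nat) (w : int) :
    good (fun _ : 'I_1 => 0%N) p w ->
    (forall q : nat, (q < p)%N ->
       good (@ptw _ _ (syz ev q.+1)) (p%:Z - q.+1%:Z) (w + q.+1%:Z)) ->
  acyclic seg_op (segD : int -> {poly Q}^o -> Prop) N.*2 p w.
Proof.
move=> gd0 gd.
pose f (_ : int) (u : 'rV[{poly S}]_1) : {poly Q}^o := map_poly ev (u 0 0).
have fE j u e : (f j u : {poly Q})`_e = ev (crow e u 0 0).
  by rewrite coef_map mxE.
have grD := graded_segre (fdeg_submodule F N (fun _ : 'I_1 => 0%N)).
apply: (acyclic_coker grD (f := f)).
- by move=> j u v; rewrite /f !mxE rmorphB.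
- move=> i j u _ _; rewrite /f !mxE rmorphM; congr (_ * _).
  by rewrite /seg_var /seg_op; case: odd; rewrite ?rmorphM /= ?map_polyX map_polyC.
- move=> j u [Du u0]; split=> e; rewrite fE.
    by apply: (gq_hom gqG); have := Du e 0; rewrite subr0.
  by move=> lt_j; rewrite u0 // mxE rmorph0.
- move=> j v [Dv v0].
  have /choice[x x_v] (e : nat) : exists x : S,
      [/\ hom N j x, ev x = v`_e & j < e%:Z -> x = 0].
    have [le_e|lt_e] := leP e%:Z j; last first.
      by exists 0; split; [apply: hom0 | rewrite rmorph0 v0 |].
    by have [x hx xv] := gq_surj gqG (Dv e); exists x; split.
  pose n := `|j|%N.+1.
  pose u : 'rV[{poly S}]_1 := const_mx (\poly_(e < n) x e).
  have cu e : crow e u = const_mx (x e).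
    apply/rowP => c; rewrite !mxE coef_poly; case: ltnP => // le_n.
    by have [_ _ ->] := x_v e => //; lia.
  exists u; last by apply/polyP => e; rewrite fE cu mxE; have [] := x_v e.
  split=> e; rewrite cu.
    by move=> c; rewrite mxE subr0; have [] := x_v e.
  by move=> lt_j; apply/rowP => c; rewrite !mxE; have [_ _ ->] := x_v e.
- exact: segre_free_acyclic.
have ac1 : acyclic (seg_var F N) (segre (@prel _ _ (syz ev 0))) N.*2 (p%:Z - 1) (w + 1).
  case: p gd0 gd => [|p] gd0 gd.
    by apply: acyclic_out; [apply: graded_segre (gp_sub (good_syz gqG _)) | lia].
  have -> : p.+1%:Z - 1 = p%:Z by lia.
  apply: segre_syz_acyclic => e le_e; rewrite add0n.
  have -> : p%:Z - e%:Z = p.+1%:Z - e.+1%:Z by lia.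
  have -> : w + 1 + e%:Z = w + e.+1%:Z by lia.
  exact: gd.
apply: cycles_bound_sub ac1 => j u /=.
  case=> -[Du u0] fu0; split=> // e; split; first exact: Du.
  by rewrite -(fE j) fu0 coef0.
case=> Zu u0; split; first by split=> // e; case: (Zu e).
by apply/polyP => e; rewrite fE coef0; case: (Zu e).
Qed.

End SegreAcyclic.

(** * The coordinate ring of a Segre product of lines *)

Section SegreRing.
Variable F : fieldType.

(** The coordinate ring in affine coordinates, one polynomial variable per line.
    The grading is not visible in the ring itself, an element being a section of
    every power that is large enough; [segdeg] restores it. *)
Fixpoint segring (d : nat) : comNzRingType :=
  if d is d'.+1 then {poly (segring d')} else F.

Fixpoint segconst (d : nat) : {rmorphism F -> segring d} :=
  if d is d'.+1 return {rmorphism F -> segring d} then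
    (polyC \o segconst d' : {rmorphism F -> {poly (segring d')}})
  else (idfun : {rmorphism F -> F}).

(** The dimension [2 ^ d] of the sections of degree one. *)
Fixpoint npt (d : nat) : nat := if d is d'.+1 then (npt d').*2 else 1%N.

(** The squarefree monomial whose exponents are the binary digits of [k], the last
    digit belonging to the last line. *)
Fixpoint gen (d : nat) (k : nat) : segring d :=
  if d is d'.+1 return segring d then
    if odd k then 'X * (gen d' k./2)%:P else (gen d' k./2)%:P
  else 1.

(** The polynomials of degree at most [j] in each variable. *)
Fixpoint segdeg (d : nat) (j : int) : segring d -> Prop :=
  if d is d'.+1 return segring d -> Prop then @segD _ (@segdeg d') j
  else fun v => 0 <= j \/ v = 0.

Definition segev (d : nat) : {mpoly F[npt d]} -> segring d :=
  mmap (segconst d) (fun i : 'I_(npt d) => gen d i).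

HB.instance Definition _ d := GRing.RMorphism.on (@segev d).

Lemma segev_mvar d k : (k < npt d)%N -> segev (mvar F (npt d) k) = gen d k.
Proof.
by move=> lt_k; rewrite (mvarE _ (Ordinal lt_k)) /segev mmapX mmap1U.
Qed.

Lemma segdeg0 d j : @segdeg d j 0.
Proof.
elim: d j => [|d IHd] j /=; first by right.
by split=> c; rewrite coef0.
Qed.

Lemma segdegB d j u v : @segdeg d j u -> segdeg j v -> segdeg j (u - v).
Proof.
elim: d j u v => [|d IHd] j u v /=.
  by move=> [|->]; [left | move=> [|->]; [left | right; rewrite subr0]].
move=> [Du u0] [Dv v0]; split=> c *; rewrite coefB; first exact: IHd.
by rewrite u0 // v0 // subrr.
Qed.

Lemma segdegN d j u : @segdeg d j u -> segdeg j (- u).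
Proof. by rewrite -sub0r; apply: segdegB; apply: segdeg0. Qed.

Lemma segdegD d j u v : @segdeg d j u -> segdeg j v -> segdeg j (u + v).
Proof. by move=> Du /segdegN; rewrite -{2}[v]opprK; apply: segdegB. Qed.

Lemma segdeg_sum d j (I : Type) (s : seq I) (P : pred I) (f : I -> segring d) :
  (forall x, P x -> segdeg j (f x)) -> segdeg j (\sum_(x <- s | P x) f x).
Proof.
by move=> hf; elim/big_rec: _ => [|x p Px]; [apply: segdeg0 | apply/segdegD/hf].
Qed.

Lemma segdegM d a b u v :
  @segdeg d a u -> segdeg b v -> segdeg (a + b) (u * v).
Proof.
elim: d a b u v => [|d IHd] a b u v /=.
  case=> [a0|->]; last by right; rewrite mul0r.
  by case=> [b0|->]; [left; apply: addr_ge0 | right; rewrite mulr0].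
move=> [Du u0] [Dv v0]; split=> c => [|lt_c]; rewrite coefM.
  by apply: segdeg_sum => i _; apply: IHd.
apply: big1 => i _; have [le_i|lt_i] := leP i%:Z a; last by rewrite u0 ?mul0r.
by rewrite v0 ?mulr0 //; have := ltn_ord i; lia.
Qed.

Lemma segdeg_const d a : segdeg 0 (segconst d a).
Proof.
elim: d => [|d IHd] /=; first by left.
split=> c => [|lt_c]; rewrite coefC; last by case: c lt_c.
by case: c => [|c] //=; apply: segdeg0.
Qed.

Lemma segdeg0_const d v : @segdeg d 0 v -> exists a, v = segconst d a.
Proof.
elim: d v => [|d IHd] v /=; first by exists v.
case=> Dv v0; have [a def_a] := IHd _ (Dv 0%N); exists a.
by apply/polyP => -[|c]; rewrite coefC /=; [apply: def_a | apply: v0].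
Qed.

Lemma segdeg_lt0 d j v : j < 0 -> @segdeg d j v -> v = 0.
Proof.
elim: d j v => [|d IHd] j v j0 /=; first by case=> //; lia.
by case=> _ v0; apply/polyP => c; rewrite coef0 v0 //; lia.
Qed.

Lemma segdeg_gen d k : segdeg 1 (gen d k).
Proof.
elim: d k => [|d IHd] k /=; first by left.
case: odd; split=> c; rewrite ?coefXM coefC.
- by case: c => [|[|c]] //=; apply: segdeg0.
- by case: c => [|[|c]].
- by case: c => [|c] //=; apply: segdeg0.
by case: c => [|c].
Qed.

Lemma gen_free d (a : nat -> F) :
  \sum_(k < npt d) segconst d (a k) * gen d k = 0 ->
  forall k, (k < npt d)%N -> a k = 0.
Proof.
elim: d a => [|d IHd] a /=.
  by rewrite big_ord1 mulr1 => a0 [|k].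
have sum_double (V : zmodType) (f : nat -> V) n :
    \sum_(k < n.*2) f k = \sum_(k < n) (f k.*2 + f k.*2.+1).
  elim: n => [|n IHn]; first by rewrite !big_ord0.
  by rewrite doubleS !big_ord_recr /= IHn addrA.
rewrite (sum_double _ (fun k => (segconst d (a k))%:P * gen d.+1 k)) => sum0 k lt_k.
have coefE c : \sum_(i < npt d) segconst d (a (i.*2 + c)%N) * gen d i
    = if (c < 2)%N then 0 else \sum_(i < npt d) segconst d (a (i.*2 + c)%N) * gen d i.
  case: ifP => // lt_c; have := congr1 (fun p : {poly segring d} => p`_c) sum0.
  rewrite coef0 coef_sum => sum0c; rewrite -[RHS]sum0c; apply: eq_bigr => i _ /=.
  rewrite !odd_double /= uphalf_double doubleK coefD !coefCM coefXM !coefC.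
  by case: c lt_c {sum0c} => [|[|c]] //= _; rewrite ?addn0 ?addn1 ?mulr0 ?addr0 ?add0r.
rewrite -(odd_double_half k) addnC; apply: (IHd (fun i => a (i.*2 + odd k)%N)).
  by rewrite coefE; case: odd.
by lia.
Qed.

Definition seg_acyclic d (p j : int) : Prop := quo_acyclic (@segev d) (@segdeg d) p j.

Lemma graded_segdeg d n : (n <= npt d)%N ->
  graded_module (fun k => segev (mvar F (npt d) k))
    (@segdeg d : int -> (segring d)^o -> Prop) n.
Proof.
move=> le_n; split=> [j|j u v|k j u lt_k Du]; [exact: segdeg0|exact: segdegB|].
rewrite segev_mvar; last exact: leq_trans le_n.
by rewrite addrC; apply: segdegM => //; apply: segdeg_gen.
Qed.

Lemma segev_hom d j u : hom (npt d) j u -> segdeg j (@segev d u).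
Proof.
move=> hu; rewrite /segev /mmap big_seq; apply: segdeg_sum => m.
rewrite mcoeff_msupp => /hu[<- _]; rewrite -[_%:Z]add0r.
apply: segdegM; first exact: segdeg_const.
have segdeg1 : segdeg 0 (1 : segring d).
  by have := segdeg_const d 1; rewrite rmorph1.
rewrite mdegE /mmap1 (big_morph Posz PoszD (erefl 0%:Z)).
elim/big_ind2: _ => [//|a x b y Da Db|i _].
  exact: segdegM.
elim: (m i) => [//|n IHn]; rewrite exprS -add1n PoszD.
by apply: segdegM => //; apply: segdeg_gen.
Qed.

Lemma segev_nondeg d (j : int) u : j < 2 -> hom (npt d) j u -> @segev d u = 0 -> u = 0.
Proof.
move=> j2 hu evu.
have [j0|j0] := ltP j 0; first exact: hom_lt0 hu.
apply/mpolyP => m; rewrite mcoeff0.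
have [j00|nz_j] := eqVneq j 0.
  rewrite j00 in hu.
  have [->|nz] := eqVneq u 0; first by rewrite mcoeff0.
  have nz0 : u@_0%MM != 0.
    apply: contra_neq nz => u0; apply/mpolyP => m'; rewrite mcoeff0.
    apply/eqP/negPn/negP => nz; have [dm _] := hu _ nz.
    suff m0 : m' = 0%MM by rewrite m0 u0 eqxx in nz.
    by apply/eqP; rewrite -mdeg_eq0; lia.
  have [_ def_u] := hom_const hu nz0; move: evu; rewrite def_u.
  rewrite /segev mmapC => /eqP; rewrite fmorph_eq0 => /eqP u0.
  by rewrite u0 eqxx in nz0.
have {j0 j2 nz_j} j1 : j = 1 by lia.
pose a k := if insub k is Some i then u@_U_(i : 'I_(npt d)) else 0.
have aE (i : 'I_(npt d)) : a i = u@_U_(i) by rewrite /a valK.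
have uE : u = \sum_(i < npt d) a i *: 'X_i.
  by rewrite [LHS](hom1_sum (k := npt d)) -?j1 //; apply: eq_bigr => i _; rewrite aE.
suff a0 (i : 'I_(npt d)) : a i = 0.
  by rewrite uE raddf_sum big1 //= => i _; rewrite a0 scale0r mcoeff0.
have := gen_free (d := d) (a := a) _ (ltn_ord i); apply.
rewrite -[RHS]evu [in RHS]uE raddf_sum; apply: eq_bigr => k _.
by rewrite /= /segev mmapZ mmapX mmap1U.
Qed.

(** As in [lift_boundary], the vanishing at [p = 0] produces an element of degree
    [j] from elements of degree [j - 1]. *)
Lemma segev_surj d : (forall j : int, 1 <= j -> seg_acyclic d 0 j) ->
  forall j v, segdeg j v -> exists2 u, hom (npt d) j u & @segev d u = v.
Proof.
move=> ac0.
suff surj (n : nat) j v : j <= n%:Z -> segdeg j v ->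
    exists2 u, hom (npt d) j u & @segev d u = v.
  by move=> j v; apply: (surj `|j|%N); lia.
elim: n j v => [|n IHn] j v le_j Dv.
  have [j0|j0] := ltP j 0.
    by exists 0; [apply: hom0 | rewrite rmorph0 (segdeg_lt0 j0 Dv)].
  have {j0 le_j} j0 : j = 0 by lia.
  rewrite j0 in Dv *; have [a ->] := segdeg0_const Dv.
  by exists a%:MP; [apply: homC | rewrite /segev mmapC].
have [lt_j|le_nj] := ltP j n.+1%:Z; first by apply: IHn => //; lia.
have j1 : 1 <= j by lia.
have [||w Dw dw] := ac0 j j1 (kemb (npt d) (v : (segring d)^o)).
- exact: kdeg_kemb (graded_segdeg (leq0n _)) Dv.
- exact: kd_kemb.
have lift1 v1 : segdeg (j - 1) v1 ->
    exists2 u, hom (npt d) (j - 1) u & @segev d u = v1 by apply: IHn; lia.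
pose f (u : {mpoly F[npt d]}^o) : (segring d)^o := segev u.
have evB : {morph f : u v / u - v} by move=> u1 u2; apply: rmorphB.
have [w1 Dw1 fw1] := kmap_surj evB lift1 Dw.
have grh := graded_hom F (n := npt d) (k := npt d) (N := npt d) _.
have := kdeg_kd (grh _) (leqnn (npt d)) Dw1; rewrite leqnn addrK subrK.
move/(_ isT)/kdeg0P => [u Du dw1]; exists u => //.
have evZ (i : nat) (k : int) (u1 : {mpoly F[npt d]}^o) : (i < npt d)%N -> hom (npt d) k u1 ->
    f (mvar F (npt d) i *: u1) = (segev (mvar F (npt d) i) : segring d) *: f u1.
  by move=> _ _; apply: (rmorphM (@segev d)).
have := kd_kmap (f := fun=> f) (l' := fun i => segev (mvar F (npt d) i)) (fun=> evB) evZ (leqnn _) Dw1.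
rewrite fw1 dw dw1 kmap_kemb; last exact: rmorph0.
by move/kemb_inj => ->.
Qed.

End SegreRing.

Section SegreVanishing.
Variable F : fieldType.

(** Only [sv_linear] concerns the linear part of the resolution; [sv_regular] and
    [sv_generated] are carried along the induction to have a finite resolution of
    a ring generated in degree one. *)
Record seg_vanishing (d : nat) : Prop := SegVanishing {
  sv_regular : forall p j : int, d%:Z < j -> seg_acyclic F d p j;
  sv_linear : forall p j : int, 1 <= p <= 3 -> 2 <= j -> seg_acyclic F d p j;
  sv_generated : forall j : int, 1 <= j -> seg_acyclic F d 0 j
}.

Lemma seg_graded_quotient d : seg_vanishing d ->
  graded_quotient (@segev F d) (@segdeg F d).
Proof.
case=> reg lin gen; split.
- exact: graded_segdeg.
- exact: segev_hom.
- exact: segev_surj.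
- exact: segev_nondeg.
by exists d.
Qed.

(** For a point the ring is a polynomial ring on its only generator, which acts as
    the identity because all graded pieces are identified with the field. *)
Lemma seg_vanishing0 : seg_vanishing 0.
Proof.
suff ac (p j : int) : 1 <= j -> seg_acyclic F 0 p j.
  by split=> [p j j0|p j _ j2|j]; try apply: ac; lia.
move=> j1 [a b] [/= Da Db] [/= dz _].
have ev1 : @segev F 0 (mvar F 1 0) = 1 by exact: (@segev_mvar F 0 0).
rewrite ev1 add0r scale1r in dz.
exists (0, a); last by rewrite /= ev1 add0r scale1r dz oppr0.
rewrite addrK; split=> /=; first by case: ifP => // _; right.
by move: Da; case: ifP => // _ _; left; lia.
Qed.

(** The resolution for [d] lines satisfies the conditions on twists of
    [segre_acyclic]: its [q]-th term is generated in degree [q + 1] for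
    [1 <= q <= 3], and in degree at most [q + d] always. *)
Lemma seg_vanishingS d : seg_vanishing d -> seg_vanishing d.+1.
Proof.
move=> sv; have gq := seg_graded_quotient sv; have [reg lin _] := sv.
have tw_reg q c : (ptw (p := syz (@segev F d) q.+1) c <= q.+1 + d)%N.
  rewrite leqNgt; apply/negP => lt_c; apply: (res_twist gq (c := c)).
  by apply: reg; lia.
have tw_lin q c : (q < 3)%N -> (ptw (p := syz (@segev F d) q.+1) c <= q.+2)%N.
  move=> lt_q; rewrite leqNgt; apply/negP => lt_c.
  apply: (res_twist gq (c := c)).
  by apply: lin; lia.
have ac (p : nat) (j : int) :
    2 <= j \/ (p = 0%N /\ 1 <= j) ->
    (forall q c, (q < p)%N -> let t := (ptw (p := syz (@segev F d) q.+1) c)%:Z in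
      2 <= j + q.+1%:Z - t \/
      (p%:Z - q.+1%:Z <= t /\ 1 <= j + q.+1%:Z - t)) ->
    seg_acyclic F d.+1 p j.
  move=> j12 gd; apply: (@eq_acyclic _ (seg_op (@segev F d))).
    move=> k lt_k; transitivity (@gen F d.+1 k).
      have lt_k2 : (k./2 < npt d)%N by move: lt_k => /=; lia.
      by have /= := @segev_mvar F d _ lt_k2; rewrite /seg_op /= => ->.
    by apply/esym/(@segev_mvar F d.+1).
  apply: (segre_acyclic gq) => [c|q lt_q c]; last exact: gd.
  by case: j12 => [j2|[-> j1]]; [left | right]; lia.
split=> [p j lt_j|p j p13 j2|j j1].
- have [p0|p0] := ltP p 0.
    by apply: (acyclic_out (@graded_segdeg F d.+1 _ (leqnn _))); rewrite p0.
  have -> : p = `|p|%N by lia.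
  apply: ac => [|q c lt_q]; first by left; lia.
  by left; have := tw_reg q c; lia.
- have -> : p = `|p|%N by lia.
  apply: ac => [|q c lt_q]; first by left.
  (* The next term has twist q + 2 and has to satisfy p - (q + 1) <= q + 2; this
     follows from p <= 3. *)
  have lt_q3 : (q < 3)%N by lia.
  by right; have := tw_lin q c lt_q3; have := res_twist_ge gq c; lia.
by apply: (ac 0%N) => [|q c]; [right|].
Qed.

Lemma seg_vanishingP d : seg_vanishing d.
Proof. by elim: d => [|d]; [apply: seg_vanishing0 | apply: seg_vanishingS]. Qed.

End SegreVanishing.

(** * Regular functions on the projective line *)

Section Line.
Variable F : numClosedFieldType.
Implicit Types (p q g h : {poly F}).

Lemma poly_eq0_of_zero p : (forall t, p.[t] = 0) -> p = 0.
Proof.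
move=> p0; apply/eqP/negPn/negP => nz_p.
pose rs : seq F := [seq k%:R | k <- iota 0 (size p)].
have rs0 : all (root p) rs by apply/allP => t _; apply/eqP/p0.
have urs : uniq rs.
  by rewrite map_inj_uniq ?iota_uniq // => i j /eqP; rewrite eqr_nat => /eqP.
by have := max_poly_roots nz_p rs0 urs; rewrite size_map size_iota ltnn.
Qed.

(** A fraction that computes [phi] where its denominator is not zero; nothing is
    said at the zeros of the denominator. *)
Definition represents (phi : F -> F) g h : Prop :=
  h != 0 /\ forall t, h.[t] != 0 -> phi t = g.[t] / h.[t].

Lemma represents_cross phi g h g' h' :
  represents phi g h -> represents phi g' h' -> g * h' = g' * h.
Proof.
move=> [nz_h gh] [nz_h' gh'].
suff /eqP : (g * h' - g' * h) * (h * h') = 0.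
  by rewrite mulf_eq0 subr_eq0 mulf_eq0 (negPf nz_h) (negPf nz_h') !orbF => /eqP.
apply: poly_eq0_of_zero => t; rewrite !(hornerM, hornerD, hornerN).
have [->|nz] := eqVneq h.[t] 0; first by rewrite mul0r mulr0.
have [->|nz'] := eqVneq h'.[t] 0; first by rewrite !mulr0.
have eq_gh : g.[t] / h.[t] = g'.[t] / h'.[t] by rewrite -gh // -gh'.
suff -> : g.[t] * h'.[t] - g'.[t] * h.[t] = 0 by rewrite mul0r.
apply/eqP; rewrite subr_eq0 -[g.[t]](divfK nz) eq_gh.
by rewrite mulrAC divfK // mulrAC.
Qed.

(** Induction on the degree of the denominator of one global fraction: at a root of
    the denominator a fraction that is regular there has, after cross
    multiplication, forced the same root on the numerator, which cancels. *)
Lemma regular_on_line (phi : F -> F) :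
    (forall t0, exists g h, h.[t0] != 0 /\
       forall t, h.[t] != 0 -> phi t = g.[t] / h.[t]) ->
  exists p, forall t, phi t = p.[t].
Proof.
move=> reg.
have [g0 [h0 [nz0 gh0]]] := reg 0.
have rep0 : represents phi g0 h0.
  by split=> //; apply: contra_neq nz0 => ->; rewrite horner0.
move: {2}(size h0) (leqnn (size h0)) => n; elim: n g0 h0 rep0 {nz0 gh0} => [|n IHn] g h rep.
  by case: rep => nz_h _; rewrite leqn0 size_poly_eq0 (negPf nz_h).
have [nz_h gh] := rep => le_n.
have [sz1|/closed_rootP[t0 rt0]] := boolP (size h == 1%N).
  have /size_poly1P[c nz_c def_h] := sz1.
  exists (c^-1 *: g) => t; rewrite gh def_h ?hornerC // hornerZ mulrC.
  by [].
have [g2 [h2 [nz2 gh2]]] := reg t0.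
have rep2 : represents phi g2 h2.
  by split=> //; apply: contra_neq nz2 => ->; rewrite horner0.
have cross := represents_cross rep rep2.
have rg : root g t0.
  have := congr1 (fun p => p.[t0]) cross; rewrite !hornerM (eqP rt0) mulr0.
  by move/eqP; rewrite mulf_eq0 (negPf nz2) orbF.
have /factor_theorem[g' def_g] := rg; have /factor_theorem[h' def_h] := rt0.
have nzX : 'X - t0%:P != 0 :> {poly F} by rewrite polyXsubC_eq0.
have nz_h' : h' != 0 by apply: contra_neq nz_h => h0; rewrite def_h h0 mul0r.
apply: (IHn g' h'); last first.
  by move: le_n; rewrite def_h size_Mmonic ?monicXsubC // size_XsubC addn2.
split=> // t nz_t; have [eq_t|ne_t] := eqVneq t t0.
  have cross' : g' * h2 = g2 * h'.
    apply: (mulIf nzX); move: cross; rewrite def_g def_h => cross.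
    by rewrite -mulrA [h2 * _]mulrC mulrA cross mulrA.
  rewrite eq_t gh2 // in nz_t *; have := congr1 (horner^~ t0) cross'.
  rewrite !hornerM => eq_gh; apply: (mulIf nz_t); apply: (mulIf nz2).
  by rewrite mulrAC divfK // divfK // eq_gh.
have nzt : (t - t0) != 0 by rewrite subr_eq0.
rewrite gh def_h ?def_g !hornerM hornerXsubC ?mulf_neq0 //.
by rewrite -mulf_div divff // mulr1.
Qed.

Lemma pair1l_neq0 (b : F) : (1, b) != 0 :> F * F.
Proof. by rewrite -[X in _ != X]/(0, 0) xpair_eqE oner_eq0. Qed.

Lemma pair1r_neq0 (a : F) : (a, 1) != 0 :> F * F.
Proof. by rewrite -[X in _ != X]/(0, 0) xpair_eqE oner_eq0 andbF. Qed.

(** The restrictions of [phi] to the two affine charts are polynomials, exchanged by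
    [t |-> t^-1] up to the factor [t ^+ n]; comparing coefficients bounds the
    degree by [n]. *)
Lemma regular_binary_form (phi : F * F -> F) (n : nat) :
    (forall (t : F) (x : F * F), t != 0 -> x != 0 -> phi (t * x.1, t * x.2) = t ^+ n * phi x) ->
    (exists p : {poly F}, forall t, phi (1, t) = p.[t]) ->
    (exists p : {poly F}, forall t, phi (t, 1) = p.[t]) ->
  exists2 p : {poly F}, (size p <= n.+1)%N &
    forall x, x != 0 -> phi x = \sum_(c < n.+1) p`_c * (x.1 ^+ (n - c) * x.2 ^+ c).
Proof.
move=> hom [p pE] [q qE].
have pq t : t != 0 -> p.[t] = t ^+ n * q.[t^-1].
  move=> nz_t; rewrite -pE -qE -hom ?pair1r_neq0 //.
  by rewrite /= mulfV // mulr1.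
pose k := size q.
have revE t : t != 0 -> t ^+ k * q.[t^-1] = (\poly_(i < k.+1) q`_(k - i)).[t].
  move=> nz_t; rewrite horner_poly (horner_coef_wide _ (leqnSn k)) big_distrr /=.
  rewrite (reindex_inj rev_ord_inj) /=; apply: eq_bigr => i _; rewrite subSS.
  rewrite mulrCA; congr (_ * _); rewrite exprVn -{1}(subnK (leq_subr i k)) exprD.
  by rewrite mulfK ?expf_neq0 // subKn // -ltnS.
pose r := \poly_(i < k.+1) q`_(k - i).
have XpXr : 'X^k * p = 'X^n * r.
  apply/eqP; rewrite -subr_eq0; apply/eqP.
  suff /eqP : ('X^k * p - 'X^n * r) * 'X = 0.
    by rewrite mulf_eq0 polyX_eq0 orbF => /eqP.
  apply: poly_eq0_of_zero => t; rewrite !(hornerM, hornerD, hornerN, hornerX, hornerXn).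
  have [->|nz_t] := eqVneq t 0; first by rewrite mulr0.
  by rewrite pq // mulrCA revE // subrr mul0r.
have coef_p c : p`_c = if (c <= n)%N then q`_(n - c) else 0.
  have := congr1 (fun f : {poly F} => f`_(k + c)) XpXr.
  rewrite !coefXnM ltnNge leq_addr /= addKn => ->; rewrite coef_poly.
  have [le_cn|lt_nc] := leqP c n; last first.
    by rewrite ifF ?ifF //; lia.
  case: ifP => lt_n; first by rewrite nth_default // -/k; lia.
  by rewrite ifT; [congr (q`_ _); lia | lia].
have sz_p : (size p <= n.+1)%N.
  by apply/leq_sizeP => c lt_c; rewrite coef_p leqNgt lt_c.
exists p => //.
move=> [a b] nz_ab /=; have [a0|nz_a] := eqVneq a 0.
  have nz_b : b != 0 by apply: contra_neq nz_ab => ->; rewrite a0.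
  rewrite a0 big_ord_recr big1 /= => [|c _]; last first.
    by rewrite expr0n subn_eq0 leqNgt ltn_ord mul0r mulr0.
  rewrite subnn mul1r add0r coef_p leqnn subnn -horner_coef0 -qE mulrC -hom ?pair1r_neq0 //=.
  by rewrite mulr0 mulr1.
have -> : (a, b) = (a * 1, a * (b / a)) by rewrite mulr1 mulrC divfK.
rewrite (hom a (1, b / a)) ?pair1l_neq0 //.
rewrite pE (horner_coef_wide _ sz_p) big_distrr; apply: eq_bigr => c _ /=.
have an : a ^+ n = a ^+ (n - c) * a ^+ c by rewrite -exprD subnK // -ltnS.
by rewrite mulrCA expr_div_n an -mulrA [a ^+ c * _]mulrC divfK ?expf_neq0.
Qed.

(** The integers [0, ..., n] are distinct in characteristic zero, and so serve as
    interpolation nodes. *)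
Definition vdm n : 'M[F]_n.+1 := Vandermonde n.+1 (\row_(j < n.+1) j%:R).

Lemma vdm_unit n : vdm n \in unitmx.
Proof.
rewrite unitmxE unitfE det_Vandermonde; apply/prodf_neq0 => i _.
apply/prodf_neq0 => j lt_ij; rewrite !mxE subr_eq0 eqr_nat.
by rewrite gtn_eqF.
Qed.

Lemma vdm_coef n p c : (size p <= n.+1)%N -> (c < n.+1)%N ->
  p`_c = \sum_(j < n.+1) p.[j%:R] * invmx (vdm n) j (inord c).
Proof.
move=> sz_p lt_c; pose u : 'rV[F]_n.+1 := \row_i p`_i.
have uV : u *m vdm n = \row_j p.[j%:R].
  apply/rowP => j; rewrite !mxE (horner_coef_wide _ sz_p).
  by apply: eq_bigr => i _; rewrite !mxE.
have /rowP/(_ (inord c)) := mulmxK (vdm_unit n) u; rewrite uV !mxE inordK // => <-.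
by apply: eq_bigr => j _; rewrite mxE.
Qed.

End Line.

(** * Sections of the line bundles as multihomogeneous forms *)

Section MultiForms.
Variable F : numClosedFieldType.
Notation X := (nat -> F * F).
Implicit Types x y : X.

(** The value at homogeneous coordinates of an element regarded as a multihomogeneous
    form of degree [n] in each pair: each affine polynomial is homogenised to
    degree [n]. *)
Fixpoint hev (d : nat) (n : nat) : segring F d -> X -> F :=
  if d is d'.+1 return segring F d -> X -> F then
    fun q x => \sum_(c < n.+1)
      hev n (q : {poly segring F d'})`_c x * ((x d').1 ^+ (n - c) * (x d').2 ^+ c)
  else fun q _ => q.

(** The values of the sections of degree one, directly in the homogeneous
    coordinates. *)
Fixpoint gval (d : nat) (k : nat) (x : X) : F :=
  if d is d'.+1 then
    gval d' k./2 x * (if odd k then (x d').2 else (x d').1)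
  else 1.

Definition upd x (i : nat) v : X := fun i' => if i' == i then v else x i'.

Definition nonzero_upto (d : nat) x := forall i, (i < d)%N -> x i != 0.

Lemma updE x i v : upd x i v i = v. Proof. by rewrite /upd eqxx. Qed.

Lemma upd_neq x i i' v : i' != i -> upd x i v i' = x i'.
Proof. by rewrite /upd => /negPf->. Qed.

Lemma upd_nonzero d x i v : v != 0 ->
  (forall i', (i' < d)%N -> i' != i -> x i' != 0) -> nonzero_upto d (upd x i v).
Proof.
by move=> nz_v nz_x i' lt_i'; rewrite /upd; case: (eqVneq i' i) => [//|ne]; apply: nz_x.
Qed.

Lemma hev_ext d n (q : segring F d) x y :
  (forall i, (i < d)%N -> x i = y i) -> hev n q x = hev n q y.
Proof.
elim: d q => [|d IHd] q xy //=; apply: eq_bigr => c _.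
by rewrite xy // (IHd _ (fun i lt_i => xy i (ltnW lt_i))).
Qed.

Lemma hev0 d n x : @hev d n 0 x = 0.
Proof.
by elim: d => [|d IHd] //=; apply: big1 => c _; rewrite coef0 IHd mul0r.
Qed.

Lemma hevD d n q r x : @hev d n (q + r) x = hev n q x + hev n r x.
Proof.
elim: d q r => [|d IHd] q r //=; rewrite -big_split; apply: eq_bigr => c _.
by rewrite coefD IHd mulrDl.
Qed.

Lemma hevZ d n a q x : @hev d n (segconst F d a * q) x = a * hev n q x.
Proof.
elim: d q => [|d IHd] q //=; rewrite big_distrr; apply: eq_bigr => c _ /=.
by rewrite coefCM IHd -mulrA.
Qed.

Lemma hev_sum d n (I : Type) (s : seq I) (P : pred I) f x :
  @hev d n (\sum_(i <- s | P i) f i) x = \sum_(i <- s | P i) hev n (f i) x.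
Proof.
exact: (big_morph (fun q => hev n q x) (fun q r => hevD n q r x) (hev0 d n x)).
Qed.

Lemma hev_gen d n k q x : @segdeg F d n%:Z q ->
  hev n.+1 (gen F d k * q) x = gval d k x * hev n q x.
Proof.
elim: d k q => [|d IHd] k q /=; first by rewrite !mul1r.
case=> Dq q0; rewrite mulrAC big_distrr big_distrl /=.
case: (odd k).
  rewrite big_ord_recl -mulrA coefXM /= hev0 mul0r add0r.
  apply: eq_bigr => c _; rewrite /bump /= add1n coefXM coefCM IHd // subSS exprS /=.
  ring.
rewrite big_ord_recr /= coefCM q0; last by lia.
rewrite mulr0 hev0 mul0r addr0; apply: eq_bigr => c _.
rewrite coefCM IHd // subSn; last by rewrite -ltnS.
rewrite exprS; ring.
Qed.

Lemma hev_const0 d a x : @hev d 0 (segconst F d a) x = a.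
Proof.
by elim: d => [|d IHd] //=; rewrite big_ord1 coefC /= IHd !expr0 !mulr1.
Qed.

Lemma hev1_gen d k x : hev 1 (gen F d k) x = gval d k x.
Proof.
have := @hev_gen d 0 k 1 x; rewrite mulr1 => ->.
  by have := hev_const0 d 1 x; rewrite rmorph1 => ->; rewrite mulr1.
by have := segdeg_const d (1 : F); rewrite rmorph1.
Qed.

Lemma hev_eq0 d n q : @segdeg F d n%:Z q ->
  (forall x, nonzero_upto d x -> hev n q x = 0) -> q = 0.
Proof.
elim: d q => [|d IHd] q /=.
  by move=> _ /(_ (fun=> (1, 1))); apply=> i.
case=> Dq q0 hq; apply/polyP => c; rewrite coef0.
have [lt_nc|le_cn] := ltP n%:Z c%:Z; first exact: q0.
apply: IHd => // x nz_x.
pose p := \poly_(c < n.+1) hev n q`_c x.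
suff p0 : p = 0.
  have := congr1 (fun p : {poly F} => p`_c) p0; rewrite coef0 coef_poly.
  by rewrite ifT //; lia.
apply: poly_eq0_of_zero => t; rewrite horner_poly.
rewrite -[RHS](hq (upd x d (1, t))); last first.
  apply: upd_nonzero; first exact: pair1l_neq0.
  by move=> i lt_i ne_i; apply: nz_x; lia.
apply: eq_bigr => c' _; rewrite updE /= expr1n mul1r; congr (_ * _).
by apply: hev_ext => i lt_i; rewrite upd_neq //; lia.
Qed.

Definition binary_slice (n : nat) (phi : F * F -> F) : Prop :=
  exists2 p : {poly F}, (size p <= n.+1)%N &
    forall v, v != 0 -> phi v = \sum_(c < n.+1) p`_c * (v.1 ^+ (n - c) * v.2 ^+ c).

(** A function whose restriction to each factor is a binary form of degree [n] is
    multihomogeneous: its coefficients with respect to the last factor are linear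
    combinations of its values at the [n.+1] interpolation nodes, hence have the
    same property on the remaining factors. *)
Lemma binary_slices_hev d n (f : X -> F) :
    (forall x y, (forall i, (i < d)%N -> x i = y i) -> f x = f y) ->
    (forall x i, (i < d)%N -> nonzero_upto d x ->
       binary_slice n (fun v => f (upd x i v))) ->
  exists2 q, @segdeg F d n%:Z q & forall x, nonzero_upto d x -> f x = hev n q x.
Proof.
elim: d f => [|d IHd] f extf slf.
  by exists (f (fun=> 0)); [left | move=> x _; apply: extf].
pose fc (c : nat) x := \sum_(j < n.+1)
  f (upd x d (1, j%:R)) * invmx (vdm F n) j (inord c).
have nz_upd x v : v != 0 -> nonzero_upto d x -> nonzero_upto d.+1 (upd x d v).
  by move=> nz_v nz_x; apply: upd_nonzero => // i lt_i ne_i; apply: nz_x; lia.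
have /choice[q qP] (c : nat) : exists q, @segdeg F d n%:Z q /\
    forall x, nonzero_upto d x -> fc c x = hev n q x.
  have [||q Dq hq] := IHd (fc c); last by exists q.
    move=> x y xy; apply: eq_bigr => j _; congr (_ * _); apply: extf => i lt_i.
    rewrite /upd; case: eqP => // ne_i; apply: xy; lia.
  move=> x i lt_id nz_x.
  have /fin_all_exists2[p sz_p pE] (j : 'I_n.+1) : exists2 p : {poly F},
      (size p <= n.+1)%N & forall v, v != 0 ->
        f (upd (upd x d (1, j%:R)) i v) =
        \sum_(c < n.+1) p`_c * (v.1 ^+ (n - c) * v.2 ^+ c).
    by apply: slf; [lia | apply: nz_upd => //; apply: pair1l_neq0].
  exists (\sum_(j < n.+1) invmx (vdm F n) j (inord c) *: p j).
    by apply: leq_trans (size_sum _ _ _) _; apply/bigmax_leqP => j _;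
      apply: leq_trans (size_scale_leq _ _) _.
  move=> v nz_v; rewrite /fc.
  transitivity (\sum_(j < n.+1) \sum_(c' < n.+1)
     (invmx (vdm F n) j (inord c) * (p j)`_c') * (v.1 ^+ (n - c') * v.2 ^+ c')).
    apply: eq_bigr => j _; rewrite mulrC.
    transitivity (invmx (vdm F n) j (inord c) * f (upd (upd x d (1, j%:R)) i v)).
      congr (_ * _); apply: extf => i' lt_i'; rewrite /upd.
      by case: eqP => [->|//]; case: eqP => // eq_d; lia.
    by rewrite pE // big_distrr; apply: eq_bigr => c' _; rewrite /= mulrA.
  rewrite exchange_big; apply: eq_bigr => c' _; rewrite -big_distrl /=.
  by congr (_ * _); rewrite coef_sum; apply: eq_bigr => j _; rewrite coefZ.
exists (\poly_(c < n.+1) q c).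
  split=> c; rewrite coef_poly.
    by case: ifP => _; [have [] := qP c | apply: segdeg0].
  by move=> lt_c; rewrite ifF //; lia.
move=> x nz_x; have [p sz_p pE] := slf x d (ltnSn d) nz_x.
transitivity (f (upd x d (x d))).
  by apply: extf => i _; rewrite /upd; case: eqP => [->|].
rewrite pE ?nz_x //=; apply: eq_bigr => c _; congr (_ * _).
rewrite coef_poly ltn_ord; have [_ <-] := qP c; last first.
  by move=> i lt_i; apply: nz_x; lia.
rewrite (vdm_coef sz_p (ltn_ord c)); apply: eq_bigr => j _; congr (_ * _).
rewrite pE ?pair1l_neq0 // (horner_coef_wide _ sz_p); apply: eq_bigr => c' _ /=.
by rewrite expr1n mul1r.
Qed.

End MultiForms.

Section Multicone.
Variables (F : numClosedFieldType) (d : nat).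
Notation X := (nat -> F * F).
Implicit Types (p : multicone F d 1) (x y : X).

(** Points of the multicone as sequences indexed by all natural numbers, which makes
    recursion on the number of factors possible. *)
Definition coords p : X := fun i =>
  if insub i is Some i' then (val p (i' : 'I_d) ord0, val p i' ord_max) else 0.

Definition coords_mx x : 'M[F]_(d, 2) :=
  \matrix_(i, j) if j == ord0 then (x i).1 else (x i).2.

Lemma coordsE p (i : 'I_d) : coords p i = (val p i ord0, val p i ord_max).
Proof. by rewrite /coords valK. Qed.

Lemma coordsK p : coords_mx (coords p) = val p.
Proof.
apply/matrixP => i j; rewrite mxE coordsE /=; case: (eqVneq j ord0) => [->//|ne_j].
by congr (val p i _); apply: val_inj; case: j ne_j => -[|[|j]].
Qed.

Lemma coords_mx_ext x y :
  (forall i, (i < d)%N -> x i = y i) -> coords_mx x = coords_mx y.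
Proof. by move=> xy; apply/matrixP => i j; rewrite !mxE xy. Qed.

Lemma row_coords_mx x (i : 'I_d) : (row i (coords_mx x) != 0) = (x i != 0).
Proof.
congr negb; apply/eqP/eqP => [/rowP r0|x0].
  have := r0 ord0; have := r0 ord_max; rewrite !mxE /=.
  by case: (x i) => a b /= -> ->.
by apply/rowP => j; rewrite !mxE x0 /= if_same.
Qed.

Lemma coords_nonzero p : nonzero_upto d (coords p).
Proof.
move=> i lt_id; rewrite -[ i ]/(val (Ordinal lt_id)) -row_coords_mx coordsK.
exact: (forallP (valP p)).
Qed.

Lemma coords_lift x : nonzero_upto d x -> exists p, val p = coords_mx x.
Proof.
move=> nz_x; have nz : [forall i, row i (coords_mx x) != 0].
  by apply/forallP => i; rewrite row_coords_mx nz_x.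
by exists (exist (fun y : 'M_(d, 2) => [forall i, row i y != 0]) _ nz).
Qed.

Definition on_coords (f : multicone F d 1 -> F) x : F :=
  oapp f 0 (insub (coords_mx x)).

Lemma on_coordsK f p : on_coords f (coords p) = f p.
Proof. by rewrite /on_coords coordsK valK. Qed.

Lemma on_coordsE f p x : val p = coords_mx x -> on_coords f x = f p.
Proof. by rewrite /on_coords => <-; rewrite valK. Qed.

Lemma horner_mmap N (v : 'I_N -> {poly F}) (g : {mpoly F[N]}) t :
  (mmap polyC v g).[t] = g.@[fun k => (v k).[t]].
Proof.
rewrite /meval /mmap /= horner_sum; apply: eq_bigr => m _.
rewrite hornerM hornerC /mmap1 horner_prod; congr (_ * _).
by apply: eq_bigr => i _; rewrite horner_exp.
Qed.

(** Along a polynomial curve in one factor a regular function is regular on the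
    line, hence polynomial. *)
Lemma regular_slice (f : multicone F d 1 -> F) x (i : 'I_d) (u1 u2 : {poly F}) :
    regular f -> nonzero_upto d x -> (forall t, (u1.[t], u2.[t]) != 0) ->
  exists p : {poly F}, forall t, on_coords f (upd x i (u1.[t], u2.[t])) = p.[t].
Proof.
move=> reg nz_x nz_u; apply: regular_on_line => t0.
pose Y : 'M[{poly F}]_(d, 2) := \matrix_(i', j)
  if i' == i then (if j == ord0 then u1 else u2) else (coords_mx x i' j)%:P.
have nz_upd t : nonzero_upto d (upd x i (u1.[t], u2.[t])).
  by apply: upd_nonzero => // i' lt_i' _; apply: nz_x.
have YE t : map_mx (horner^~ t) Y = coords_mx (upd x i (u1.[t], u2.[t])).
  apply/matrixP => i' j; rewrite !mxE /upd -val_eqE.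
  by case: (val i' == val i); [case: (j == ord0) | rewrite hornerC].
have evE (g : {mpoly F[d * 2]}) t p :
    val p = coords_mx (upd x i (u1.[t], u2.[t])) ->
    (mmap polyC (fun k => mxvec Y 0 k) g).[t] = eval_at g p.
  move=> vp; rewrite horner_mmap /eval_at vp -YE; apply: meval_eq => k.
  by case/mxvec_indexP: k => i' j; rewrite !mxvecE !mxE.
have [p0 vp0] := coords_lift (nz_upd t0).
have [g [h [nz_h fE]]] := reg p0.
exists (mmap polyC (fun k => mxvec Y 0 k) g), (mmap polyC (fun k => mxvec Y 0 k) h).
split=> [|t]; first by rewrite (evE _ _ _ vp0).
have [p vp] := coords_lift (nz_upd t).
by rewrite !(evE _ _ _ vp) (on_coordsE f vp); apply: fE.
Qed.

(** Homogeneity and [regular_slice] in the two charts of a factor show that the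
    slices are binary forms. *)
Lemma section_is_form n (f : multicone F d 1 -> F) :
    H0_O (fun=> n) f ->
  exists2 q, @segdeg F d n%:Z q & forall p, f p = hev n q (coords p).
Proof.
case=> reg mh.
have [||q Dq fE] := @binary_slices_hev F d n (on_coords f).
- by move=> x y xy; rewrite /on_coords (coords_mx_ext xy).
- move=> x i lt_id nz_x; pose i' := Ordinal lt_id.
  have := (@regular_binary_form F (fun v => on_coords f (upd x i v)) n); apply => [t v nz_t nz_v| |].
  + have nz_upd w : w != 0 -> nonzero_upto d (upd x i w).
      by move=> nz_w; apply: upd_nonzero => // k lt_k _; apply: nz_x.
    have [p vp] := coords_lift (nz_upd _ nz_v).
    have nz_tv : (t * v.1, t * v.2) != 0.
      apply: contra_neq nz_v => -[/eqP]; rewrite mulf_eq0 (negPf nz_t) /= => /eqP v1.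
      move=> /eqP; rewrite mulf_eq0 (negPf nz_t) /= => /eqP v2.
      by case: v v1 v2 {vp} => a b /= -> ->.
    have [p' vp'] := coords_lift (nz_upd _ nz_tv).
    rewrite (on_coordsE f vp) (on_coordsE f vp').
    rewrite (mh p p' (\row_k if k == i' then t else 1)).
    * congr (_ * _); rewrite (bigD1 i') //= big1 => [|k ne_k].
        by rewrite mxE eqxx mulr1.
      by rewrite mxE (negPf ne_k) expr1n.
    * by move=> k; rewrite mxE; case: ifP; rewrite ?oner_eq0.
    rewrite vp vp'; apply/matrixP => k j; rewrite mul_diag_mx !mxE /upd.
    rewrite -[k == i']val_eqE /=; case: (val k == i); rewrite ?mul1r //=.
    by case: ifP.
  + have [|p pE] := @regular_slice f x i' 1 'X reg nz_x.
      by move=> t; rewrite hornerC pair1l_neq0.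
    by exists p => t; rewrite -pE hornerC hornerX.
  have [|p pE] := @regular_slice f x i' 'X 1 reg nz_x.
    by move=> t; rewrite hornerC pair1r_neq0.
  by exists p => t; rewrite -pE hornerC hornerX.
exists q => // p; rewrite -on_coordsK fE //; exact: coords_nonzero.
Qed.

Lemma hev_poly d' n (q : segring F d') : (d' <= d)%N ->
  exists g, forall p, eval_at g p = hev n q (coords p).
Proof.
elim: d' q => [|d' IHd] q lt_d.
  by exists q%:MP => p; rewrite /eval_at mevalC.
have /choice[g gE] (c : nat) : exists g, forall p, eval_at g p = hev n (q : {poly segring F d'})`_c (coords p).
  by apply: IHd; apply: ltnW.
pose i := Ordinal lt_d.
pose va j : {mpoly F[d * 2]} := 'X_(mxvec_index i j).
exists (\sum_(c < n.+1) g c * (va ord0 ^+ (n - c) * va ord_max ^+ c)) => p.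
have vaE j : eval_at (va j) p = val p i j by rewrite /eval_at mevalXU mxvecE.
rewrite /eval_at raddf_sum /=; apply: eq_bigr => c _.
have gcE := gE c p; rewrite /eval_at in gcE vaE.
by rewrite !rmorphM !rmorphXn /= gcE !vaE (coordsE p i : coords p d' = _).
Qed.

Lemma hev_scale d' n (q : segring F d') x y (t : nat -> F) :
    (forall i, (i < d')%N -> y i = (t i * (x i).1, t i * (x i).2)) ->
  hev n q y = (\prod_(i < d') t i ^+ n) * hev n q x.
Proof.
elim: d' q => [|d' IHd] q yx /=; first by rewrite big_ord0 mul1r.
rewrite [RHS]big_distrr /=; apply: eq_bigr => c _.
rewrite big_ord_recr yx //= (IHd _ (fun i lt_i => yx i (ltnW lt_i))) !exprMn.
have tn : t d' ^+ n = t d' ^+ (n - c) * t d' ^+ c.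
  by rewrite -exprD subnK // -ltnS.
by rewrite tn; ring.
Qed.

Lemma form_is_section n q : H0_O (fun=> n) (fun p => @hev F d n q (coords p)).
Proof.
split=> [p|x y t nz_t vy].
  have [g gE] := hev_poly n q (leqnn d).
  exists g, 1; rewrite /eval_at meval1 oner_eq0; split=> // p' _.
  by rewrite meval1 divr1 -/(eval_at g p') gE.
pose t' i := if insub i is Some i' then t 0 (i' : 'I_d) else 1.
rewrite (@hev_scale d n q (coords x) (coords y) t').
  by congr (_ * _); apply: eq_bigr => i _; rewrite /t' valK.
move=> i lt_i; rewrite -[ i ]/(val (Ordinal lt_i)) !coordsE vy /t' valK.
by rewrite !mul_diag_mx !mxE.
Qed.

End Multicone.

(** * Homogeneous components *)

Section Components.
Variables (F : fieldType) (N : nat).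
Notation S := {mpoly F[N]}.

Definition homcomp (j : int) (p : S) : S :=
  if 0 <= j then pihomog mdeg `|j|%N p else 0.

Lemma mcoeff_homcomp j p m :
  (homcomp j p)@_m = if (mdeg m)%:Z == j then p@_m else 0.
Proof.
rewrite /homcomp; case: (leP 0 j) => [j0|j0]; last first.
  by rewrite mcoeff0 ifF //; lia.
rewrite pihomogE raddf_sum /=.
under eq_bigr => m' _ do rewrite mcoeffZ mcoeffX.
have [dm|ndm] := eqVneq (mdeg m)%:Z j; last first.
  rewrite big1 // => m' /eqP dm'; case: eqP => [eq_m|]; last by rewrite mulr0.
  by case/eqP: ndm; rewrite -eq_m dm'; lia.
have [pm0|nz] := eqVneq p@_m 0.
  rewrite pm0 big1 // => m' _; have [->|_] := eqVneq m' m; last by rewrite mulr0.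
  by rewrite pm0 mul0r.
rewrite big_mkcond (bigD1_seq m) ?msupp_uniq ?mcoeff_msupp //= eqxx mulr1.
rewrite ifT; last by lia.
rewrite big1 ?addr0 // => m' /negPf ne_m; case: ifP => // _.
by rewrite ne_m mulr0.
Qed.

Section Rows.
Variables (r : nat) (tw : 'I_r -> nat).
Implicit Types u v : 'rV[S]_r.

Definition rowcomp (j : int) u : 'rV[S]_r :=
  \row_c homcomp (j - (tw c)%:Z) (u 0 c).

Lemma rowcomp_fdeg j u : fdeg tw j (rowcomp j u).
Proof.
move=> c m; rewrite mxE mcoeff_homcomp; case: ifP => [/eqP dm _|]; last by rewrite eqxx.
by split=> // i; rewrite leqNgt ltn_ord.
Qed.

Lemma rowcomp_sum_fdeg j (I : Type) (s : seq I) (f : I -> 'rV[S]_r) :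
  rowcomp j (\sum_(x <- s) f x) = \sum_(x <- s) rowcomp j (f x).
Proof.
apply/rowP => c; rewrite !(mxE, summxE); apply/mpolyP => m.
rewrite mcoeff_homcomp !(raddf_sum (mcoeff m)) /=; case: ifP => dm.
  by apply: eq_bigr => x _; rewrite mxE [RHS]mcoeff_homcomp dm.
by rewrite big1 // => x _; rewrite mxE [LHS]mcoeff_homcomp dm.
Qed.

Lemma rowcomp_id j k u : fdeg tw k u -> rowcomp j u = if j == k then u else 0.
Proof.
move=> Du; apply/rowP => c; apply/mpolyP => m; rewrite mxE mcoeff_homcomp.
have [u0|/Du[dm _]] := eqVneq (u 0 c)@_m 0.
  by rewrite u0 if_same; case: ifP; rewrite ?mxE ?mcoeff0 // u0.
rewrite dm; have [->|ne] := eqVneq j k; first by rewrite eqxx.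
by rewrite ifF ?mxE ?mcoeff0 //; lia.
Qed.

Lemma rowcomp_sum u : exists B : nat, u = \sum_(j < B) rowcomp j%:Z u.
Proof.
pose B := (\max_(c < r) (msize (u 0%R c) + tw c)).+1; exists B.
apply/rowP => c; rewrite summxE; apply/mpolyP => m; rewrite (raddf_sum (mcoeff m)) /=.
have [u0|nz] := eqVneq (u 0 c)@_m 0.
  by rewrite u0 big1 // => j _; rewrite mxE mcoeff_homcomp u0 if_same.
have lt_B : (mdeg m + tw c < B)%N.
  rewrite ltnS; apply: leq_trans (leq_bigmax c).
  by rewrite leq_add2r ltnW // msize_mdeg_lt // mcoeff_msupp.
rewrite (bigD1 (Ordinal lt_B)) //= mxE mcoeff_homcomp ifT; last by lia.
rewrite big1 ?addr0 // => j /eqP ne_j; rewrite mxE mcoeff_homcomp ifF //.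
by apply/eqP => eq_j; apply: ne_j; apply: val_inj => /=; lia.
Qed.

Lemma fdeg_lt0 j u : j < 0 -> fdeg tw j u -> u = 0.
Proof.
move=> j0 Du; apply/rowP => c; rewrite mxE.
by apply: hom_lt0 (Du c); lia.
Qed.

End Rows.

Lemma rowcomp_mul r r' (tw : 'I_r -> nat) (tw' : 'I_r' -> nat)
    (M : 'M[S]_(r, r')) j u :
  (forall c, fdeg tw' (tw c) (row c M)) ->
  rowcomp tw' j (u *m M) = rowcomp tw j u *m M.
Proof.
move=> grM; have DM k v : fdeg tw k v -> fdeg tw' k (v *m M).
  by apply: (gens_in_span (g := Generators tw M) (fdeg_submodule F N tw')).
have [B def_u] := rowcomp_sum tw u.
rewrite {1}def_u mulmx_suml rowcomp_sum_fdeg.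
have Ej (k : nat) : rowcomp tw' j (rowcomp tw k%:Z u *m M) =
    rowcomp tw j (rowcomp tw k%:Z u) *m M.
  rewrite (rowcomp_id _ (DM _ _ (@rowcomp_fdeg _ tw _ _))).
  rewrite (rowcomp_id _ (@rowcomp_fdeg _ tw _ _)).
  by case: ifP; rewrite ?mul0mx.
under eq_bigr => k _ do rewrite Ej.
by rewrite -mulmx_suml -rowcomp_sum_fdeg -def_u.
Qed.

(** Exactness can be tested on homogeneous elements because the maps are graded. *)
Lemma graded_exact_rows r r' r'' (tw : 'I_r -> nat) (tw' : 'I_r' -> nat)
    (M : 'M[S]_(r, r')) (M2 : 'M[S]_(r'', r)) (u : 'rV[S]_r) :
    (forall c, fdeg tw' (tw c) (row c M)) ->
    (forall j v, fdeg tw j v -> v *m M = 0 -> exists w : 'rV_r'', v = w *m M2) ->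
  u *m M = 0 -> exists w : 'rV_r'', u = w *m M2.
Proof.
move=> grM ex uM0; have [B def_u] := rowcomp_sum tw u.
have /choice[w wE] (j : nat) : exists w : 'rV_r'', rowcomp tw j%:Z u = w *m M2.
  apply: (ex j%:Z); first exact: rowcomp_fdeg.
  rewrite -(rowcomp_mul _ _ grM) uM0; apply/rowP => c; rewrite !mxE.
  by apply/mpolyP => m; rewrite mcoeff_homcomp mcoeff0 if_same.
exists (\sum_(j < B) w j); rewrite mulmx_suml {1}def_u.
by apply: eq_bigr => j _.
Qed.

End Components.

(** * The minimal resolution of the Segre ring *)

Section SegreResolution.
Variables (F : numClosedFieldType) (d : nat).
Notation S := {mpoly F[npt d]}.
Notation X := (multicone F d 1).
Notation H := (fun n => @H0_O F d 1 (fun _ => (n * 1)%N)).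

Definition seg_section (k : 'I_(npt d)) (x : X) : F := gval d k (coords x).

Lemma H_form n f : H n f <-> exists2 q, @segdeg F d n%:Z q & forall x, f x = hev n q (coords x).
Proof.
rewrite /= muln1; split=> [|[q Dq fE]]; first exact: section_is_form.
have -> : f = fun x => hev n q (coords x) by apply/funext.
exact: form_is_section.
Qed.

(** A form is determined by its values on the multicone, the field being infinite. *)
Lemma forms_eq n q r : @segdeg F d n%:Z q -> segdeg n%:Z r ->
  (forall x : X, hev n q (coords x) = hev n r (coords x)) -> q = r.
Proof.
move=> Dq Dr qr; apply/eqP; rewrite -subr_eq0; apply/eqP.
apply: (hev_eq0 (segdegB Dq Dr)) => x nz_x.
have [p vp] := coords_lift nz_x.
have -> : hev n (q - r) x = hev n (q - r) (coords p).
  apply: hev_ext => i lt_id; rewrite -[ i ]/(val (Ordinal lt_id)) coordsE vp !mxE /=.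
  by case: (x i).
rewrite -[- r]mulN1r -(rmorph1 (segconst F d)) -rmorphN hevD hevZ qr.
by rewrite mulN1r subrr.
Qed.

(** Evaluating a polynomial at the sections agrees with evaluating its image in the
    coordinate ring; homogeneity fixes the power of the line bundle in which the
    image is evaluated. *)
Lemma meval_hev (h : 'I_(npt d) -> X -> F) n (u : S) x :
    (forall k, h k x = gval d k (coords x)) -> hom (npt d) n%:Z u ->
  u.@[fun k => h k x] = hev n (segev u) (coords x).
Proof.
move=> hE hu; rewrite {1}[u]mpolyE raddf_sum /= [in RHS]/segev /mmap hev_sum.
apply: eq_big_seq => m; rewrite mcoeff_msupp => /hu[[dm] _].
rewrite hevZ mevalZ; congr (_ * _).
have -> : mmap1 (fun i : 'I_(npt d) => gen F d i) m = segev 'X_[m].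
  by rewrite /segev mmapX.
elim: n m dm {hu} => [|n IHn] m dm.
  have -> : m = 0%MM by apply/eqP; rewrite -mdeg_eq0 dm.
  rewrite mpolyX0 meval1 rmorph1; have := hev_const0 d (1 : F) (coords x).
  by rewrite rmorph1.
have [i [m' [-> dm']]] := mnm_split dm.
rewrite mpolyXD !rmorphM /= mevalXU hE IHn //.
rewrite -(mvarE F i) segev_mvar // hev_gen //; apply: segev_hom => m0.
rewrite mcoeffX; have [<- _|_] := eqVneq m' m0; last by rewrite eqxx.
by rewrite dm'; split=> // j; rewrite leqNgt ltn_ord.
Qed.

Lemma in_degree_fdeg N (E : augmented_complex F X N) i n u :
  @in_degree F X N E i n u <-> fdeg (@twist _ _ _ E i) n%:Z u.
Proof.
split=> [Du c m nz|Du j m]; last first.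
  by rewrite mcoeff_msupp => /Du[]; lia.
split=> [|j]; last by rewrite leqNgt ltn_ord.
by have := Du c m; rewrite mcoeff_msupp => /(_ nz); lia.
Qed.

Lemma seg_section_basis : is_basis H seg_section.
Proof.
have secE k x : seg_section k x = hev 1 (gen F d k) (coords x) by rewrite hev1_gen.
split=> [k|c c0 k|f /H_form[q Dq fE]].
- apply/(H_form 1); exists (gen F d k); first exact: segdeg_gen.
  by move=> x; apply: secE.
- pose a i := if insub i is Some i' then c (i' : 'I_(npt d)) else 0.
  have aE (i : 'I_(npt d)) : a i = c i by rewrite /a valK.
  rewrite -aE; have := gen_free (d := d) (a := a) _ (ltn_ord k); apply.
  apply: (@forms_eq 1).
  + apply: segdeg_sum => i _; rewrite -[1%:Z]add0r.
    by apply: segdegM; [apply: segdeg_const | apply: segdeg_gen].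
  + exact: segdeg0.
  move=> x; rewrite hev_sum hev0 -[RHS](c0 x); apply: eq_bigr => i _.
  by rewrite hevZ aE secE.
have [u hu evu] := segev_surj (sv_generated (seg_vanishingP F d)) Dq.
exists (fun k => u@_U_(k)) => x.
rewrite fE -evu -(@meval_hev seg_section) //.
rewrite {1}(hom1_sum hu) raddf_sum; apply: eq_bigr => k _.
by rewrite /= mevalZ mevalXU.
Qed.

Let gq := seg_graded_quotient (seg_vanishingP F d).

Definition seg_resolution : augmented_complex F X (npt d) :=
  @AugmentedComplex F X (npt d) (fun q => prank (syz (@segev F d) q))
    (fun q => @ptw _ _ (syz (@segev F d) q)) (res_mx (@segev F d))
    (fun _ _ => 1).

Lemma res_row_fdeg q c :
  fdeg (@ptw _ _ (syz (@segev F d) q)) (@ptw _ _ (syz (@segev F d) q.+1) c)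
    (row c (res_mx (@segev F d) q)).
Proof. exact (sub_fdeg (gp_sub (good_syz gq q)) (mg_in (syz_gens gq q) c)). Qed.

Lemma augment_seg n (u : 'rV[S]_1) x :
  fdeg (fun=> 0%N) n%:Z u ->
  @augment F X (npt d) seg_section seg_resolution u x = hev n (segev (u 0 0)) (coords x).
Proof.
move=> Du; rewrite /augment big_ord1 /= mulr1 (@meval_hev seg_section n) //.
by have := Du 0; rewrite subr0.
Qed.

Lemma seg_resolution_exact : exact_complex H seg_section seg_resolution.
Proof.
split=> [n f /H_form[q Dq fE]|n u /in_degree_fdeg Du|i u].
- have [u hu evu] := segev_surj (sv_generated (seg_vanishingP F d)) Dq.
  have Du : fdeg (fun _ : 'I_1 => 0%N) n%:Z (const_mx u).
    by move=> c; rewrite mxE subr0.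
  exists (const_mx u); first exact/in_degree_fdeg.
  by move=> x; rewrite (augment_seg _ Du) mxE evu fE.
- split=> [au0|[v def_u] x].
    have ev0 : segev (u 0 0) = 0.
      apply: (@forms_eq n); [|exact: segdeg0|].
        by apply: segev_hom; have := Du 0; rewrite subr0.
      by move=> x; rewrite -augment_seg // au0 hev0.
    have Zu : @prel _ _ (syz (@segev F d) 0) n%:Z u by [].
    by have [v _ <-] := mg_lifts (syz_gens gq 0) Zu; exists v.
  rewrite (augment_seg _ Du) def_u mxE rmorph_sum big1 ?hev0 //= => c _.
  by have [_] := mg_in (syz_gens gq 0) c; rewrite mxE rmorphM => ->; rewrite mulr0.
split=> [uM0|[v ->]].
  apply: (graded_exact_rows (@res_row_fdeg i)) uM0 => j v Dv vM0.
  have Zv : @prel _ _ (syz (@segev F d) i.+1) j v by [].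
  by have [w _ <-] := mg_lifts (syz_gens gq i.+1) Zv; exists w.
rewrite -mulmxA; suff -> : res_mx (@segev F d) i.+1 *m res_mx (@segev F d) i = 0.
  by rewrite mulmx0.
apply/row_matrixP => c; rewrite row_mul row0.
by have [_] := mg_in (syz_gens gq i.+1) c.
Qed.

Lemma seg_resolution_minimal :
  minimal_graded_free_resolution H seg_section seg_resolution.
Proof.
split.
- split=> [j|i j]; last by apply/in_degree_fdeg; apply: res_row_fdeg.
  apply/(H_form 0); exists 1.
    by have := segdeg_const d (1 : F); rewrite rmorph1.
  by move=> x; have := hev_const0 d (1 : F) (coords x); rewrite rmorph1.
- exact: seg_resolution_exact.
- by exists (npt d) => -[//|i] lt_i; apply: (res_rank_eq0 gq).
move=> i j k; have := gp_max (good_syz gq i) (mg_in (syz_gens gq i) j) k.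
by rewrite mxE.
Qed.

(** A generator of degree larger than [i.+1] in the [i]-th term would give nonzero
    Koszul homology in coefficient degree at least two. *)
Lemma seg_property_N3 p : (p <= 3)%N -> O_property_N F 1 (fun _ : 'I_d => 1%N) p.
Proof.
move=> p3; exists (npt d), seg_section, seg_resolution.
split; [exact: seg_section_basis|exact: seg_resolution_minimal|by []|].
move=> [//|i] /andP[_ le_ip] j; apply/eqP; rewrite eqn_leq.
apply/andP; split; last exact: (res_twist_ge gq).
rewrite leqNgt; apply/negP => lt_tw; apply: (res_twist gq (c := j)).
by apply: (sv_linear (seg_vanishingP F d)); rewrite /= in lt_tw *; lia.
Qed.

End SegreResolution.

(** * A fourth syzygy of degree six *)

Section Retraction.
Variables (Q : comNzRingType) (l : nat -> Q).

(** The generators for one more line, when [l] is the sequence of generators for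
    the lines at hand. *)
Definition seg_ext (k : nat) : {poly Q} :=
  if odd k then 'X * (l k./2)%:P else (l k./2)%:P.

(** The inclusion as the summand spanned by the generators of even index, those
    that do not involve the new variable. *)
Fixpoint kincl (m : nat) : koszul Q^o m -> koszul {poly Q}^o m.*2 :=
  if m is m'.+1 return koszul Q^o m -> koszul {poly Q}^o m.*2 then
    fun w => ((kincl w.1, kincl w.2), 0)
  else fun p => p%:P.

(** Setting the new variable to zero annihilates the generators of odd index, and
    commutes with the differentials. *)
Fixpoint kretr (m : nat) : koszul {poly Q}^o m.*2 -> koszul Q^o m :=
  if m is m'.+1 return koszul {poly Q}^o m.*2 -> koszul Q^o m then
    fun z => (kretr z.1.1, kretr z.1.2)
  else fun p => (p : {poly Q})`_0.

Lemma kretrD m : {morph @kretr m : u v / u + v}.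
Proof.
elim: m => [|m IHm] u v /=; first exact: coefD.
by rewrite !IHm.
Qed.

Lemma kretrN m : {morph @kretr m : u / - u}.
Proof.
elim: m => [|m IHm] u /=; first exact: coefN.
by rewrite !IHm.
Qed.

Lemma kretrZ m (a : {poly Q}) u : @kretr m (a *: u) = a`_0 *: kretr u.
Proof.
elim: m u => [|m IHm] u /=; first by rewrite [_ *: _]/(a * _) coef0M.
by rewrite !IHm.
Qed.

Lemma kretrK m : cancel (@kincl m) (@kretr m).
Proof.
elim: m => [|m IHm] u /=; first by rewrite coefC.
by rewrite !IHm; case: u.
Qed.

Lemma kd_kretr m z : kd l (@kretr m z) = kretr (kd seg_ext z).
Proof.
elim: m z => [|m IHm] z; first by rewrite /= coef0.
rewrite [LHS]/= !IHm [RHS]/= !(kretrD, kretrN, kretrZ) /seg_ext /=.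
rewrite odd_double /= uphalf_double doubleK coefC coef0M coefX !mul0r !scale0r.
by rewrite !addr0.
Qed.

Lemma kinclD m : {morph @kincl m : u v / u + v}.
Proof.
elim: m => [|m IHm] u v /=; first exact: polyCD.
by rewrite !IHm -[X in (_, X)](addr0 0).
Qed.

Lemma kincl0 m : @kincl m 0 = 0.
Proof. by have := kinclD (0 : koszul Q^o m) 0; rewrite addr0 -[LHS]addr0 => /addrI. Qed.

Lemma kinclN m : {morph @kincl m : u / - u}.
Proof. by move=> u; apply/eqP; rewrite -addr_eq0 -kinclD addNr kincl0. Qed.

Lemma kinclZ m (a : Q) u : kincl (a *: u) = a%:P *: @kincl m u.
Proof.
elim: m u => [|m IHm] u /=; first exact: polyCM.
by rewrite !IHm -[X in (_, X)](scaler0 _ a%:P).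
Qed.

Lemma kd_kincl m w : kd seg_ext (@kincl m w) = kincl (kd l w).
Proof.
elim: m w => [|m IHm] w; first by rewrite /= polyC0.
rewrite [LHS]/= !IHm kd0 scaler0 !addr0 oppr0 [RHS]/=.
rewrite kinclD kinclN kinclZ /seg_ext odd_double doubleK.
by rewrite scaler0 addr0 -[(0, 0)]/(0 : (_ * _)%type) oppr0.
Qed.

Lemma kdeg_kincl (D : int -> Q -> Prop) m p j w :
  (forall j, D j 0) -> 0 <= j -> kdeg (D : int -> Q^o -> Prop) p j w ->
  kdeg (segD D : int -> {poly Q}^o -> Prop) p j (@kincl m w).
Proof.
move=> D0 j0; have kdeg00 m' p' : kdeg (segD D : int -> {poly Q}^o -> Prop) p' j
    (0 : koszul {poly Q}^o m').
  elim: m' p' => [|m' IHm] p' /=; last by split; apply: IHm.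
  by case: ifP => // _; split=> c; rewrite coef0.
elim: m p w => [|m IHm] p w /=.
  case: ifP => _ Dw; last by rewrite Dw polyC0.
  by split=> -[|c]; rewrite coefC /=; [exact: Dw | exact: D0 | lia |].
case=> D1 D2; split; first by split; apply: IHm.
by split; apply: kdeg00.
Qed.

Lemma kdeg_kretr (D : int -> Q -> Prop) m p j z :
  kdeg (segD D : int -> {poly Q}^o -> Prop) p j z ->
  kdeg (D : int -> Q^o -> Prop) p j (@kretr m z).
Proof.
elim: m p z => [|m IHm] p z /=.
  by case: ifP => _; [case=> + _; apply | move=> ->; rewrite coef0].
by case=> [[D1 D2] _]; split; apply: IHm.
Qed.

Lemma acyclic_seg_ext (D : int -> Q -> Prop) m p j :
    (forall j, D j 0) -> 0 <= j ->
    acyclic seg_ext (segD D : int -> {poly Q}^o -> Prop) m.*2 p j ->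
  acyclic l (D : int -> Q^o -> Prop) m p j.
Proof.
move=> D0 j0 acD z Dz dz; have [||w Dw dw] := acD (kincl z).
- exact: kdeg_kincl.
- by rewrite kd_kincl dz kincl0.
exists (kretr w); first exact: kdeg_kretr.
by rewrite kd_kretr dw kretrK.
Qed.

End Retraction.

Section Coordinates.
Variables (Q : comNzRingType) (l : nat -> Q).
Implicit Types s : seq bool.

(** Coordinates with respect to the basis of the exterior algebra: [s] is the
    characteristic sequence of a set of generators, the last one first. *)
Fixpoint kcoord n s : koszul Q^o n -> Q :=
  if n is n'.+1 return koszul Q^o n -> Q then
    fun z => kcoord (behead s) (if head false s then z.2 else z.1)
  else id.

Fixpoint kbuild n (g : seq bool -> Q) : koszul Q^o n :=
  if n is n'.+1 then
    (kbuild n' (fun s => g (false :: s)), kbuild n' (fun s => g (true :: s)))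
  else g [::].

(** The signed pairs of a generator [k] outside [s] and the set [s] enlarged by
    [k], that is, the terms of the differential that contribute to the coordinate
    at [s]. *)
Fixpoint kfaces n s : seq (bool * nat * seq bool) :=
  if n is n'.+1 then
    let r := kfaces n' (behead s) in
    if head false s then [seq (~~ x.1.1, x.1.2, true :: x.2) | x <- r]
    else (false, n', true :: behead s) ::
      [seq (x.1.1, x.1.2, false :: x.2) | x <- r]
  else [::].

Definition signed (b : bool) (v : Q) := if b then - v else v.

Definition ksum (r : seq (bool * nat * seq bool)) (g : nat -> seq bool -> Q) : Q :=
  foldr (fun x v => signed x.1.1 (g x.1.2 x.2) + v) 0 r.

Lemma ksum_map r f g (b : bool) (h : seq bool -> seq bool) :
    (forall k t, g k (h t) = f k t) ->
  ksum [seq (b (+) x.1.1, x.1.2, h x.2) | x <- r] g = signed b (ksum r f).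
Proof.
move=> gf; elim: r => [|x r IHr] /=; first by case: b; rewrite /= ?oppr0.
by rewrite IHr gf; case: b {IHr}; case: x.1.1; rewrite /= ?opprD ?opprK.
Qed.

Lemma kcoordD n s : {morph @kcoord n s : u v / u + v}.
Proof. by elim: n s => [|n IHn] s u v //=; case: head; apply: IHn. Qed.

Lemma kcoord0 n s : @kcoord n s 0 = 0.
Proof. by elim: n s => [|n IHn] s //=; case: head; apply: IHn. Qed.

Lemma kcoordN n s : {morph @kcoord n s : u / - u}.
Proof. by elim: n s => [|n IHn] s u //=; case: head; apply: IHn. Qed.

Lemma kcoordZ n s a u : @kcoord n s (a *: u) = a * kcoord s u.
Proof. by elim: n s u => [|n IHn] s u //=; case: head; apply: IHn. Qed.

Lemma kcoord_build n s g : size s = n -> kcoord s (kbuild n g) = g s.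
Proof.
elim: n s g => [|n IHn] [|[] s] g //= [sz_s]; exact: (IHn s _ sz_s).
Qed.

Lemma kcoord_kd n s z : size s = n ->
  @kcoord n s (kd l z) = ksum (kfaces n s) (fun k t => l k * kcoord t z).
Proof.
elim: n s z => [|n IHn] [|b s] z //= [sz_s].
case: b => /=.
  rewrite kcoordN IHn //.
  exact/esym/(@ksum_map _ _ _ true).
rewrite kcoordD kcoordZ IHn // addrC; congr (_ + _).
exact/esym/(@ksum_map _ _ _ false).
Qed.

Lemma kcoord_ext n (u v : koszul Q^o n) :
  (forall s, size s = n -> kcoord s u = kcoord s v) -> u = v.
Proof.
elim: n u v => [|n IHn] u v uv; first exact: (uv [::]).
case: u v uv => u1 u2 [v1 v2] uv; congr (_, _); apply: IHn => s sz_s.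
  by apply: (uv (false :: s)); rewrite /= sz_s.
by apply: (uv (true :: s)); rewrite /= sz_s.
Qed.

Lemma kdeg_kcoord (D : int -> Q -> Prop) n (p : nat) j (z : koszul Q^o n) :
    D j 0 ->
    (forall s, size s = n ->
       if count id s == p then D j (kcoord s z) else kcoord s z = 0) ->
  kdeg (D : int -> Q^o -> Prop) p%:Z j z.
Proof.
move=> D0; elim: n p z => [|n IHn] p z Dz /=.
  by have := Dz [::] erefl; rewrite /= eqz_nat eq_sym; case: ifP.
split; first by apply: IHn => s sz_s; apply: (Dz (false :: s)); rewrite /= sz_s.
case: p Dz => [|p] Dz.
  rewrite (_ : z.2 = 0); last first.
    apply: kcoord_ext => s sz_s; have := Dz (true :: s); rewrite /= sz_s.
    by move=> /(_ erefl) ->; rewrite kcoord0.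
  elim: (n) (_ - 1) => [|m IHm] i /=; last by split; apply: IHm.
  by case: ifP.
have -> : p.+1%:Z - 1 = p%:Z by lia.
by apply: IHn => s sz_s; have := Dz (true :: s); rewrite /= sz_s eqSS; apply.
Qed.

Lemma kcoord_kdeg (D : int -> Q -> Prop) n p j (z : koszul Q^o n) s :
  (forall j, D j 0) -> kdeg (D : int -> Q^o -> Prop) p j z -> D j (kcoord s z).
Proof.
move=> D0; elim: n p s z => [|n IHn] p s z /=; first by case: ifP => // _ ->.
by case=> D1 D2; case: head; [apply: IHn D2 | apply: IHn D1].
Qed.

End Coordinates.

Arguments kcoord : simpl never.
Arguments kbuild : simpl never.
Arguments kfaces : simpl never.

(** A finite check over all sets of generators that computes without enumerating a
    finite type. *)
Fixpoint all_bits n (P : seq bool -> bool) : bool :=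
  if n is n'.+1 then
    all_bits n' (fun s => P (false :: s)) && all_bits n' (fun s => P (true :: s))
  else P [::].

Lemma all_bitsP n P : all_bits n P -> forall s, size s = n -> P s.
Proof.
elim: n P => [|n IHn] P /=; first by move=> P0 [|].
by case/andP=> P1 P2 [|[] s] //= [sz_s]; [apply: (IHn _ P2) | apply: (IHn _ P1)].
Qed.

Section CubeClass.
Variable F : fieldType.
Notation Q := (segring F 3).
Implicit Types (e : nat * nat * nat).

Definition bits (k : nat) : nat * nat * nat :=
  (nat_of_bool (odd k./2./2), nat_of_bool (odd k./2), nat_of_bool (odd k)).

Definition exp_add e1 e2 : nat * nat * nat :=
  ((e1.1.1 + e2.1.1)%N, (e1.1.2 + e2.1.2)%N, (e1.2 + e2.2)%N).

Definition exp_sub e1 e2 : nat * nat * nat :=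
  ((e1.1.1 - e2.1.1)%N, (e1.1.2 - e2.1.2)%N, (e1.2 - e2.2)%N).

Definition exp_le e1 e2 : bool :=
  [&& e1.1.1 <= e2.1.1, e1.1.2 <= e2.1.2 & e1.2 <= e2.2]%N.

Definition monom e : Q :=
  'X^(e.2) * ('X^(e.1.2) * ('X^(e.1.1) : {poly F})%:P : {poly {poly F}})%:P.

Definition mcoef e (w : Q) : F :=
  (((w : {poly {poly {poly F}}})`_e.2)`_e.1.2)`_e.1.1.

Lemma genS d k : gen F d.+1 k = 'X^(odd k) * (gen F d k./2)%:P.
Proof. by rewrite /=; case: odd; rewrite ?mul1r. Qed.

Lemma gen_monomE k : gen F 3 k = monom (bits k).
Proof. by rewrite !genS /= mulr1. Qed.

Lemma monomM e1 e2 : monom e1 * monom e2 = monom (exp_add e1 e2).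
Proof.
rewrite /monom /exp_add /= !exprD mulrACA -polyCM; congr (_ * _%:P).
by rewrite mulrACA -polyCM.
Qed.

Lemma gen_monom k e : gen F 3 k * monom e = monom (exp_add (bits k) e).
Proof. by rewrite gen_monomE monomM. Qed.

Lemma mcoef_gen k e w : mcoef e (gen F 3 k * w) =
  if exp_le (bits k) e then mcoef (exp_sub e (bits k)) w else 0.
Proof.
rewrite gen_monomE; move: (bits k) => [[a b] c]; case: e => -[i1 i2] i3.
rewrite /monom /mcoef /exp_le /exp_sub /=.
rewrite -mulrA coefXnM; case: ltnP => _; first by rewrite !coef0 !andbF.
rewrite coefCM -mulrA coefXnM; case: ltnP => _; first by rewrite coef0 andbF.
by rewrite coefCM coefXnM; case: ltnP.
Qed.

Lemma mcoef_monom e : mcoef e (monom e) = 1.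
Proof. by rewrite /mcoef /monom coefMC coefXn eqxx mul1r coefMC coefXn eqxx mul1r coefXn eqxx. Qed.

Lemma monom_deg e j : (e.1.1%:Z <= j) -> e.1.2%:Z <= j -> e.2%:Z <= j ->
  @segdeg F 3 j (monom e).
Proof.
move=> e1 e2 e3; have segXn d j0 i (u : segring F d) : i%:Z <= j0 -> segdeg j0 u ->
    @segdeg F d.+1 j0 ('X^i * u%:P).
  move=> le_i Du; split=> c; rewrite coefXnM coefC.
    by case: ifP => _; [|case: ifP => _ //]; apply: segdeg0.
  by move=> lt_c; case: ifP => // _; case: eqP => //; lia.
apply: (segXn 2%N) => //; apply: (segXn 1%N) => //.
rewrite -['X^_]mulr1 -[1]/(1%:P); apply: (segXn 0%N) => //; left; lia.
Qed.

Lemma mcoef_deg e (j : nat) w : @segdeg F 3 j%:Z w ->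
  ~~ [&& e.1.1 <= j, e.1.2 <= j & e.2 <= j]%N -> mcoef e w = 0.
Proof.
case=> Dw w0; rewrite /mcoef !negb_and -!ltnNge => /or3P[] lt_e.
- by have [Dw1 _] := Dw e.2; have [_ ->] := Dw1 e.1.2.
- by have [_ w01] := Dw e.2; rewrite w01 // coef0.
by rewrite w0 // !coef0.
Qed.

Fixpoint weight n (s : seq bool) : nat * nat * nat :=
  if n is n'.+1 then
    exp_add (if head false s then bits n' else (0%N, 0%N, 0%N)) (weight n' (behead s))
  else (0%N, 0%N, 0%N).

Arguments weight : simpl never.

(** The differential preserves the total torus weight.  The class lies in weight
    (3, 3, 3), the centre of the weights from 0 to 6 that occur in total degree
    6; in this weight the coefficient of a set of generators is a scalar times
    one monomial. *)
Definition coweight s := exp_sub (3%N, 3%N, 3%N) (weight 8 s).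

Definition vertex_set (A : seq nat) : seq bool :=
  [seq k \in A | k <- [:: 7; 6; 5; 4; 3; 2; 1; 0]%N].

(** Generators are indexed by the vertices of the cube, written in binary, and the
    coordinates of the cycle by sets of four of them.  The entry [true] stands
    for the coefficient -1.  The list solves the integral linear system that the
    vanishing of the differential imposes in weight (3, 3, 3), checked in
    [cube_class_cycle]. *)
Definition cube_cycle : seq (bool * seq nat) :=
  [:: (true, [:: 0; 3; 5; 6]); (false, [:: 1; 2; 4; 7]);
      (true, [:: 0; 2; 4; 7]); (true, [:: 0; 2; 3; 4]); (false, [:: 0; 2; 3; 5]);
      (false, [:: 0; 1; 4; 7]); (false, [:: 0; 1; 3; 4]); (true, [:: 0; 1; 3; 6]);
      (true, [:: 0; 1; 2; 7]); (false, [:: 0; 1; 2; 5]); (false, [:: 0; 1; 5; 6]);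
      (false, [:: 1; 2; 3; 4]); (true, [:: 1; 2; 3; 5]); (false, [:: 1; 3; 5; 6])]%N.

(** The decomposition of the cube into five tetrahedra: the one on the vertices
    with an odd number of digits 1, and the four at the other vertices, each
    spanned by such a vertex and its three neighbours. *)
Definition cube_cocycle : seq (bool * seq nat) :=
  [:: (false, [:: 1; 2; 4; 7]); (true, [:: 0; 1; 2; 4]); (false, [:: 1; 2; 3; 7]);
      (true, [:: 1; 4; 5; 7]); (false, [:: 2; 4; 6; 7])]%N.

Definition cycle_sign s : option bool :=
  ohead [seq x.1 | x <- cube_cycle & vertex_set x.2 == s].

Definition cycle_coef s : Q :=
  if cycle_sign s is Some b then signed b (monom (coweight s)) else 0.

Definition cube_class : koszul Q^o 8 := kbuild 8 cycle_coef.

Fixpoint sign_sum (r : seq (bool * nat * seq bool)) : int :=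
  if r is x :: r' then
    (if cycle_sign x.2 is Some b then (-1) ^+ (x.1.1 (+) b) else 0) + sign_sum r'
  else 0.

Definition face_ok s (x : bool * nat * seq bool) : bool :=
  (size x.2 == 8) && (cycle_sign x.2 ==> (exp_add (bits x.1.2) (coweight x.2) == coweight s)).

Lemma ksum_sign_sum s r : all (face_ok s) r ->
  ksum r (fun k t => gen F 3 k * kcoord t cube_class) = monom (coweight s) *~ sign_sum r.
Proof.
elim: r => [|x r IHr] /=; first by rewrite mulr0z.
case/andP=> /andP[/eqP sz_x ok_x] /IHr->; rewrite mulrzDr; congr (_ + _).
rewrite kcoord_build // /cycle_coef; case: (cycle_sign x.2) ok_x => [b|] /=; last first.
  by rewrite mulr0 mulr0z; case: x.1.1; rewrite /= ?oppr0.
move/eqP=> <-; rewrite -gen_monom.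
by case: x.1.1; case: b; rewrite /= ?expr0 ?expr1 ?mulrN ?opprK ?mulrNz ?mulr1z.
Qed.

(** In each coordinate the differential is a monomial times an integer, so the
    verification is a computation with integers over all 256 sets. *)
Lemma cube_class_cycle : kd (gen F 3) cube_class = 0.
Proof.
have ok : all_bits 8 (fun s => all (face_ok s) (kfaces 8 s) && (sign_sum (kfaces 8 s) == 0)).
  by vm_compute.
apply: kcoord_ext => s sz_s; have /andP[fok /eqP s0] := all_bitsP ok sz_s.
by rewrite kcoord_kd // (ksum_sign_sum fok) s0 mulr0z kcoord0.
Qed.

Lemma segdeg_signed d j b u : @segdeg F d j u -> segdeg j (signed b u).
Proof. by case: b => //; apply: segdegN. Qed.

Lemma cube_class_deg :
  kdeg (@segdeg F 3 : int -> Q^o -> Prop) 4 2 cube_class.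
Proof.
have ok : all_bits 8 (fun s => cycle_sign s ==>
    [&& count id s == 4, (coweight s).1.1 <= 2, (coweight s).1.2 <= 2 & (coweight s).2 <= 2])%N.
  by vm_compute.
apply: (kdeg_kcoord (p := 4)) => [|s sz_s]; first exact: segdeg0.
have := all_bitsP ok sz_s; rewrite kcoord_build // /cycle_coef.
case: cycle_sign => [b /and4P[c4 w1 w2 w3]|_]; last first.
  by case: (_ == _); [apply: segdeg0 | ].
by rewrite c4; apply: segdeg_signed; apply: monom_deg.
Qed.

Definition gsum (r : seq (bool * (nat * nat * nat * seq bool)))
    (G : nat * nat * nat -> seq bool -> F) : F :=
  foldr (fun x v => signed x.1 (G x.2.1 x.2.2) + v) 0 r.

(** The exponents of the monomials of degree one. *)
Definition low e : bool := [&& e.1.1 <= 1, e.1.2 <= 1 & e.2 <= 1]%N.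

(** In weight (3, 3, 3) few chains of coefficient degree one contribute to the
    coordinate at [s]: the monomial left after division by the generator must be
    [low]. *)
Definition face_terms s : seq (bool * (nat * nat * nat * seq bool)) :=
  [seq (x.1.1, (exp_sub (coweight s) (bits x.1.2), x.2)) |
    x <- kfaces 8 s & exp_le (bits x.1.2) (coweight s)
                      && low (exp_sub (coweight s) (bits x.1.2))].

Lemma mcoef_boundary (w : koszul Q^o 8) p s :
    kdeg (@segdeg F 3 : int -> Q^o -> Prop) p 1 w -> size s = 8 ->
  mcoef (coweight s) (kcoord s (kd (gen F 3) w)) =
  gsum (face_terms s) (fun e t => mcoef e (kcoord t w)).
Proof.
move=> Dw sz_s; rewrite (kcoord_kd _ _ sz_s) /face_terms.
set G := fun e t => mcoef e (kcoord t w).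
move: (coweight s) (kfaces 8 s) => e; elim=> [|x r IHr].
  by rewrite /mcoef /ksum [foldr _ _ _]/= !coef0.
have mD u v : mcoef e (u + v) = mcoef e u + mcoef e v by rewrite /mcoef !coefD.
have mS b u : mcoef e (signed b u) = signed b (mcoef e u).
  by case: b; rewrite /signed // /mcoef !coefN.
rewrite [ksum _ _]/= mD mS IHr mcoef_gen [filter _ (x :: r)]/=.
have : ~~ low (exp_sub e (bits x.1.2)) ->
    mcoef (exp_sub e (bits x.1.2)) (kcoord x.2 w) = 0.
  by have := mcoef_deg (j := 1) (kcoord_kdeg x.2 (@segdeg0 F 3) Dw); apply.
rewrite -[mcoef (exp_sub _ _) _]/(G (exp_sub e (bits x.1.2)) x.2).
move: G {IHr mD mS Dw} => G.
have signed0 : signed x.1.1 (0 : F) = 0 by case: x.1.1; rewrite /signed ?oppr0.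
case: exp_le; rewrite ?andTb ?andFb => G0; last by rewrite signed0 add0r.
case: low G0 => G0; first by [].
by rewrite G0 // signed0 add0r.
Qed.

Definition signed_sum (T : Type) (r : seq (bool * T)) (f : T -> F) : F :=
  foldr (fun x v => signed x.1 (f x.2) + v) 0 r.

Lemma signed_sum_map (T T' : Type) (h : T -> T') r (f : T -> F) (g : T' -> F) :
  (forall x, f x = g (h x)) ->
  signed_sum r f = signed_sum [seq (x.1, h x.2) | x <- r] g.
Proof. by move=> fg; elim: r => [//|x r IHr] /=; rewrite fg IHr. Qed.

Definition pairing (y : koszul Q^o 8) : F :=
  signed_sum cube_cocycle
    (fun A => mcoef (coweight (vertex_set A)) (kcoord (vertex_set A) y)).

Lemma size_vertex_set A : size (vertex_set A) = 8.
Proof. by rewrite size_map. Qed.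

(** Each of the four outer sets of [cube_cocycle] has a single contributing term,
    which the central set also has and which cancels in the signed sum. *)
Lemma pairing_boundary (w : koszul Q^o 8) p :
  kdeg (@segdeg F 3 : int -> Q^o -> Prop) p 1 w -> pairing (kd (gen F 3) w) = 0.
Proof.
move=> Dw; set G := fun e t => mcoef e (kcoord t w).
have -> : pairing (kd (gen F 3) w) =
    signed_sum [seq (x.1, face_terms (vertex_set x.2)) | x <- cube_cocycle] (gsum^~ G).
  by apply: (signed_sum_map (h := fun A => face_terms (vertex_set A))) => A;
  apply: (mcoef_boundary Dw (size_vertex_set _)).
move: G {Dw} => G.
have -> : [seq (x.1, face_terms (vertex_set x.2)) | x <- cube_cocycle] =
    let a := (0, 0, 1, vertex_set [:: 7; 6; 4; 2; 1])%N in
    let b := (0, 1, 0, vertex_set [:: 7; 5; 4; 2; 1])%N in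
    let c := (1, 0, 0, vertex_set [:: 7; 4; 3; 2; 1])%N in
    let e := (1, 1, 1, vertex_set [:: 7; 4; 2; 1; 0])%N in
    [:: (false, [:: (true, a); (true, b); (false, c); (false, e)]);
        (true, [:: (false, e)]); (false, [:: (true, c)]);
        (true, [:: (true, b)]); (false, [:: (false, a)])].
  by vm_compute.
move: (vertex_set [:: 7; 6; 4; 2; 1]%N) (vertex_set [:: 7; 5; 4; 2; 1]%N)
  (vertex_set [:: 7; 4; 3; 2; 1]%N) (vertex_set [:: 7; 4; 2; 1; 0]%N) => a b c e.
rewrite /signed_sum /gsum [LHS]/=; ring.
Qed.

(** Of the five sets only the central one occurs in [cube_cycle]. *)
Lemma pairing_cube_class : pairing cube_class = 1.
Proof.
have -> : pairing cube_class =
    signed_sum [seq (x.1, cycle_sign (vertex_set x.2)) | x <- cube_cocycle]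
      (fun b => if b is Some b' then signed b' 1 else 0).
  apply: (signed_sum_map (h := fun A => cycle_sign (vertex_set A))) => A.
  rewrite (kcoord_build _ (size_vertex_set _)) /cycle_coef.
  move: (coweight _) (cycle_sign _) => e [b|]; last by rewrite /mcoef !coef0.
  have mN u : mcoef e (- u) = - mcoef e u by rewrite /mcoef !coefN.
  by case: b; rewrite /signed ?mN mcoef_monom.
have -> : [seq (x.1, cycle_sign (vertex_set x.2)) | x <- cube_cocycle] =
    [:: (false, Some false); (true, None); (false, None); (true, None); (false, None)].
  by vm_compute.
by rewrite /signed_sum [LHS]/= !oppr0 !addr0.
Qed.

Lemma cube_not_acyclic :
  ~ acyclic (gen F 3) (@segdeg F 3 : int -> Q^o -> Prop) 8 4 2.
Proof.
move=> /(_ cube_class cube_class_deg cube_class_cycle) [w Dw dw].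
have := pairing_boundary Dw; rewrite dw pairing_cube_class.
by move/eqP; rewrite oner_eq0.
Qed.

End CubeClass.

Lemma segre_not_acyclic (F : fieldType) d : (3 <= d)%N ->
  ~ acyclic (gen F d) (@segdeg F d : int -> (segring F d)^o -> Prop) (npt d) 4 2.
Proof.
elim: d => // d IHd; rewrite leq_eqVlt => /orP[/eqP<-|lt_d].
  exact: cube_not_acyclic.
move=> ac; apply: IHd => //; apply: acyclic_seg_ext ac => //.
exact: segdeg0.
Qed.

(** * Linear substitutions *)

Section LinearSubstitution.
Variable F : fieldType.

Lemma mpoly_rmorph_ext N (R : comNzRingType) (f g : {rmorphism {mpoly F[N]} -> R}) :
  (forall a, f a%:MP = g a%:MP) -> (forall i, f 'X_i = g 'X_i) -> f =1 g.
Proof.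
move=> fC fX u; rewrite [u]mpolyE !rmorph_sum; apply: eq_bigr => m _.
rewrite -mul_mpolyC !rmorphM fC mpolyXE_id !rmorph_prod; congr (_ * _).
by apply: eq_bigr => i _; rewrite !rmorphXn /= fX.
Qed.

(** The substitution of the linear forms given by the rows of [B]. *)
Definition lin N N' (B : 'M[F]_(N, N')) : {mpoly F[N]} -> {mpoly F[N']} :=
  mmap (@mpolyC N' F) (fun c => \sum_k B c k *: 'X_k).

HB.instance Definition _ N N' B := GRing.RMorphism.on (@lin N N' B).

Lemma linC N N' (B : 'M[F]_(N, N')) a : lin B a%:MP = a%:MP.
Proof. exact: mmapC. Qed.

Lemma linX N N' (B : 'M[F]_(N, N')) i : lin B 'X_i = \sum_k B i k *: 'X_k.
Proof. by rewrite /lin mmapX mmap1U. Qed.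

Lemma linZ N N' (B : 'M[F]_(N, N')) a u : lin B (a *: u) = a *: lin B u.
Proof. by rewrite -!mul_mpolyC rmorphM /= linC. Qed.

Lemma lin_mul N N' N'' (A : 'M[F]_(N, N')) (B : 'M[F]_(N', N'')) u :
  lin B (lin A u) = lin (A *m B) u.
Proof.
apply: (mpoly_rmorph_ext (f := lin B \o lin A) (g := lin (A *m B))) u => [a|i] /=.
  by rewrite !linC.
rewrite !linX rmorph_sum /=; under eq_bigr => k _ do rewrite linZ linX scaler_sumr.
rewrite exchange_big /=; apply: eq_bigr => k _; rewrite mxE scaler_suml.
by apply: eq_bigr => j _; rewrite scalerA.
Qed.

Lemma lin1 N u : lin (1%:M : 'M[F]_N) u = u.
Proof.
apply: (mpoly_rmorph_ext (f := lin 1%:M) (g := idfun)) u => [a|i] /=.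
  by rewrite linC.
rewrite linX (bigD1 i) //= big1 ?addr0 => [|k /negPf ne_k].
  by rewrite mxE eqxx scale1r.
by rewrite mxE eq_sym ne_k scale0r.
Qed.

Lemma meval_lin N N' (B : 'M[F]_(N, N')) u (v : 'I_N' -> F) :
  (lin B u).@[v] = u.@[fun c => \sum_k B c k * v k].
Proof.
apply: (mpoly_rmorph_ext (f := meval v \o lin B)
          (g := meval (fun c => \sum_k B c k * v k))) u => [a|i] /=.
  by rewrite linC !mevalC.
rewrite linX mevalXU raddf_sum; apply: eq_bigr => k _ /=.
by rewrite mevalZ mevalXU.
Qed.

Lemma lin_hom N N' (B : 'M[F]_(N, N')) j u : hom N j u -> hom N' j (lin B u).
Proof.
move=> hu; rewrite /lin /mmap big_seq; apply: hom_sum => m.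
rewrite mcoeff_msupp => /hu[dm _]; rewrite -[j]add0r; apply: homM; first exact: homC.
rewrite -dm mdegE /mmap1 (big_morph Posz PoszD (erefl 0%:Z)).
have hom1 : hom N' 0 (1 : {mpoly F[N']}) by rewrite -mpolyC1; apply: homC.
elim/big_ind2: _ => [//|a x b y Da Db|i _]; first exact: homM.
elim: (m i) => [//|n IHn]; rewrite exprS -add1n PoszD; apply: homM => //.
apply: hom_sum => k _; rewrite -mul_mpolyC -[1%N%:Z]add0r; apply: homM; first exact: homC.
by rewrite -mvarE; apply: hom_mvar.
Qed.

(** A linear change of coordinates carries the Koszul complex of the variables
    to that of any other generating system of linear forms. *)
Lemma lin_acyclic N M (A : 'M[F]_(M, N)) (B : 'M[F]_(N, M)) (p j : int) :
    A *m B = 1%:M -> B *m A = 1%:M -> (p != 0) || (j != 0) ->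
  acyclic (fun k => lin A (mvar F M k))
    (hom N : int -> {mpoly F[N]}^o -> Prop) M p j.
Proof.
move=> AB BA pj; have := @hom_acyclic F M M p j (leqnn M) pj.
have hA k : (k < M)%N -> hom N 1 (lin A (mvar F M k)).
  by move=> lt_k; apply/lin_hom/hom_mvar.
apply: (acyclic_retract (U := {mpoly F[N]}^o) (U' := {mpoly F[M]}^o)
  (f := lin A) (g := lin B)).
- split=> [i|i u v|i k u lt_i hu]; [exact: hom0|exact: homB|].
  by rewrite addrC; apply: homM => //; apply: hA.
- by apply: graded_hom; rewrite leqnn.
- exact: rmorphB.
- exact: rmorphB.
- by move=> i u _; apply: (rmorphM (lin A)).
- by move=> i u _; rewrite (rmorphM (lin B)) /= lin_mul AB lin1.
- by move=> i u; apply: lin_hom.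
- by move=> i u; apply: lin_hom.
by move=> u; rewrite /= lin_mul BA lin1.
Qed.

End LinearSubstitution.

Lemma basis_change (F : closedFieldType) (X : Type) (H : nat -> (X -> F) -> Prop)
    N N' (s : 'I_N -> X -> F) (s' : 'I_N' -> X -> F) :
    is_basis H s -> is_basis H s' ->
  exists (A : 'M[F]_(N', N)) (B : 'M[F]_(N, N')),
    [/\ A *m B = 1%:M, B *m A = 1%:M
      & forall c x, s c x = \sum_k B c k * s' k x].
Proof.
have expand M M' (t : 'I_M -> X -> F) (t' : 'I_M' -> X -> F) :
    is_basis H t -> is_basis H t' ->
    exists A : 'M[F]_(M', M), forall k x, t' k x = \sum_c A k c * t c x.
  case=> _ _ gen_t [Ht' _ _].
  have /fin_all_exists[a aE] k := gen_t _ (Ht' k).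
  by exists (\matrix_(k, c) a k c) => k x; rewrite aE; apply: eq_bigr => c _; rewrite mxE.
have inverse M M' (t : 'I_M -> X -> F) (t' : 'I_M' -> X -> F)
    (A : 'M[F]_(M', M)) (B : 'M[F]_(M, M')) :
    is_basis H t -> (forall k x, t' k x = \sum_c A k c * t c x) ->
    (forall c x, t c x = \sum_k B c k * t' k x) -> B *m A = 1%:M.
  case=> _ free_t _ tA tB; apply/matrixP => i j; apply/eqP; rewrite -subr_eq0.
  apply/eqP; apply: (free_t (fun j => (B *m A) i j - (1%:M : 'M_M) i j)) => x.
  under eq_bigr => c _ do rewrite mulrBl.
  rewrite sumrB [X in _ - X](bigD1 i) //= [X in _ - (_ + X)]big1 => [|c /negPf ne_c].
    rewrite mxE eqxx mul1r addr0 [X in _ - X]tB; apply/eqP; rewrite subr_eq0; apply/eqP.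
    under eq_bigr => c _ do rewrite mxE mulr_suml.
    rewrite exchange_big /=; apply: eq_bigr => k _.
    by rewrite tA mulr_sumr; apply: eq_bigr => c _; rewrite mulrA.
  by rewrite mxE eq_sym ne_c mul0r.
move=> bs bs'; have [A tA] := expand _ _ _ _ bs bs'; have [B tB] := expand _ _ _ _ bs' bs.
by exists A, B; split=> //; [apply: (inverse _ _ s' s) | apply: (inverse _ _ s s')].
Qed.

(** * Koszul homology along a free resolution *)

(** The map of graded modules defined by [A], from a free module onto [Z], may be
    used in [acyclic_coker]: homogeneous preimages are obtained by taking
    components. *)
Lemma acyclic_image (F : fieldType) (N M : nat) (l : nat -> {mpoly F[N]}) r r'
    (tw : 'I_r -> nat) (tw' : 'I_r' -> nat) (A : 'M[{mpoly F[N]}]_(r, r'))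
    (Z : int -> 'rV[{mpoly F[N]}]_r' -> Prop) p j :
    (forall k, (k < M)%N -> hom N 1 (l k)) ->
    (forall c, fdeg tw' (tw c) (row c A)) ->
    (forall k v, Z k v <-> fdeg tw' k v /\ exists w, v = w *m A) ->
    acyclic l (fdeg tw) M p j ->
    acyclic l (gker (fdeg tw) (fun _ u => u *m A)) M (p - 1) (j + 1) ->
  acyclic l Z M p j.
Proof.
move=> hom_l grA ZE.
apply: (acyclic_coker (l := l) (D := fdeg tw) (f := fun _ u => u *m A)).
- exact: (@graded_fdeg F N r tw l M hom_l M (leqnn M)).

- by move=> _ u v; rewrite mulmxBl.
- by move=> i k u _ _; rewrite -scalemxAl.
- move=> k u Du; apply/ZE; split; last by exists u.
  exact: (gens_in_span (g := Generators tw A) (fdeg_submodule F N tw')) grA Du.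
move=> k v /ZE[Dv [w def_v]]; exists (rowcomp tw k w); first exact: rowcomp_fdeg.
by rewrite -(rowcomp_mul _ _ grA) -def_v (rowcomp_id _ Dv) eqxx.
Qed.

Section FromResolution.
Variables (F : numClosedFieldType) (d N : nat).
Notation S := {mpoly F[N]}.
Notation X := (multicone F d 1).
Notation H := (fun n => @H0_O F d 1 (fun _ => (n * 1)%N)).
Variables (s : 'I_N -> X -> F) (E : augmented_complex F X N).
Hypotheses (bs : is_basis H s) (grE : graded H E) (exE : exact_complex H s E).
Notation tw i := (@twist _ _ _ E i).

(** The sections of all powers are polynomials in those of degree one. *)
Lemma section_poly n f : H n f ->
  exists2 p, hom (npt d) n%:Z p & forall x, f x = p.@[fun k => seg_section k x].
Proof.
case/H_form=> q Dq fE.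
have [p hp evp] := segev_surj (sv_generated (seg_vanishingP F d)) Dq.
by exists p => // x; rewrite fE -evp -(@meval_hev _ _ (@seg_section F d)).
Qed.

(** Let [Z q] be the image of the differential onto the [q]-th term, or the ideal
    of relations for [q = 0].  The long exact sequences move the homology of the
    coordinate ring at [p] and [2] to that of [Z q] at [p - 1 - q] and [q + 3],
    as long as the exterior degree of the free term in between is positive.  At
    [q = p - 1] this exterior degree is zero and the coefficient degree is
    [p + 2]; the free module generated in degree [p + 1] has no homology there. *)
Lemma linear_twist_seg_acyclic p : (0 < p)%N ->
  (forall j : 'I_(rank E p), twist j = p.+1) -> seg_acyclic F d p%:Z 2.
Proof.
move=> p0 twp; have [A [B [AB BA sE]]] := basis_change bs (seg_section_basis F d).
(* The linear forms in the given sections that represent the monomials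
   [gen F d k]: they make the coordinate ring a module over the polynomial
   ring of the resolution with the expected Koszul complex. *)
pose l k := lin A (mvar F (npt d) k).
have hom_l k : (k < npt d)%N -> hom N 1 (l k).
  by move=> lt_k; apply/lin_hom/hom_mvar.
have l_acyclic a b : (a != 0) || (b != 0) ->
    acyclic l (hom N : int -> S^o -> Prop) (npt d) a b by apply: (lin_acyclic AB BA).
case: grE => gr_aug gr_diff; case: exE => ex_G ex_0 ex_i.
have gr_row i c : fdeg (tw i) (tw i.+1 c) (row c (diff E i)) by apply/in_degree_fdeg.
have /fin_all_exists2[g hg gE] c := section_poly (gr_aug c).
pose psi (u : 'rV[S]_(rank E 0)) := \sum_c lin B (u 0 c) * g c.
have psiB : {morph psi : u v / u - v}.
  move=> u v; rewrite /psi -sumrB; apply: eq_bigr => c _.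
  by rewrite !mxE rmorphB /= mulrBl.
have psiZ a u : psi (a *: u) = lin B a * psi u.
  by rewrite /psi mulr_sumr; apply: eq_bigr => c _; rewrite mxE rmorphM /= mulrA.
have psi_hom k u : fdeg (tw 0) k u -> hom (npt d) k (psi u).
  move=> Du; apply: hom_sum => c _; rewrite -[k](subrK (tw 0 c)%:Z).
  by apply: homM => //; apply: lin_hom.
have psi_aug u x : augment s u x = (psi u).@[fun k => seg_section k x].
  rewrite /augment /psi raddf_sum; apply: eq_bigr => c _ /=.
  rewrite mevalM gE meval_lin; congr (_ * _).
  by apply: meval_eq => k; rewrite sE.
have psi_ker (n : nat) u : fdeg (tw 0) n%:Z u ->
    segev (psi u) = 0 <-> exists v, u = v *m diff E 0.
  move=> Du; rewrite -ex_0; last exact/in_degree_fdeg.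
  have evE x : augment s u x = hev n (segev (psi u)) (coords x).
    by rewrite psi_aug (@meval_hev _ _ (@seg_section F d) n) //; apply: psi_hom.
  split=> [ev0 x|au0]; first by rewrite evE ev0 hev0.
  apply: (@forms_eq F d n); [|exact: segdeg0|].
    exact/segev_hom/psi_hom.
  by move=> x; rewrite -evE au0 hev0.
pose ev (_ : int) (u : 'rV[S]_(rank E 0)) : (segring F d)^o := segev (psi u).
pose Z q : int -> 'rV[S]_(rank E q) -> Prop :=
  if q is q'.+1 return int -> 'rV[S]_(rank E q) -> Prop
  then gker (fdeg (tw q'.+1)) (fun _ u => u *m diff E q')
  else gker (fdeg (tw 0)) ev.
have evZ i k u : (i < npt d)%N -> fdeg (tw 0) k u ->
    ev (k + 1) (l i *: u) = (segev (mvar F (npt d) i) : segring F d) *: ev k u.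
  by move=> _ _; rewrite /ev psiZ rmorphM /= lin_mul AB lin1.
have evB k : {morph ev k : u v / u - v}.
  by move=> u v; rewrite /ev psiB rmorphB.
have gr_fdeg i : graded_module l (fdeg (tw i)) (npt d)
  by exact: (@graded_fdeg F N _ (tw i) l _ hom_l _ (leqnn _)).
have gr_Z q : graded_module l (Z q) (npt d).
  case: q => [|q]; first exact: (graded_gker (gr_fdeg 0%N) evB evZ).
  apply: (graded_gker (gr_fdeg q.+1)) => [_ u v|i k u _ _].
    by rewrite mulmxBl.
  by rewrite -scalemxAl.
have ZE q k v : Z q k v <-> fdeg (tw q) k v /\ exists w, v = w *m diff E q.
  case: q v => [|q] v; last first.
    by split=> -[Dv exv]; split=> //; apply/ex_i.
  have [k0|k0] := leP 0 k.
    by rewrite -[k]gez0_abs //; split=> -[Dv exv]; split=> //; apply/(psi_ker `|k|%N).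
  split=> -[/(fdeg_lt0 k0)-> _].
    by split; [apply: fdeg0 | exists 0; rewrite mul0mx].
  by apply: (gr0 (gr_Z 0%N)).
have Z_acyclic (n q : nat) : (q + n.+1)%N = p -> acyclic l (Z q) (npt d) n%:Z (q%:Z + 3).
  elim: n q => [|n IHn] q eq_p; apply: (acyclic_image hom_l (@gr_row q) (@ZE q)).
  - rewrite addn1 in eq_p; rewrite -eq_p in twp.
    apply: (@cycles_bound_row _ l (rank E q.+1)
      (fun c k => hom N (k - (tw q.+1 c)%:Z)) (fun c k => hom N (k - (tw q.+1 c)%:Z))) => c.
    apply: cycles_bound_shift; apply: l_acyclic; rewrite twp; lia.
  - by apply: (acyclic_out (gr_Z q.+1)).
  - by apply: (fdeg_acyclic l_acyclic).
  have := IHn q.+1; rewrite addSnnS => /(_ eq_p).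
  have -> : n.+1%:Z - 1 = n%:Z :> int by lia.
  by have -> : q%:Z + 3 + 1 = q.+1%:Z + 3 :> int by lia.
apply: (acyclic_coker (D := fdeg (tw 0)) (f := ev) (gr_fdeg 0%N) evB evZ).
- by move=> k u /psi_hom; apply: segev_hom.
- move=> k v Dv; have [k0|k0] := leP 0 k; last first.
    exists 0; first exact: fdeg0.
    by rewrite (segdeg_lt0 k0 Dv) -[X in ev _ X](subrr 0) evB subrr.
  rewrite -[k]gez0_abs // in Dv *; set n := `|k|%N in Dv *.
  have [|u /in_degree_fdeg Du uE] := ex_G n (fun x => hev n v (coords x)).
    by apply/H_form; exists v.
  exists u => //; apply: (@forms_eq F d n) => // [|x].
    exact/segev_hom/psi_hom.
  rewrite -uE psi_aug (@meval_hev _ _ (@seg_section F d) n) //; exact: psi_hom.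
- by apply: (fdeg_acyclic l_acyclic); lia.
have := Z_acyclic p.-1 0%N; rewrite add0n prednK // => /(_ erefl).
have -> : p.-1%:Z = p%:Z - 1 by lia.
by rewrite add0r.
Qed.

End FromResolution.

(** * Property N_p for products of lines *)

Lemma segre_property_N (F : numClosedFieldType) d p : (3 <= d)%N ->
  O_property_N F 1 (fun _ : 'I_d => 1%N) p <-> (p <= 3)%N.
Proof.
move=> d3; split=> [[N [s [E [bs [grE exE _ _] _ twE]]]]|]; last exact: seg_property_N3.
rewrite leqNgt; apply/negP => p4; apply: (segre_not_acyclic (F := F) d3).
apply: (eq_acyclic (l := fun k => segev (mvar F (npt d) k))) => [k lt_k|].
  exact: segev_mvar.
apply: (linear_twist_seg_acyclic bs grE exE (p := 4)) => // j.
by apply: twE; rewrite p4.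
Qed.

Theorem corollary9 (R : realType) (d p : nat) (hd : (3 <= d)%N) :
  O_property_N (complex R) 1 (fun _ : 'I_d => 1%N) p <-> (p <= 3)%N.
Proof. exact: (segre_property_N _ _ hd). Qed.
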